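(* Smooth solutions to the Saint-Venant–Maxwell system $$\begin{aligned} &\partial_t(H\boldsymbol U)+\operatorname{div}_H\Big(H\boldsymbol U\otimes\boldsymbol U+\big(\tfrac g2H^2+\mathcal G_\epsilon A^{cc}H^3\big)\boldsymbol I-\mathcal G_\epsilon H\boldsymbol F^H\boldsymbol A^H(\boldsymbol F^H)^T\Big)=-gH\nabla_Hz_b-kH\boldsymbol U,\\ &\partial_tH+\operatorname{div}_H(H\boldsymbol U)=0,\\ &\partial_t(H\boldsymbol F^H)+\operatorname{div}_H(H\boldsymbol U\otimes\boldsymbol F^H-H\boldsymbol F^H\otimes\boldsymbol U)=0,\\ &\partial_t(H\boldsymbol A^H)+\operatorname{div}_H(H\boldsymbol U\boldsymbol A^H)=H\big(((\boldsymbol F^H)^T\boldsymbol F^H)^{-1}-\boldsymbol A^H\big)/\lambda,\\ &\partial_t(HA^{cc})+\operatorname{div}_H(H\boldsymbol UA^{cc})=H\big(H^{-2}-A^{cc}\big)/\lambda, \end{aligned}$$ with $\boldsymbol A^H\in S^{++}(\mathbb R^{2\times2})$, $A^{cc}>0$, are in bijection with smooth solutions $q=(H,H\boldsymbol U,H\boldsymbol F^H,H\boldsymbol Y^H,HY^{cc})$ to the system (S) consisting of the first three equations above together with $$\begin{aligned} &\partial_t(H\boldsymbol Y^H)+\operatorname{div}_H(H\boldsymbol U\boldsymbol Y^H)=-H\,\boldsymbol Y^H\big(\boldsymbol Z^H-\boldsymbol Y^H\big)\boldsymbol Y^H/\lambda,\\ &\partial_t(HY^{cc})+\operatorname{div}_H(H\boldsymbol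 UY^{cc})=H\big(H^{-2}(Y^{cc})^{-3}-Y^{cc}\big)/(4\lambda), \end{aligned}$$ when $\boldsymbol A^H=(\boldsymbol Y^H)^{-1/2}$ is defined componentwise by identification with the square-root matrix-inverse of $\boldsymbol Y^H=(Y^{\alpha\beta})\in S^{++}(\mathbb R^{2\times2})$, $A^{cc}=(Y^{cc})^4$, $\boldsymbol Z^H:=(\boldsymbol A^H\boldsymbol F^H(\boldsymbol F^H)^T)^{-1}+(\boldsymbol F^H(\boldsymbol F^H)^T\boldsymbol A^H)^{-1}$, and we recall $H|\boldsymbol F^H|=\hat H>0$. Furthermore, with $\boldsymbol\Sigma^H=\mathcal G_\epsilon\boldsymbol F^H\boldsymbol A^H(\boldsymbol F^H)^T$ and $\Sigma^{zz}=\mathcal G_\epsilon A^{cc}H^2$, for some algebraic term $\tilde D$ without sign a priori, the functional $$\tilde E=\frac H2\Big(|\boldsymbol U|^2+gH+\big(\operatorname{tr}\boldsymbol\Sigma^H+\Sigma^{zz}+\operatorname{tr}(\boldsymbol Y^H\boldsymbol Y^H)\big)\Big),$$ strictly convex in $q\in\mathcal A^+_H:=\{H>0,\ \boldsymbol Y^H=(\boldsymbol Y^H)^T>0,\ Y^{cc}>0\}$, satisfies $$\partial_t\tilde E+\operatorname{div}_H\Big(\boldsymbol U\big(\tilde E+\tfrac g2H^2\big)+H(\Sigma^{zz}-\boldsymbol\Sigma^H)\cdot\boldsymbol U\Big)=-kH|\boldsymbol U|^2-gH\boldsymbol U\cdot\nabla_Hz_b-H\tilde D .$$ Thus $\tilde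 E$ defines a mathematical entropy for (S), this last law defines a strictly convex extension for (S), and (S) is a symmetric-hyperbolic system of conservation laws on the open set $\mathcal A^+_H\equiv\{H>0,\ \boldsymbol A^H=(\boldsymbol A^H)^T>0,\ A^{cc}>0\}$.
   Context: Two space dimensions $(x,y)$: Latin indices $i,j\in\{x,y\}$ are spatial, Greek indices $\alpha,\beta\in\{a,b\}$ material; repeated indices are summed. $H>0$ is the water depth, $\boldsymbol U$ the depth-averaged velocity, $\boldsymbol F^H=(F^i_\alpha)$ the invertible $2\times2$ horizontal deformation gradient of the motion, with determinant $|\boldsymbol F^H|$. $\nabla_H=(\partial_x,\partial_y)$; $\operatorname{div}_H$ is the 2D divergence acting on the first tensor index, so the $\boldsymbol F^H$-equation reads $\partial_t(HF^i_\alpha)+\partial_j(HU^jF^i_\alpha-HF^j_\alpha U^i)=0$. $S^{++}(\mathbb R^{2\times2})$ is the set of symmetric positive definite matrices, $\boldsymbol I$ the identity (in the energy flux, $\Sigma^{zz}-\boldsymbol\Sigma^H$ means $\Sigma^{zz}\boldsymbol I-\boldsymbol\Sigma^H$), $\operatorname{tr}$ the trace. $g,\mathcal G_\epsilon,\lambda,\hat H>0$ and the friction parameter $k$ are given ($\epsilon$ is a fixed small parameter), and $z_b(x,y)$ is a given smooth topography. Terminology: for a system of conservation laws (with algebraic source terms) in a state variable $q$, a mathematical entropy is a strictly convex function of $q$ for which smooth solutions satisfy an additional conservation law (with algebraic source terms); that additional law is called a strictly convex extension. The system is symmetric-hyperbolic if it can be symmetrized in the sense of Friedrichs, i.e. (Godunov–Mock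 theorem) by the Hessian of a mathematical entropy.
   Formalization: The bijection uses the corrected source -HY(Z-2Y^{-1})Y/λ, Z=(A^{-1}F^TF)^{-1}+(F^TFA^{-1})^{-1}, as it fails for the printed one; symmetrization holds modulo div_H(HF_α)=0, and the energy law is for F the deformation gradient of a motion. *)

(* Defs.v *)
From HB Require Import structures.
From mathcomp Require Import all_boot all_order all_algebra.
From mathcomp Require Import all_classical all_reals all_analysis.

Set Implicit Arguments.
Unset Strict Implicit.
Unset Printing Implicit Defensive.

Import Order.TTheory GRing.Theory Num.Theory.
Import numFieldNormedType.Exports.

Local Open Scope classical_set_scope.
Local Open Scope ring_scope.

Section Matrices.
Context {R : realType}.

Definition dot n (u v : 'rV[R]_n) : R := (u *m v^T) 0 0.

Definition spd n (A : 'M[R]_n) : Prop :=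
  A^T = A /\ forall v : 'rV[R]_n, v != 0 -> 0 < dot (v *m A) v.

(* The matrix Y^(-1/2): the symmetric positive definite square root of the
   inverse of Y, which exists and is unique when Y is itself symmetric positive
   definite; the value is irrelevant for other Y. *)
Definition invsqrtmx n (Y : 'M[R]_n.+1) : 'M[R]_n.+1 :=
  get [set A : 'M[R]_n.+1 | spd A /\ A *m A = invmx Y].

Definition unitv n (i : 'I_n) : 'rV[R]_n := delta_mx 0 i.

End Matrices.

Section Calculus.
Context {R : realType}.

Fixpoint differentiable_upto (V : normedModType R) n (k : nat)
    (D : set 'rV[R]_n.+1) (f : 'rV[R]_n.+1 -> V) : Prop :=
  match k with
  | 0 => forall p, D p -> {for p, continuous f}
  | k'.+1 => (forall p, D p -> differentiable f p) /\
      forall i, differentiable_upto k' D (fun p => 'D_(unitv i) f p)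
  end.

(* C^infinity on D, meant for open D. *)
Definition smooth_on (V : normedModType R) n
    (D : set 'rV[R]_n.+1) (f : 'rV[R]_n.+1 -> V) : Prop :=
  forall k, differentiable_upto k D f.

Definition grad n (f : 'rV[R]_n.+1 -> R) (p : 'rV[R]_n.+1) : 'rV[R]_n.+1 :=
  \row_i 'D_(unitv i) f p.

Definition hessian n (f : 'rV[R]_n.+1 -> R) (p : 'rV[R]_n.+1) : 'M[R]_n.+1 :=
  \matrix_(i, j) 'D_(unitv i) (fun p' => 'D_(unitv j) f p') p.

Definition strictly_convex_on n (D : set 'rV[R]_n) (f : 'rV[R]_n -> R) : Prop :=
  forall (x y : 'rV[R]_n) (s : R), D x -> D y -> x != y -> 0 < s < 1 ->
    D ((1 - s) *: x + s *: y) /\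
    f ((1 - s) *: x + s *: y) < (1 - s) * f x + s * f y.

(* Points of 'rV_3 are (t, x, y) (or (t, a, b) in material coordinates). *)
Definition space_of (p : 'rV[R]_3) : 'rV[R]_2 := \row_j p 0 (lift ord0 j).

Definition with_space (p : 'rV[R]_3) (x : 'rV[R]_2) : 'rV[R]_3 :=
  \row_i if unlift ord0 i is Some j then x 0 j else p 0 i.

Definition dt (V : normedModType R) (f : 'rV[R]_3 -> V) (p : 'rV[R]_3) : V :=
  'D_(unitv ord0) f p.

Definition dx (V : normedModType R) (j : 'I_2) (f : 'rV[R]_3 -> V)
  (p : 'rV[R]_3) : V := 'D_(unitv (lift ord0 j)) f p.

End Calculus.

Section BalanceLaws.
Context {R : realType}.

Record balance_law (n : nat) := BalanceLaw {
  flux : 'I_2 -> 'rV[R]_n -> 'rV[R]_n ;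
  source : 'rV[R]_2 -> 'rV[R]_n -> 'rV[R]_n
}.

Definition satisfies n (S : balance_law n.+1) (Om : set 'rV[R]_3)
    (q : 'rV[R]_3 -> 'rV[R]_n.+1) : Prop :=
  forall p, Om p ->
    dt q p + \sum_(j < 2) dx j (flux S j \o q) p = source S (space_of p) (q p).

(* [Sol Om q] is to be read: q is a smooth solution on the open set Om.
   The entropy source sigma may depend on the position, through z_b. *)
Definition strictly_convex_extension n
    (Sol : set 'rV[R]_3 -> ('rV[R]_3 -> 'rV[R]_n.+1) -> Prop)
    (D : set 'rV[R]_n.+1) (eta : 'rV[R]_n.+1 -> R)
    (zeta : 'I_2 -> 'rV[R]_n.+1 -> R)
    (sigma : 'rV[R]_2 -> 'rV[R]_n.+1 -> R) : Prop :=
  [/\ strictly_convex_on D eta, smooth_on D eta,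
      forall j, smooth_on D (zeta j)
    & forall (Om : set 'rV[R]_3) q, open Om -> Sol Om q ->
        forall p, Om p ->
          dt (eta \o q) p + \sum_(j < 2) dx j (zeta j \o q) p
          = sigma (space_of p) (q p)].

Definition mathematical_entropy n
    (Sol : set 'rV[R]_3 -> ('rV[R]_3 -> 'rV[R]_n.+1) -> Prop)
    (D : set 'rV[R]_n.+1) (eta : 'rV[R]_n.+1 -> R) : Prop :=
  exists zeta sigma, strictly_convex_extension Sol D eta zeta sigma.

(* Friedrichs symmetrization by the Hessian of an entropy. With row vectors,
   the quasilinear form of the system is
     dt q + sum_j dx_j q *m jacobian (flux j) q = source,
   and multiplication by the Hessian on the right must produce a system
     dt q *m hessian + sum_j dx_j q *m B_j = source *m hessian
   with symmetric B_j. The predicate [invol], on pairs p standing for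
   (dx_0 q, dx_1 q), is the linear differential constraint satisfied by the
   solutions, modulo which the two forms of the system coincide. *)
Definition hessian_symmetrizes n (S : balance_law n.+1)
    (invol : ('I_2 -> 'rV[R]_n.+1) -> Prop) (D : set 'rV[R]_n.+1)
    (eta : 'rV[R]_n.+1 -> R) : Prop :=
  forall q, D q -> spd (hessian eta q) /\
    exists B : 'I_2 -> 'M[R]_n.+1, (forall j, (B j)^T = B j) /\
      forall p, invol p ->
        \sum_(j < 2) p j *m B j
        = (\sum_(j < 2) p j *m jacobian (flux S j) q) *m hessian eta q.

Definition symmetric_hyperbolic n
    (Sol : set 'rV[R]_3 -> ('rV[R]_3 -> 'rV[R]_n.+1) -> Prop)
    (S : balance_law n.+1) (invol : ('I_2 -> 'rV[R]_n.+1) -> Prop)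
    (D : set 'rV[R]_n.+1) : Prop :=
  [/\ open D, forall j, smooth_on D (flux S j)
    & exists eta, mathematical_entropy Sol D eta /\
                  hessian_symmetrizes S invol D eta].

End BalanceLaws.

Section SaintVenantMaxwell.
Context {R : realType}.

Record physics := Physics {
  grav : R ;                (* g *)
  elas : R ;                (* G_epsilon *)
  rlx : R ;                 (* lambda *)
  Hhat : R ;
  fric : R ;                (* k *)
  zb : 'rV[R]_2 -> R
}.

(* A state of either system is the vector (H, HU, HF, HW, Hw) of R^11, with
   (W, w) = (A^H, A^cc) or (W, w) = (Y^H, Y^cc); the symmetric matrix W enters
   by its three components W^aa, W^ab, W^bb. *)
Definition symvec (W : 'M[R]_2) : 'rV[R]_3 :=
  \row_(k < 3) W (inord k./2) (inord (uphalf k)).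

Definition vecsym (v : 'rV[R]_3) : 'M[R]_2 := \matrix_(i, j) v 0 (inord (i + j)).

Definition pack (H : R) (m : 'rV[R]_2) (P W : 'M[R]_2) (w : R) : 'rV[R]_11 :=
  row_mx (H%:M : 'rV_1)
    (row_mx m (row_mx (mxvec P) (row_mx (symvec W) (w%:M : 'rV_1)))).

Definition tail1 (q : 'rV[R]_11) : 'rV[R]_10 :=
  rsubmx (q : 'rV_(1 + (2 + (2 * 2 + (3 + 1))))).
Definition tail2 (q : 'rV[R]_11) : 'rV[R]_8 :=
  rsubmx (tail1 q : 'rV_(2 + (2 * 2 + (3 + 1)))).
Definition tail3 (q : 'rV[R]_11) : 'rV[R]_4 :=
  rsubmx (tail2 q : 'rV_(2 * 2 + (3 + 1))).

Definition qH (q : 'rV[R]_11) : R :=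
  lsubmx (q : 'rV_(1 + (2 + (2 * 2 + (3 + 1))))) 0 0.
Definition qHU (q : 'rV[R]_11) : 'rV[R]_2 :=
  lsubmx (tail1 q : 'rV_(2 + (2 * 2 + (3 + 1)))).
(* Rows of HF are spatial indices, columns are material indices. *)
Definition qHF (q : 'rV[R]_11) : 'M[R]_2 :=
  vec_mx (lsubmx (tail2 q : 'rV_(2 * 2 + (3 + 1)))).
Definition qHW (q : 'rV[R]_11) : 'M[R]_2 :=
  vecsym (lsubmx (tail3 q : 'rV_(3 + 1))).
Definition qHw (q : 'rV[R]_11) : R := rsubmx (tail3 q : 'rV_(3 + 1)) 0 0.

Definition vel q : 'rV[R]_2 := (qH q)^-1 *: qHU q.
Definition defF q : 'M[R]_2 := (qH q)^-1 *: qHF q.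
Definition tenW q : 'M[R]_2 := (qH q)^-1 *: qHW q.
Definition scaw q : R := (qH q)^-1 * qHw q.

(* As a set of vectors (H, HU, HF, HW, Hw), this is both
   {H > 0, Y^H = (Y^H)^T > 0, Y^cc > 0} and {H > 0, A^H = (A^H)^T > 0, A^cc > 0}. *)
Definition admissible : set 'rV[R]_11 :=
  [set q | [/\ 0 < qH q, spd (tenW q) & 0 < scaw q]].

Definition stressA (q : 'rV[R]_11) : 'M[R]_2 := invsqrtmx (tenW q).
Definition stressAcc (q : 'rV[R]_11) : R := scaw q ^+ 4.

(* (H, HU, HF, HY, HYcc) |-> (H, HU, HF, HA, HAcc) *)
Definition Y_to_A (q : 'rV[R]_11) : 'rV[R]_11 :=
  pack (qH q) (qHU q) (qHF q) (qH q *: stressA q) (qH q * stressAcc q).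

Section Systems.
Context (P : physics).

(* The flux in the direction j for the conformation (A, Acc). *)
Definition flux_with (A : 'rV[R]_11 -> 'M[R]_2) (Acc : 'rV[R]_11 -> R)
    (j : 'I_2) (q : 'rV[R]_11) : 'rV[R]_11 :=
  let H := qH q in let U := vel q in let F := defF q in
  pack (H * U 0 j)
    (\row_i (H * U 0 j * U 0 i
             + (grav P / 2 * H ^+ 2 + elas P * Acc q * H ^+ 3) * (j == i)%:R
             - elas P * H * (F *m A q *m F^T) j i))
    (\matrix_(i, al) (H * U 0 j * F i al - H * F j al * U 0 i))
    ((H * U 0 j) *: tenW q)
    (H * U 0 j * scaw q).

Definition source_with (rW : 'rV[R]_11 -> 'M[R]_2) (rw : 'rV[R]_11 -> R)
    (x : 'rV[R]_2) (q : 'rV[R]_11) : 'rV[R]_11 :=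
  pack 0 (- (grav P * qH q) *: grad (zb P) x - (fric P * qH q) *: vel q) 0
    (qH q *: rW q) (qH q * rw q).

Definition A_system : balance_law 11 := BalanceLaw
  (flux_with tenW scaw)
  (source_with
    (fun q => (rlx P)^-1 *: (invmx ((defF q)^T *m defF q) - tenW q))
    (fun q => (qH q ^- 2 - scaw q) / rlx P)).

(* The system (S), as a function of the relaxation rate rY of Y^H. *)
Definition Y_system (rY : 'rV[R]_11 -> 'M[R]_2) : balance_law 11 := BalanceLaw
  (flux_with stressA stressAcc)
  (source_with rY
    (fun q => (qH q ^- 2 * scaw q ^- 3 - scaw q) / (4 * rlx P))).

(* - Y (Z - Y) Y / lambda, Z = (A F F^T)^-1 + (F F^T A)^-1. This is not the
   rate of Y = A^-2 when A relaxes to (F^T F)^-1: if F = A = Y = I, then A is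
   at rest while this rate is - I / lambda. *)
Definition Y_rate_printed (q : 'rV[R]_11) : 'M[R]_2 :=
  let F := defF q in let A := stressA q in let Y := tenW q in
  let Z := invmx (A *m F *m F^T) + invmx (F *m F^T *m A) in
  - (rlx P)^-1 *: (Y *m (Z - Y) *m Y).

(* The rate of Y = A^-2 when A has rate ((F^T F)^-1 - A) / lambda:
   - Y (Z - 2 Y^-1) Y / lambda, Z = (A^-1 F^T F)^-1 + (F^T F A^-1)^-1. *)
Definition Y_rate (q : 'rV[R]_11) : 'M[R]_2 :=
  let F := defF q in let A := stressA q in let Y := tenW q in
  let Z := invmx (invmx A *m F^T *m F) + invmx (F^T *m F *m invmx A) in
  - (rlx P)^-1 *: (Y *m (Z - 2 *: invmx Y) *m Y).

Definition smooth_solution (S : balance_law 11) (Om : set 'rV[R]_3)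
    (q : 'rV[R]_3 -> 'rV[R]_11) : Prop :=
  [/\ smooth_on Om q, forall p, Om p -> admissible (q p),
      forall p, Om p -> qH (q p) * \det (defF (q p)) = Hhat P
    & satisfies S Om q].

(* F is the deformation gradient of a motion phi with velocity U: near every
   event of Om there are material coordinates (a, b) such that
   dt phi = U (t, phi) and d_alpha phi^i = F^i_alpha (t, phi). *)
Definition deformation_gradient (Om : set 'rV[R]_3)
    (U : 'rV[R]_3 -> 'rV[R]_2) (F : 'rV[R]_3 -> 'M[R]_2) : Prop :=
  forall p, Om p -> exists (W : set 'rV[R]_3) (phi : 'rV[R]_3 -> 'rV[R]_2),
    [/\ open W, smooth_on W phi,
        exists2 w, W w & with_space w (phi w) = p
      & forall w, W w -> let p' := with_space w (phi w) in
          [/\ Om p', dt phi w = U p'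
            & forall (i al : 'I_2), dx al phi w 0 i = F p' i al]].

Definition motion_solution (S : balance_law 11) (Om : set 'rV[R]_3)
    (q : 'rV[R]_3 -> 'rV[R]_11) : Prop :=
  smooth_solution S Om q /\ deformation_gradient Om (vel \o q) (defF \o q).

(* The Piola identity div (H F_alpha) = 0, as a constraint on the pair p of
   the space derivatives of q. It holds along motions with H |F| constant, and
   the energy law needs it: for a general matrix field F the time derivative of
   tr (F A F^T) contains the extra term 2 U^i F^i_beta A_(alpha beta)
   div (H F_alpha) / H. *)
Definition piola (p : 'I_2 -> 'rV[R]_11) : Prop :=
  forall al : 'I_2, \sum_(j < 2) qHF (p j) j al = 0.

Definition SigmaH (q : 'rV[R]_11) : 'M[R]_2 :=
  elas P *: (defF q *m stressA q *m (defF q)^T).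

Definition Sigmazz (q : 'rV[R]_11) : R := elas P * stressAcc q * qH q ^+ 2.

Definition energy (q : 'rV[R]_11) : R :=
  qH q / 2 * (dot (vel q) (vel q) + grav P * qH q
              + (\tr (SigmaH q) + Sigmazz q + \tr (tenW q *m tenW q))).

Definition energy_flux (j : 'I_2) (q : 'rV[R]_11) : R :=
  vel q 0 j * (energy q + grav P / 2 * qH q ^+ 2)
  + qH q * \sum_(i < 2) ((Sigmazz q)%:M - SigmaH q) j i * vel q 0 i.

Definition energy_source (Dt : 'rV[R]_11 -> R) (x : 'rV[R]_2) (q : 'rV[R]_11) : R :=
  - (fric P * qH q * dot (vel q) (vel q))
  - grav P * qH q * dot (vel q) (grad (zb P) x)
  - qH q * Dt q.

End Systems.
End SaintVenantMaxwell.
Arguments physics : clear implicits.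

(* Main.v *)
(* The change of variables Psi : (Y, Ycc) |-> (Y^(-1/2), Ycc^4) is a smooth
   diffeomorphism of the admissible set that conjugates the two systems: along
   any direction v one has D(fA_j o Psi)[v] = DPsi[D fY_j [v]] and
   sA o Psi = DPsi[sY]. Hence DPsi maps the residual of the Y-system at q to the
   residual of the A-system at Psi(q), and it is injective.

   The energy eta and its flux zeta_j satisfy the algebraic identity
     D eta [D f_j [v]] = D zeta_j [v] + sum_al L_al (HF)_(j al) [v],
   with L_al = - G sum_i U_i (F A)_(i al). Contracted with dx_j q, the last term
   becomes a combination of div (H F_al), which vanishes by the Piola identity:
   this is the energy law. Differentiating the same identity once more gives the
   symmetric matrices zeta_j'' - D eta . f_j'' that represent eta'' f_j' modulo
   the Piola constraint.

   Convexity: in conservative variables, with P = H F and X = H Y, the elastic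
   energy is G/2 tr (P C^-1 P^T) where C^2 = H X. Along a line, C'' solves a
   Lyapunov equation with right-hand side - 2 K^2 and is thus negative
   semidefinite, so the second derivative of every term of eta is a sum of
   squares. *)

Require Import Defs.
From HB Require Import structures.
From mathcomp Require Import all_boot all_order all_algebra.
From mathcomp Require Import all_classical all_reals all_analysis.
From mathcomp Require Import ring lra.

Set Implicit Arguments.
Unset Strict Implicit.
Unset Printing Implicit Defensive.

Import Order.TTheory GRing.Theory Num.Theory.
Import numFieldNormedType.Exports.

Local Open Scope classical_set_scope.
Local Open Scope ring_scope.

(** * Differential calculus *)

(** The closed form of the matrix square root serves only for existence and smoothness. Its
    derivatives come from implicit relations, [A A Y = 1] for [A = Y^(-1/2)] and [C C = H X] for
    [C]: each gives a Lyapunov equation with a unique symmetric solution, so a derivative is found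
    by exhibiting a solution. Behind the convexity lie two classical facts: [p C^-1 p^T] is jointly
    convex in [(p, C)] and decreasing in [C], and the geometric mean [C] of [H I] and [X] is
    operator concave. The Piola defect comes from the term [- H F_(j al) U_i] of the conservative
    flux of [HF], whose derivative contains [U_i] times the derivative of [H F_(j al)]. No algebra
    on states removes it: it vanishes because second derivatives of the motion commute and [H det F]
    is constant, whence the detour through material coordinates. The relaxation rate of [Y] enters
    the source only, hence only the dissipation, on whose sign nothing is claimed. The energy part
    is therefore carried out for an arbitrary rate, the bijection for the rate that the chain rule
    dictates. *)

Section DirectionalDerivatives.
Context {R : realType}.

Lemma derive_chain (U V W : normedModType R) (f : U -> V) (g : V -> W) p u :
  differentiable f p -> differentiable g (f p) ->
  'D_u (g \o f) p = 'D_('D_u f p) g (f p).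
Proof.
move=> df dg; rewrite !deriveE //; last exact: differentiable_comp.
by rewrite diff_comp.
Qed.

Lemma derive_coord (V : normedModType R) m (f : V -> 'rV[R]_m) p v k :
  differentiable f p -> 'D_v (fun x => f x 0 k) p = 'D_v f p 0 k.
Proof. by move=> df; rewrite derive_mx ?mxE //; exact: diff_derivable. Qed.

Lemma row_expand m (v : 'rV[R]_m) : v = \sum_(k < m) v 0 k *: unitv k.
Proof. exact: row_sum_delta. Qed.

Lemma derive_dirD (V W : normedModType R) (f : V -> W) p u v :
  differentiable f p -> 'D_(u + v) f p = 'D_u f p + 'D_v f p.
Proof. by move=> df; rewrite !deriveE // linearD. Qed.

Lemma derive_dirZ (V W : normedModType R) (f : V -> W) p a v :
  differentiable f p -> 'D_(a *: v) f p = a *: 'D_v f p.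
Proof. by move=> df; rewrite !deriveE // linearZ. Qed.

Lemma derive_dir_sum (V W : normedModType R) (f : V -> W) p I (s : seq I)
    (v : I -> V) :
  differentiable f p ->
  'D_(\sum_(i <- s) v i) f p = \sum_(i <- s) 'D_(v i) f p.
Proof.
move=> df; rewrite deriveE // linear_sum.
by apply: eq_bigr => i _; rewrite deriveE.
Qed.

Lemma derive_dirE (W : normedModType R) m (f : 'rV[R]_m -> W) p v :
  differentiable f p -> 'D_v f p = \sum_(k < m) v 0 k *: 'D_(unitv k) f p.
Proof.
move=> df; rewrite [in LHS](row_expand v) derive_dir_sum //.
by apply: eq_bigr => k _; rewrite derive_dirZ.
Qed.

Lemma differentiable_row (V : normedModType R) m (f : V -> 'rV[R]_m) p :
  (forall k, differentiable (fun x => f x 0 k) p) -> differentiable f p.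
Proof.
move=> df; have -> : f = \sum_(k < m) (fun x => f x 0 k *: unitv k).
  by apply/funext => x; rewrite fct_sumE -row_expand.
by apply: differentiable_sum => k; apply: differentiableZl.
Qed.

(** The components of a state are plain functions with a proof of [scalar]; the expansion in
    coordinates gives them differentiability and smoothness. *)
Lemma linear_rowE m (l : 'rV[R]_m -> R) :
  scalar l -> l = (fun v => \sum_(k < m) v 0 k * l (unitv k)).
Proof.
move=> lin; pose lM := GRing.isLinear.Build _ _ _ _ _ lin.
pose L : {linear 'rV[R]_m -> R^o} := HB.pack l lM.
apply/funext => v; rewrite [in LHS](row_expand v) -[l _]/(L _) linear_sum.
by apply: eq_bigr => k _; rewrite linearZ.
Qed.

Lemma differentiable_scalar m (l : 'rV[R]_m -> R) p :
  scalar l -> differentiable l p.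
Proof.
move=> /linear_rowE ->.
have -> : (fun v : 'rV[R]_m => \sum_(k < m) v 0 k * l (unitv k))
        = \sum_(k < m) ((fun v => v 0 k *: (l (unitv k) : R^o)) : 'rV[R]_m -> R^o).
  by apply/funext => v; rewrite fct_sumE.
apply: (@differentiable_sum R _ R^o) => k.
by apply: (@differentiableZl R _ R^o); exact: differentiable_coord.
Qed.

Lemma derive_scalar m (l : 'rV[R]_m -> R) p v : scalar l -> 'D_v l p = l v.
Proof.
move=> lin; rewrite deriveE; last exact: differentiable_scalar.
pose lM := GRing.isLinear.Build _ _ _ _ _ lin.
pose L : {linear 'rV[R]_m -> R^o} := HB.pack l lM.
rewrite -[l]/(L : _ -> _) diff_lin // => x.
by apply: differentiable_continuous; exact: differentiable_scalar.
Qed.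

Lemma derive_affine (V : normedModType R) (p u : V) (s : R) :
  differentiable (fun h : R => p + h *: u) s /\
  'D_1 (fun h : R => p + h *: u) s = u.
Proof.
have d : is_diff s (fun h : R => p + h *: u) ( *:%R ^~ u).
  have := @is_diffD R R^o V (cst p) ( *:%R ^~ u) 0 ( *:%R ^~ u) s _ _.
  by rewrite add0r; apply.
have ds : differentiable (fun h : R => p + h *: u) s by exact: ex_diff.
by split=> //; rewrite deriveE // diff_val scale1r.
Qed.

Lemma line_is_derive (V W : normedModType R) (f : V -> W) p u (s : R) :
  differentiable f (p + s *: u) ->
  is_derive s 1 (fun h : R => f (p + h *: u)) ('D_u f (p + s *: u)).
Proof.
have [d e] := derive_affine p u s => df.
split; first exact/diff_derivable/(differentiable_comp d).
by rewrite (derive_chain (1 : R^o) d df) e.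
Qed.

Lemma line_MVT (V : normedModType R) (f : V -> R) p u (a b : R) : a < b ->
  (forall s, a <= s <= b -> differentiable f (p + s *: u)) ->
  exists2 s, a < s < b &
    f (p + b *: u) - f (p + a *: u) = (b - a) * 'D_u f (p + s *: u).
Proof.
move=> ab df; pose g (h : R) := f (p + h *: u).
have dg (s : R) : a <= s <= b -> is_derive s 1 g ('D_u f (p + s *: u)).
  by move=> /df; exact: line_is_derive.
have [||c cab e] := @MVT R g (fun s => 'D_u f (p + s *: u)) a b ab.
- by move=> x; rewrite in_itv /= => /andP[ax xb]; apply: dg; rewrite !ltW.
- apply: derivable_within_continuous => x; rewrite in_itv /= => xab.
  exact: (@ex_derive _ _ _ _ _ _ _ (dg x xab)).
by exists c; [rewrite in_itv /= in cab|rewrite mulrC].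
Qed.

End DirectionalDerivatives.

(** * Symmetry of second derivatives *)

Section Schwarz.
Context {R : realType} (V : normedModType R).

(** Mean value theorem twice: in the direction [u] for [x |-> f (x + h v) - f x], then in the
    direction [v] for ['D_u f]. The second difference itself is symmetric in [u] and [v]. *)
Let second_difference (f : V -> R) p u v (h : R) : 0 < h ->
  (forall s t : R, 0 <= s <= h -> 0 <= t <= h ->
    differentiable f (p + s *: u + t *: v) /\
    differentiable ('D_u f) (p + s *: u + t *: v)) ->
  exists s t : R, [/\ 0 <= s <= h, 0 <= t <= h &
    f (p + h *: u + h *: v) - f (p + h *: u) - f (p + h *: v) + f p
    = h ^+ 2 * 'D_v ('D_u f) (p + s *: u + t *: v)].
Proof.
move=> h0 df; pose g x := f (x + h *: v) - f x.
have dg s : 0 <= s <= h -> differentiable g (p + s *: u) /\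
    'D_u g (p + s *: u) = 'D_u f (p + s *: u + h *: v) - 'D_u f (p + s *: u).
  move=> sh; have [d1 _] := df s h sh (ltac:(by rewrite ltW //=)).
  have [d0 _] := df s 0 sh (ltac:(by rewrite lexx ltW)).
  rewrite scale0r addr0 in d0.
  have ds : differentiable (fun x => x + h *: v) (p + s *: u).
    by apply: differentiableD.
  have dfs := differentiable_comp ds d1.
  split; first exact: (@differentiableB R V R^o).
  rewrite deriveB; [|exact: diff_derivable..].
  apply: (congr2 (fun x y => x - y)); last by [].
  have -> : 'D_u (fun x => f (x + h *: v)) (p + s *: u) = _ :=
    derive_chain u ds d1.
  congr ('D_ _ f _); rewrite deriveD; [|exact: diff_derivable..].
  by rewrite derive_id derive_cst addr0.
have [s|s sh e1] := @line_MVT R V g p u 0 h h0; first by move=> /dg[].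
have sh' : 0 <= s <= h by case/andP: sh => *; rewrite !ltW.
have [t|t th e2] := @line_MVT R V ('D_u f) (p + s *: u) v 0 h h0.
  by move=> th; have [] := df s t sh' th.
exists s, t; split => //; first by case/andP: th => *; rewrite !ltW.
rewrite subr0 scale0r addr0 in e1; rewrite subr0 scale0r addr0 in e2.
rewrite expr2 -mulrA -e2 -(dg s sh').2 -e1 /g; lra.
Qed.

Let dist_half_absurd (a b c : R) :
  `|a - c| < `|a - b| / 2 -> `|b - c| < `|a - b| / 2 -> False.
Proof.
move=> ac bc; have := ltrD ac bc.
by rewrite -splitr ltNge (distrC b) ler_distD.
Qed.

(** Schwarz's theorem. The second difference over a small parallelogram is [h^2] times either mixed
    derivative at some point of it, so a gap between their values at [p] contradicts continuity. *)
Lemma derive_comm (f : V -> R) (D : set V) u v p : open D -> D p ->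
  (forall x, D x -> [/\ differentiable f x, differentiable ('D_u f) x
                      & differentiable ('D_v f) x]) ->
  {for p, continuous ('D_u ('D_v f))} -> {for p, continuous ('D_v ('D_u f))} ->
  'D_u ('D_v f) p = 'D_v ('D_u f) p.
Proof.
move=> oD Dp df cuv cvu; apply/eqP/negPn/negP => ne.
pose e := `|'D_u ('D_v f) p - 'D_v ('D_u f) p| / 2.
have e0 : 0 < e by rewrite divr_gt0 // normr_gt0 subr_eq0.
move/cvgrPdist_lt: cuv => /(_ _ e0) nuv.
move/cvgrPdist_lt: cvu => /(_ _ e0) nvu.
have nD : \forall x \near p, D x by exact: open_nbhs_nbhs.
have /nbhs_ballP[r /= r0 br] : nbhs p [set x | D x /\
    (`|'D_u ('D_v f) p - 'D_u ('D_v f) x| < e /\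
     `|'D_v ('D_u f) p - 'D_v ('D_u f) x| < e)].
  exact: filterI nD (filterI nuv nvu).
(* Keeps the parallelogram within distance [r / 2] of [p]; the added 1 covers [u = v = 0]. *)
pose h := r / 2 / (`|u| + `|v| + 1).
have n0 : 0 < `|u| + `|v| + 1 by rewrite ltr_wpDl // addr_ge0.
have h0 : 0 < h by rewrite !divr_gt0.
have inb (s t : R) : 0 <= s <= h -> 0 <= t <= h -> ball p r (p + s *: u + t *: v).
  move=> /andP[s0 sh] /andP[t0 th]; rewrite -ball_normE /=.
  rewrite -addrA opprD addrA subrr sub0r normrN.
  apply: (le_lt_trans (ler_normD _ _)); rewrite !normrZ !ger0_norm //.
  apply: (@le_lt_trans _ _ (h * (`|u| + `|v|))).
    by rewrite mulrDr lerD // ler_wpM2r.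
  apply: (@lt_le_trans _ _ (h * (`|u| + `|v| + 1))).
    by rewrite ltr_pM2l // ltrDl.
  by rewrite /h mulfVK ?lt0r_neq0 //; clear -r0; lra.
clearbody h.
have [|s [t [sh th e1]]] := @second_difference f p u v h h0.
  by move=> s t sh th; have [/df[]] := br _ (inb _ _ sh th).
have [|t' [s' [th' sh' e2]]] := @second_difference f p v u h h0.
  move=> s1 t1 sh1 th1; rewrite addrAC.
  by have [/df[]] := br _ (inb _ _ th1 sh1).
rewrite (addrAC p (h *: v)) (addrAC p (t' *: v)) in e2.
rewrite (addrAC (f _) (- f (p + h *: v))) in e2.
have [_ [_ a1]] := br _ (inb _ _ sh th).
have [_ [a2 _]] := br _ (inb _ _ sh' th').
have h2 : h ^+ 2 != 0 by rewrite expf_neq0 ?gt_eqF.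
move: e1; rewrite e2 => /(mulfI h2) ee.
by rewrite -ee in a1; exact: dist_half_absurd a2 a1.
Qed.

End Schwarz.

(** * Calculus of smooth functions on an open set *)

Section SmoothFunctions.
Context {R : realType} (n : nat) (D : set 'rV[R]_n.+1).
Hypothesis oD : open D.
Implicit Types (V : normedModType R) (f g : 'rV[R]_n.+1 -> R).

Lemma open_near_eq V (f g : 'rV[R]_n.+1 -> V) p :
  (forall x, D x -> f x = g x) -> D p -> {near p, f =1 g}.
Proof.
move=> fg Dp; have nD : nbhs p D by exact: open_nbhs_nbhs.
exact: filterS nD.
Qed.

Lemma derive_ext V (f g : 'rV[R]_n.+1 -> V) p v :
  (forall x, D x -> f x = g x) -> D p -> 'D_v f p = 'D_v g p.
Proof. by move=> fg Dp; apply: near_eq_derive; exact: open_near_eq. Qed.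

(** The first-order expansion of [f] at [p] involves only values near [p], so it serves for [g] with
    the same differential. *)
Lemma differentiable_ext V (f g : 'rV[R]_n.+1 -> V) p :
  (forall x, D x -> f x = g x) -> D p -> differentiable f p ->
  differentiable g p.
Proof.
move=> fg Dp df.
have near0 : \forall h \near (0 : 'rV[R]_n.+1), f (h + p) = g (h + p).
  by have := open_near_eq fg Dp; rewrite (near_shift 0); apply: filterS => h /=;
    rewrite subr0.
have /diff_locallyP[c e] := df.
have lg : g \o shift p = cst (g p) + 'd f p +o_ (0 : 'rV[R]_n.+1) id.
  apply/eqaddoP => eps e0; move/eqaddoP: e => /(_ _ e0) ne.
  apply: filterS2 near0 ne => h /= eh; rewrite !fctE /= eh.
  by rewrite (fg p Dp).
by apply/diff_locallyP; rewrite (diff_unique c lg).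
Qed.

Lemma differentiable_upto_S V k (f : 'rV[R]_n.+1 -> V) :
  differentiable_upto k.+1 D f -> differentiable_upto k D f.
Proof.
elim: k f => [|k IH] f [df ddf]; last by split=> // i; exact: IH.
by move=> p /df; exact: differentiable_continuous.
Qed.

Lemma differentiable_upto_ext V k (f g : 'rV[R]_n.+1 -> V) :
  (forall x, D x -> f x = g x) ->
  differentiable_upto k D f -> differentiable_upto k D g.
Proof.
elim: k f g => [|k IH] f g fg.
  move=> cf p Dp; rewrite /prop_for /= /continuous_at -(fg p Dp).
  exact: cvg_trans (near_eq_cvg (open_near_eq fg Dp)) (cf p Dp).
move=> [df ddf]; split=> [p Dp|i]; first exact: differentiable_ext fg Dp (df p Dp).
apply: IH (ddf i) => x Dx; exact: derive_ext.
Qed.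

Lemma smooth_ext V (f g : 'rV[R]_n.+1 -> V) :
  (forall x, D x -> f x = g x) -> smooth_on D f -> smooth_on D g.
Proof. by move=> fg sf k; apply: differentiable_upto_ext fg _. Qed.

Lemma smooth_differentiable V (f : 'rV[R]_n.+1 -> V) p :
  smooth_on D f -> D p -> differentiable f p.
Proof. by move=> sf; have [df _] := sf 1; exact: df. Qed.

Lemma differentiable_upto_cst V k (c : V) : differentiable_upto k D (cst c).
Proof.
elim: k c => [|k IH] c; first by move=> p _; exact: cst_continuous.
split=> // i; apply: differentiable_upto_ext (IH 0) => x _.
by rewrite derive_cst.
Qed.

Lemma smooth_cst V (c : V) : smooth_on D (fun=> c).
Proof. by move=> k; exact: differentiable_upto_cst. Qed.

Lemma differentiable_upto_add k f g :
  differentiable_upto k D f -> differentiable_upto k D g ->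
  differentiable_upto k D (fun x => f x + g x).
Proof.
elim: k f g => [|k IH] f g.
  by move=> cf cg p Dp; exact: (@cvgD _ R^o _ _ _ _ _ _ _ (cf p Dp) (cg p Dp)).
move=> [df ddf] [dg ddg]; split=> [p Dp|i].
  by apply: (@differentiableD R _ R^o); [exact: df|exact: dg].
apply: differentiable_upto_ext (IH _ _ (ddf i) (ddg i)) => x Dx.
by rewrite deriveD //; apply: diff_derivable; [exact: df|exact: dg].
Qed.

Lemma differentiable_upto_mul k f g :
  differentiable_upto k D f -> differentiable_upto k D g ->
  differentiable_upto k D (fun x => f x * g x).
Proof.
elim: k f g => [|k IH] f g.
  by move=> cf cg p Dp; exact: cvgM (cf p Dp) (cg p Dp).
move=> sf sg; have [df ddf] := sf; have [dg ddg] := sg; split=> [p Dp|i].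
  by apply: differentiableM; [exact: df|exact: dg].
have s1 := IH _ _ (differentiable_upto_S sf) (ddg i).
have s2 := IH _ _ (differentiable_upto_S sg) (ddf i).
apply: differentiable_upto_ext (differentiable_upto_add s1 s2) => x Dx.
by rewrite deriveM //; apply: diff_derivable; [exact: df|exact: dg].
Qed.

(** The derivative [- f' / f^2] involves the inverse itself at one order less, so the induction is
    on the order with [f] fixed. The square root is treated in the same way through
    [f' / (2 sqrt f)]. *)
Lemma differentiable_upto_inv k f : (forall x, D x -> f x != 0) ->
  differentiable_upto k D f -> differentiable_upto k D (fun x => (f x)^-1).
Proof.
move=> f0; elim: k => [|k IH].
  by move=> cf p Dp; exact: cvgV (f0 p Dp) (cf p Dp).
move=> sf; have [df ddf] := sf; split=> [p Dp|i].
  by apply: differentiableV; [exact: df|exact: f0].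
have s1 := IH (differentiable_upto_S sf).
have s2 := differentiable_upto_mul (differentiable_upto_mul s1 s1) (ddf i).
have s3 := differentiable_upto_mul (differentiable_upto_cst k (-1 : R)) s2.
apply: differentiable_upto_ext s3 => x Dx.
rewrite deriveV ?f0 //; last by apply: diff_derivable; exact: df.
by rewrite /cst mulN1r -invfM -expr2 -mulNr.
Qed.

Lemma differentiable_upto_sqrt k f : (forall x, D x -> 0 < f x) ->
  differentiable_upto k D f ->
  differentiable_upto k D (fun x => Num.sqrt (f x) : R).
Proof.
move=> f0; elim: k => [|k IH].
  move=> cf p Dp; apply: (@continuous_comp _ _ _ f (@Num.sqrt R)).
    exact: cf.
  exact: sqrt_continuous.
move=> sf; have [df ddf] := sf.
have dsq (y : R) : 0 < y -> differentiable (@Num.sqrt R) y.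
  by move=> y0; apply/derivable1_diffP; have [] := is_derive1_sqrt y0.
split=> [p Dp|i].
  by apply: (differentiable_comp (df p Dp)); exact/dsq/f0.
have s1 := IH (differentiable_upto_S sf).
have s2 := differentiable_upto_mul (differentiable_upto_cst k (2 : R)) s1.
have n0 x : D x -> 2 * Num.sqrt (f x) != 0.
  by move=> Dx; rewrite mulf_neq0 ?pnatr_eq0 // sqrtr_eq0 -ltNge f0.
have s3 := differentiable_upto_mul (differentiable_upto_inv n0 s2) (ddf i).
apply: differentiable_upto_ext s3 => x Dx.
rewrite (derive_chain _ (df x Dx) (dsq _ (f0 _ Dx))).
have -> : 'D_('D_(unitv i) f x) (@Num.sqrt R) (f x)
    = 'D_(unitv i) f x *: 'D_1 (@Num.sqrt R) (f x).
  rewrite -(@derive_dirZ R R^o R^o); last exact/dsq/f0.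
  by congr ('D_ _ _ _); rewrite [RHS]mulr1.
have [_ ->] := is_derive1_sqrt (f0 _ Dx).
by rewrite mulrC.
Qed.

Lemma differentiable_upto_sum k m (F : 'I_m -> 'rV[R]_n.+1 -> R) :
  (forall i, differentiable_upto k D (F i)) ->
  differentiable_upto k D (fun x => \sum_(i < m) F i x).
Proof.
elim: m F => [|m IH] F sF.
  apply: differentiable_upto_ext (differentiable_upto_cst k (0 : R)) => x _.
  by rewrite big_ord0.
have sm := differentiable_upto_add (IH (fun i => F (widen_ord (leqnSn m) i))
  (fun i => sF _)) (sF ord_max).
by apply: differentiable_upto_ext sm => x _; rewrite big_ord_recr.
Qed.

Lemma smooth_sum m (F : 'I_m -> 'rV[R]_n.+1 -> R) :
  (forall i, smooth_on D (F i)) -> smooth_on D (fun x => \sum_(i < m) F i x).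
Proof. by move=> sF k; apply: differentiable_upto_sum => i; exact: sF. Qed.

Lemma smoothD f g : smooth_on D f -> smooth_on D g ->
  smooth_on D (fun x => f x + g x).
Proof. by move=> sf sg k; exact: differentiable_upto_add. Qed.

Lemma smoothM f g : smooth_on D f -> smooth_on D g ->
  smooth_on D (fun x => f x * g x).
Proof. by move=> sf sg k; exact: differentiable_upto_mul. Qed.

Lemma smoothN f : smooth_on D f -> smooth_on D (fun x => - f x).
Proof.
move=> sf; apply: smooth_ext (smoothM (smooth_cst (-1 : R)) sf) => x _.
by rewrite mulN1r.
Qed.

Lemma smoothB f g : smooth_on D f -> smooth_on D g ->
  smooth_on D (fun x => f x - g x).
Proof. by move=> sf sg; exact/(smoothD sf)/smoothN. Qed.

Lemma smoothX f m : smooth_on D f -> smooth_on D (fun x => f x ^+ m).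
Proof.
move=> sf; elim: m => [|m IH]; first exact: smooth_cst.
by apply: smooth_ext (smoothM sf IH) => x _; rewrite exprS.
Qed.

Lemma smoothV f : (forall x, D x -> f x != 0) -> smooth_on D f ->
  smooth_on D (fun x => (f x)^-1).
Proof. by move=> f0 sf k; exact: differentiable_upto_inv. Qed.

Lemma smooth_sqrt f : (forall x, D x -> 0 < f x) -> smooth_on D f ->
  smooth_on D (fun x => Num.sqrt (f x) : R).
Proof. by move=> f0 sf k; exact: differentiable_upto_sqrt. Qed.

Lemma smooth_derive_unitv V (f : 'rV[R]_n.+1 -> V) i :
  smooth_on D f -> smooth_on D ('D_(unitv i) f).
Proof. by move=> sf k; have [_] := sf k.+1; apply. Qed.

Lemma smooth_derive f v : smooth_on D f -> smooth_on D ('D_v f).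
Proof.
move=> sf; have s i := smoothM (smooth_cst (v 0 i)) (smooth_derive_unitv i sf).
apply: smooth_ext (smooth_sum s) => x Dx.
by rewrite (derive_dirE _ (smooth_differentiable sf Dx)).
Qed.

Lemma smooth_coord m (f : 'rV[R]_n.+1 -> 'rV[R]_m) k :
  smooth_on D f -> smooth_on D (fun x => f x 0 k).
Proof.
move=> sf j; elim: j f sf => [|j IH] f sf.
  move=> p Dp; apply: (@continuous_comp _ _ _ f (fun v => v 0 k)).
    exact: (sf 0).
  exact: coord_continuous.
split=> [p Dp|i].
  exact: (differentiable_comp (smooth_differentiable sf Dp)
            (differentiable_coord (f p) 0 k)).
apply: differentiable_upto_ext (IH _ (smooth_derive_unitv i sf)) => x Dx.
by rewrite derive_coord //; exact: smooth_differentiable Dx.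
Qed.

Lemma smooth_row m (f : 'rV[R]_n.+1 -> 'rV[R]_m) :
  (forall k, smooth_on D (fun x => f x 0 k)) -> smooth_on D f.
Proof.
move=> sf j; elim: j f sf => [|j IH] f sf.
  move=> p Dp; apply: differentiable_continuous; apply: differentiable_row => k.
  exact: smooth_differentiable Dp.
have df x : D x -> differentiable f x.
  by move=> Dx; apply: differentiable_row => k; exact: smooth_differentiable Dx.
split=> // i; apply: IH => k.
apply: smooth_ext (smooth_derive_unitv i (sf k)) => x Dx.
by rewrite derive_coord //; exact: df.
Qed.

Lemma smooth_scalar m (l : 'rV[R]_m -> R) (f : 'rV[R]_n.+1 -> 'rV[R]_m) :
  scalar l -> smooth_on D f -> smooth_on D (l \o f).
Proof.
move=> /linear_rowE -> sf.
apply: (smooth_sum (F := fun k x => f x 0 k * l (unitv k))) => k.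
by apply: smoothM; [exact: smooth_coord|exact: smooth_cst].
Qed.

Lemma smooth_derive_comm f u v p : smooth_on D f -> D p ->
  'D_u ('D_v f) p = 'D_v ('D_u f) p.
Proof.
move=> sf Dp; have su := smooth_derive u sf; have sv := smooth_derive v sf.
apply: (derive_comm oD Dp) => [x Dx||].
- by split; [exact: smooth_differentiable sf Dx|
    exact: smooth_differentiable su Dx|exact: smooth_differentiable sv Dx].
- exact: (smooth_derive u sv 0).
- exact: (smooth_derive v su 0).
Qed.

Lemma hessian_sym f p : smooth_on D f -> D p -> (hessian f p)^T = hessian f p.
Proof.
by move=> sf Dp; apply/matrixP => i j; rewrite !mxE; exact: smooth_derive_comm.
Qed.

(** Reduces positive definiteness of the Hessian to second derivatives along lines, the only ones
    computed for the energy. *)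
Lemma dot_hessian f p v : smooth_on D f -> D p ->
  dot (v *m hessian f p) v = 'D_v ('D_v f) p.
Proof.
move=> sf Dp; have sv := smooth_derive v sf.
rewrite (derive_dirE _ (smooth_differentiable sv Dp)) /dot mxE.
under [RHS]eq_bigr do rewrite (smooth_derive_comm _ _ sf Dp).
apply: eq_bigr => j _.
rewrite (derive_dirE _ (smooth_differentiable (smooth_derive_unitv j sf) Dp)).
rewrite mxE [_^T _ _]mxE mulrC; congr (_ * _); apply: eq_bigr => i _.
by rewrite mxE.
Qed.

End SmoothFunctions.

Section SmoothComposition.
Context {R : realType} (n m : nat) (D : set 'rV[R]_n.+1) (E : set 'rV[R]_m.+1).
Hypotheses (oD : open D) (oE : open E).

(** The chain rule produces the partial derivatives of [f] composed with [q], so the induction on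
    the order ranges over all smooth [f]. *)
Lemma smooth_comp (f : 'rV[R]_m.+1 -> R) (q : 'rV[R]_n.+1 -> 'rV[R]_m.+1) :
  (forall x, D x -> E (q x)) -> smooth_on D q -> smooth_on E f ->
  smooth_on D (f \o q).
Proof.
move=> qE sq sf k; elim: k f sf => [|k IH] f sf.
  move=> p Dp; apply: continuous_comp; first exact: (sq 0).
  exact/(sf 0)/qE.
have df x Dx := smooth_differentiable sf (qE x Dx).
have dq x Dx := smooth_differentiable sq (Dx : D x).
split=> [p Dp|i]; first exact: differentiable_comp (dq p Dp) (df p Dp).
pose F j x := 'D_(unitv i) q x 0 j * ('D_(unitv j) f \o q) x.
have sF j : differentiable_upto k D (F j).
  apply: (differentiable_upto_mul oD); last exact/IH/smooth_derive_unitv.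
  exact: (smooth_coord oD j (smooth_derive_unitv i sq)).
apply: (differentiable_upto_ext oD) (differentiable_upto_sum oD sF) => x Dx.
by rewrite (derive_chain _ (dq x Dx) (df x Dx)) (derive_dirE _ (df x Dx)).
Qed.

End SmoothComposition.

(** * Strict convexity from second derivatives along lines *)

Section StrictConvexity.
Context {R : realType} (n : nat) (D : set 'rV[R]_n.+1).

(** The chord lies above the graph by [s (1 - s)] times the difference of the slopes on the two
    sides of the intermediate point; a third use of the mean value theorem turns this difference
    into a second derivative. *)
Lemma strictly_convex_derive2 (f : 'rV[R]_n.+1 -> R) :
  open D -> smooth_on D f ->
  (forall x y (s : R), D x -> D y -> 0 <= s <= 1 -> D ((1 - s) *: x + s *: y)) ->
  (forall x v, D x -> v != 0 -> 0 < 'D_v ('D_v f) x) ->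
  strictly_convex_on D f.
Proof.
move=> oD sf cD f2 x y s Dx Dy xy s01; have /andP[s0 s1] := s01.
split; first by apply: cD; rewrite // !ltW.
pose v := y - x; have v0 : v != 0 by rewrite subr_eq0 eq_sym.
have lineE (t : R) : x + t *: v = (1 - t) *: x + t *: y.
  by rewrite scalerBr scalerBl scale1r addrA addrAC.
have Dl (t : R) : 0 <= t <= 1 -> D (x + t *: v).
  by move=> t01; rewrite lineE; exact: cD.
have sv := smooth_derive oD v sf.
have df (g : 'rV[R]_n.+1 -> R) (a b : R) : smooth_on D g -> 0 <= a -> b <= 1 ->
    forall t, a <= t <= b -> differentiable g (x + t *: v).
  move=> sg a0 b1 t /andP[ta tb]; apply: (smooth_differentiable sg).
  by apply: Dl; rewrite (le_trans a0 ta) (le_trans tb b1).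
have [a /andP[a0 a1] ea] := line_MVT s0 (df _ 0 s sf (lexx 0) (ltW s1)).
have [b /andP[b0 b1] eb] := line_MVT s1 (df _ s 1 sf (ltW s0) (lexx 1)).
have ab := lt_trans a1 b0.
have [c /andP[c0 c1] ec] := line_MVT ab (df _ a b sv (ltW a0) (ltW b1)).
have Dc : D (x + c *: v).
  by apply: Dl; rewrite (ltW (lt_trans a0 c0)) (ltW (lt_trans c1 b1)).
have h := f2 _ _ Dc v0.
rewrite scale0r addr0 subr0 in ea; rewrite scale1r subrKC in eb.
rewrite -lineE.
move: ea eb ec h; set z := x + s *: v.
move: (f z) (f x) (f y) ('D_v f (x + a *: v)) ('D_v f (x + b *: v))
  ('D_v ('D_v f) _).
move=> fz fx fy da db dc ea eb ec h; rewrite -subr_gt0.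
have -> : (1 - s) * fx + s * fy - fz = s * (1 - s) * (db - da).
  have -> : fx = fz - s * da by rewrite -ea subKr.
  have -> : fy = fz + (1 - s) * db by rewrite -eb subrKC.
  ring.
by rewrite ec !mulr_gt0 // subr_gt0.
Qed.

End StrictConvexity.

Section PointwiseDerivatives.
Context {R : realType} (V : normedModType R).
Implicit Types (f g : V -> R) (p v : V).

Lemma derive_fsum m (F : 'I_m -> V -> R) p v :
  (forall i, differentiable (F i) p) ->
  'D_v (fun x => \sum_(i < m) F i x) p = \sum_(i < m) 'D_v (F i) p.
Proof.
move=> dF; rewrite -(@derive_sum R V R^o); last first.
  by move=> i; exact: diff_derivable.
by congr ('D_v _ p); apply/funext => x; rewrite fct_sumE.
Qed.

Lemma derive_fmul f g p v : differentiable f p -> differentiable g p ->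
  'D_v (fun x => f x * g x) p = f p * 'D_v g p + g p * 'D_v f p.
Proof. by move=> df dg; rewrite deriveM //; exact: diff_derivable. Qed.

Lemma derive_fadd f g p v : differentiable f p -> differentiable g p ->
  'D_v (fun x => f x + g x) p = 'D_v f p + 'D_v g p.
Proof. by move=> df dg; rewrite deriveD //; exact: diff_derivable. Qed.

End PointwiseDerivatives.

(** * Entropies modulo linear differential constraints *)

Section EntropyPairs.
Context {R : realType} (n m : nat) (S : @balance_law R n.+1).
Context (D : set 'rV[R]_n.+1) (eta : 'rV[R]_n.+1 -> R).
Context (zeta : 'I_2 -> 'rV[R]_n.+1 -> R).
Context (L : 'I_m -> 'rV[R]_n.+1 -> R) (l : 'I_2 -> 'I_m -> 'rV[R]_n.+1 -> R).
Hypotheses (oD : open D) (s_eta : smooth_on D eta).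
Hypotheses (s_zeta : forall j, smooth_on D (zeta j)).
Hypotheses (s_flux : forall j, smooth_on D (flux S j)).
Hypothesis s_L : forall a, smooth_on D (L a).

(* The constraints satisfied by the solutions are sum_j l_(j a) (dx_j q) = 0; the
   usual compatibility of an entropy pair is only required modulo them. *)
Hypothesis compat : forall j q v, D q ->
  'D_('D_v (flux S j) q) eta q
  = 'D_v (zeta j) q + \sum_(a < m) L a q * l j a v.

Lemma entropy_law Om q p : open Om -> smooth_on Om q ->
  (forall x, Om x -> D (q x)) -> satisfies S Om q -> Om p ->
  (forall a, \sum_(j < 2) l j a (dx j q p) = 0) ->
  dt (eta \o q) p + \sum_(j < 2) dx j (zeta j \o q) p
  = 'D_(source S (space_of p) (q p)) eta (q p).
Proof.
move=> oOm sq qD Sq Omp lq0.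
have dq := smooth_differentiable sq Omp; have Dq := qD p Omp.
have de := smooth_differentiable s_eta Dq.
apply: (etrans _ (congr1 (fun s => 'D_s eta (q p)) (Sq p Omp))).
apply: (etrans _ (esym (derive_dirD _ _ de))).
rewrite derive_dir_sum //.
rewrite /dt (derive_chain _ dq de); congr (_ + _).
under [RHS]eq_bigr => j _.
  rewrite /dx (derive_chain _ dq (smooth_differentiable (s_flux j) Dq)).
  rewrite compat //; over.
(* Summing over [j] first makes each constraint appear as a whole, as the cofactor of [L a]. *)
rewrite big_split /= exchange_big /= [X in _ = _ + X]big1 ?addr0 => [|a _].
  apply: eq_bigr => j _.
  by rewrite /dx (derive_chain _ dq (smooth_differentiable (s_zeta j) Dq)).
by rewrite -mulr_sumr lq0 mulr0.
Qed.

Let addr_exchange (x y z t : R) : x + y = z + t -> z - x = y - t.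
Proof.
by move=> e; rewrite -(addrK t z) -e addrAC (addrC x) addrK.
Qed.

(** The compatibility identity differentiated in the direction [w]. Since [l j a v] does not depend
    on the base point, only [L a] is differentiated and the defect remains a multiple of [l j a v],
    so the same constraint kills it. *)
Let second_compat j q v w : D q ->
  'D_v ('D_w (zeta j)) q
  - \sum_(k < n.+1) 'D_(unitv k) eta q * 'D_v ('D_w (fun x => flux S j x 0 k)) q
  = \sum_(k < n.+1) 'D_v (flux S j) q 0 k * 'D_(unitv k) ('D_w eta) q
    - \sum_(a < m) 'D_w (L a) q * l j a v.
Proof.
move=> Dq; pose f k := fun x => flux S j x 0 k.
pose A k := 'D_(unitv k) eta; pose F k := 'D_v (f k); pose Z := 'D_v (zeta j).
have sf k : smooth_on D (f k) := smooth_coord oD k (s_flux j).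
have sF k : smooth_on D (F k) := smooth_derive oD v (sf k).
have sA k : smooth_on D (A k) := smooth_derive oD (unitv k) s_eta.
have sZ : smooth_on D Z := smooth_derive oD v (s_zeta j).
have sl a := smoothM oD (s_L a) (smooth_cst oD (l j a v)).
have coord k x : D x -> 'D_v (flux S j) x 0 k = F k x.
  move=> Dx; apply: esym.
  exact: derive_coord (smooth_differentiable (s_flux j) Dx).
have eqn x : D x -> \sum_(k < n.+1) A k x * F k x
    = Z x + \sum_(a < m) L a x * l j a v.
  move=> Dx; apply: etrans (compat j v Dx).
  apply: etrans (esym (derive_dirE _ (smooth_differentiable s_eta Dx))).
  by apply: eq_bigr => k _; rewrite coord // mulrC.
have lhs : 'D_w (fun x => \sum_(k < n.+1) A k x * F k x) q
    = \sum_(k < n.+1) A k q * 'D_w (F k) q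
      + \sum_(k < n.+1) F k q * 'D_w (A k) q.
  apply: etrans (derive_fsum w
    (fun k => smooth_differentiable (smoothM oD (sA k) (sF k)) Dq)) _.
  apply: etrans (big_split _ _ _ _ _); apply: eq_bigr => k _.
  exact: derive_fmul (smooth_differentiable (sA k) Dq)
                     (smooth_differentiable (sF k) Dq).
have rhs : 'D_w (fun x => Z x + \sum_(a < m) L a x * l j a v) q
    = 'D_w Z q + \sum_(a < m) 'D_w (L a) q * l j a v.
  apply: etrans (derive_fadd w (smooth_differentiable sZ Dq)
    (smooth_differentiable (smooth_sum oD sl) Dq)) _.
  congr (_ + _).
  apply: etrans (derive_fsum w (fun a => smooth_differentiable (sl a) Dq)) _.
  apply: eq_bigr => a _.
  apply: etrans (derive_fmul w (smooth_differentiable (s_L a) Dq)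
    (differentiable_cst (l j a v) q)) _.
  by rewrite derive_cst mulr0 add0r mulrC.
have c1 : \sum_(k < n.+1) A k q * 'D_v ('D_w (f k)) q
    = \sum_(k < n.+1) A k q * 'D_w (F k) q.
  apply: eq_bigr => k _; apply: (congr1 (fun z => A k q * z)).
  exact: smooth_derive_comm (sf k) Dq.
have c2 : \sum_(k < n.+1) 'D_v (flux S j) q 0 k * 'D_(unitv k) ('D_w eta) q
    = \sum_(k < n.+1) F k q * 'D_w (A k) q.
  apply: eq_bigr => k _; apply: congr2; first exact: coord.
  exact: smooth_derive_comm s_eta Dq.
have c3 : 'D_v ('D_w (zeta j)) q = 'D_w Z q.
  exact: smooth_derive_comm (s_zeta j) Dq.
apply: etrans (congr2 (fun x y => x - y) c3 c1) _.
apply: etrans (congr1 (fun x => x - _) (esym c2)).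
apply: addr_exchange; apply: (etrans (esym lhs) (etrans _ rhs)).
exact: (derive_ext oD w eqn Dq).
Qed.

Lemma compat_hessian_symmetrizes invol :
  (forall q, D q -> spd (hessian eta q)) ->
  (forall p, invol p -> forall a, \sum_(j < 2) l j a (p j) = 0) ->
  hessian_symmetrizes S invol D eta.
Proof.
move=> spdh inv q Dq; split; first exact: spdh.
pose f j k := fun x => flux S j x 0 k.
have sf j k : smooth_on D (f j k) := smooth_coord oD k (s_flux j).
(* Symmetric in [k] and [i] by Schwarz, unlike the product of the Jacobian and the Hessian, which
   also contains the derivatives of [L]. *)
pose B j k i := 'D_(unitv k) ('D_(unitv i) (zeta j)) q
  - \sum_(r < n.+1) 'D_(unitv r) eta q
      * 'D_(unitv k) ('D_(unitv i) (f j r)) q.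
exists (fun j => \matrix_(k, i) B j k i); split=> [j|p /inv lp].
  apply/matrixP => k i; rewrite [LHS]mxE [LHS]mxE [RHS]mxE.
  apply: (congr2 (fun x y => x - y)).
    exact: smooth_derive_comm (s_zeta j) Dq.
  apply: eq_bigr => r _; apply: (congr1 (fun z => _ * z)).
  exact: smooth_derive_comm (sf j r) Dq.
have BE j i : \sum_(k < n.+1) p j 0 k * B j k i
    = 'D_(p j) ('D_(unitv i) (zeta j)) q
      - \sum_(r < n.+1) 'D_(unitv r) eta q
          * 'D_(p j) ('D_(unitv i) (f j r)) q.
  have dE (g : 'rV[R]_n.+1 -> R) : smooth_on D g ->
      'D_(p j) ('D_(unitv i) g) q
      = \sum_(k < n.+1) p j 0 k * 'D_(unitv k) ('D_(unitv i) g) q.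
    move=> sg; apply: derive_dirE.
    exact: smooth_differentiable (smooth_derive oD _ sg) Dq.
  have dF : \sum_(r < n.+1) 'D_(unitv r) eta q
        * 'D_(p j) ('D_(unitv i) (f j r)) q
      = \sum_(r < n.+1) \sum_(k < n.+1) 'D_(unitv r) eta q
        * (p j 0 k * 'D_(unitv k) ('D_(unitv i) (f j r)) q).
    apply: eq_bigr => r _; rewrite -mulr_sumr.
    exact: (congr1 (fun z => _ * z) (dE _ (sf j r))).
  apply: (etrans _ (esym (congr2 (fun x y => x - y) (dE _ (s_zeta j)) dF))).
  rewrite exchange_big -sumrB; apply: eq_bigr => k _.
  rewrite mulrBr mulr_sumr; congr (_ - _).
  by apply: eq_bigr => r _; exact: mulrCA.
apply/rowP => i; rewrite summxE.
have e1 j : (p j *m \matrix_(k, i) B j k i) 0 i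
    = \sum_(k < n.+1) 'D_(p j) (flux S j) q 0 k * 'D_(unitv k) ('D_(unitv i) eta) q
    - \sum_(a < m) 'D_(unitv i) (L a) q * l j a (p j).
  rewrite -second_compat // -BE mxE.
  by apply: eq_bigr => k _; rewrite mxE.
under eq_bigr => j _ do rewrite e1.
(* The defect cancels only after summation over [j]: the two space directions are not symmetrized
   separately. *)
rewrite sumrB [X in _ - X]exchange_big /= [X in _ - X]big1 => [|a _]; last first.
  by rewrite -mulr_sumr lp mulr0.
rewrite subr0 exchange_big mxE; apply: eq_bigr => k _.
rewrite -mulr_suml [in RHS]mxE; congr (_ * _); rewrite summxE.
apply: eq_bigr => j _.
by rewrite -deriveEjacobian //; exact: smooth_differentiable (s_flux j) Dq.
Qed.

End EntropyPairs.

(** * Symmetric positive definite matrices of size two *)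

Section TwoByTwo.
Context {R : realType}.
Implicit Types (A B Y : 'M[R]_2).

Lemma ord2P (P : 'I_2 -> Prop) : P 0 -> P 1 -> forall i, P i.
Proof.
move=> P0 P1 i; case: (unliftP ord0 i) => [j|] ->; last exact: P0.
by rewrite (ord1 j) (_ : lift ord0 0 = 1) //; exact: val_inj.
Qed.

Lemma lift01 : lift ord0 ord0 = 1 :> 'I_2. Proof. exact: val_inj. Qed.

Lemma sum2E (V : nmodType) (F : 'I_2 -> V) : \sum_(i < 2) F i = F 0 + F 1.
Proof. by rewrite big_ord_recl big_ord1 lift01. Qed.

Lemma matrix2P A B : A 0 0 = B 0 0 -> A 0 1 = B 0 1 -> A 1 0 = B 1 0 ->
  A 1 1 = B 1 1 -> A = B.
Proof.
by move=> *; apply/matrixP; apply: ord2P; apply: ord2P.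
Qed.

Lemma mulmx2E m n (A : 'M[R]_(m, 2)) (B : 'M[R]_(2, n)) i j :
  (A *m B) i j = A i 0 * B 0 j + A i 1 * B 1 j.
Proof. by rewrite mxE sum2E. Qed.

Lemma det2E A : \det A = A 0 0 * A 1 1 - A 0 1 * A 1 0.
Proof.
rewrite (expand_det_row _ 0) sum2E /cofactor !det_mx11 !mxE /= expr0 expr1 mul1r.
rewrite mulN1r mulrN; congr (_ * A _ _ - _ * A _ _); exact: val_inj.
Qed.

Lemma tr2E A : \tr A = A 0 0 + A 1 1.
Proof. exact: sum2E. Qed.

Lemma invmx_right n (A B : 'M[R]_n) : A *m B = 1%:M -> invmx A = B.
Proof.
move=> e; have [uA _] := mulmx1_unit e.
by rewrite -[RHS]mul1mx -(mulVmx uA) -mulmxA e mulmx1.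
Qed.

Definition mx2 (a b c d : R) : 'M[R]_2 :=
  \matrix_(i, j) if i == 0 then if j == 0 then a else b
                 else if j == 0 then c else d.

Lemma mx2E a b c d : (mx2 a b c d 0 0 = a) * (mx2 a b c d 0 1 = b) *
  (mx2 a b c d 1 0 = c) * (mx2 a b c d 1 1 = d).
Proof. by rewrite !mxE. Qed.

Lemma id2E : ((1%:M : 'M[R]_2) 0 0 = 1) * ((1%:M : 'M[R]_2) 0 1 = 0) *
  ((1%:M : 'M[R]_2) 1 0 = 0) * ((1%:M : 'M[R]_2) 1 1 = 1).
Proof. by rewrite !mxE. Qed.

Lemma invmx2E A : A 0 0 * A 1 1 - A 0 1 * A 1 0 != 0 ->
  invmx A = (A 0 0 * A 1 1 - A 0 1 * A 1 0)^-1 *: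
    mx2 (A 1 1) (- A 0 1) (- A 1 0) (A 0 0).
Proof.
move=> d0; apply: invmx_right.
by apply: matrix2P; rewrite mulmx2E !mxE /= ?id2E; field.
Qed.

(** Sylvester's criterion. One direction tests the form on [(1, 0)] and on [(- A 0 1, A 0 0)], where
    its value is [A 0 0] times the determinant; the other completes the square. *)
Lemma spd2P A :
  spd A <-> [/\ A 1 0 = A 0 1, 0 < A 0 0 & 0 < A 0 0 * A 1 1 - A 0 1 ^+ 2].
Proof.
have qE v : dot (v *m A) v = v 0 0 * (v 0 0 * A 0 0 + v 0 1 * A 1 0)
    + v 0 1 * (v 0 0 * A 0 1 + v 0 1 * A 1 1).
  by rewrite /dot mulmx2E !mxE !sum2E; ring.
split=> [[sA pA]|[sA a0 d0]].
  have s : A 1 0 = A 0 1 by rewrite -{1}sA mxE.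
  pose e (x y : R) : 'rV[R]_2 := \row_j if j == 0 then x else y.
  have eE x y : (e x y 0 0 = x) * (e x y 0 1 = y) by rewrite !mxE.
  have pe x y : (x != 0) || (y != 0) ->
      0 < x * (x * A 0 0 + y * A 0 1) + y * (x * A 0 1 + y * A 1 1).
    move=> xy; have := pA (e x y); rewrite qE !eE s; apply.
    apply: contraTneq xy => e0; rewrite -(eE x y).1 -{2}(eE x y).2 e0 !mxE.
    by rewrite eqxx.
  have a0 : 0 < A 0 0.
    by have := pe 1 0; rewrite oner_eq0 => /(_ isT); rewrite !mul0r !mul1r !addr0.
  split=> //; have := pe (- A 0 1) (A 0 0); rewrite (gt_eqF a0) orbT => /(_ isT).
  rewrite [X in 0 < X](_ : _ = A 0 0 * (A 0 0 * A 1 1 - A 0 1 ^+ 2)); last by ring.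
  by rewrite pmulr_rgt0.
split=> [|v v0].
  by apply: matrix2P; rewrite mxE ?sA.
rewrite qE sA; set x := v 0 0; set y := v 0 1.
rewrite -(pmulr_rgt0 _ a0).
rewrite [X in 0 < X](_ : _ = (x * A 0 0 + y * A 0 1) ^+ 2
                     + (A 0 0 * A 1 1 - A 0 1 ^+ 2) * y ^+ 2); last by ring.
have [y0|y0] := eqVneq y 0.
  have x0 : x != 0.
    apply: contraNneq v0 => x0; apply/eqP/rowP; apply: ord2P;
    by rewrite mxE ?[LHS]x0 ?[LHS]y0.
  rewrite y0 mul0r addr0 expr0n mulr0 addr0 exprn_even_gt0 //=.
  by rewrite mulf_neq0 // gt_eqF.
by rewrite ltr_wpDl ?sqr_ge0 // mulr_gt0 // exprn_even_gt0.
Qed.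

Lemma spd2_det A : spd A -> 0 < \det A.
Proof. by case/spd2P => s _; rewrite det2E s expr2. Qed.

Lemma spd2_11 A : spd A -> 0 < A 1 1.
Proof.
case/spd2P => _ a0 d0; rewrite -(pmulr_rgt0 _ a0).
by apply: lt_le_trans d0 _; rewrite gerBl sqr_ge0.
Qed.

Lemma spd2_unit A : spd A -> A \in unitmx.
Proof. by move=> /spd2_det d; rewrite unitmxE unitfE gt_eqF. Qed.

Lemma spd2_inv A : spd A -> spd (invmx A).
Proof.
move=> sA; have [s a0 d0] := (spd2P A).1 sA; have a1 := spd2_11 sA.
have d0' : 0 < A 0 0 * A 1 1 - A 0 1 * A 1 0 by rewrite s -expr2.
rewrite invmx2E ?gt_eqF //; apply/spd2P; rewrite !mxE /= s; split=> //.
  by rewrite mulr_gt0 // invr_gt0 -expr2.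
rewrite s in d0'; rewrite [X in 0 < X](_ : _ = (A 0 0 * A 1 1 - A 0 1 * A 0 1)^-1).
  by rewrite invr_gt0.
by field; rewrite gt_eqF.
Qed.

Lemma spd2_sqr A : spd A -> spd (A *m A).
Proof.
move=> sA; have [s a0 d0] := (spd2P A).1 sA.
apply/spd2P; rewrite !mulmx2E s; split; first by ring.
  by rewrite ltr_pwDl ?mulr_gt0 // -expr2 sqr_ge0.
rewrite [X in 0 < X](_ : _ = (A 0 0 * A 1 1 - A 0 1 ^+ 2) ^+ 2); last by ring.
by rewrite exprn_gt0.
Qed.

(* Cayley-Hamilton recovers A from A^2, since det A and tr A are the positive
   square roots of det (A^2) and tr (A^2) + 2 det A. *)
Lemma spd2_sqr_inj A B : spd A -> spd B -> A *m A = B *m B -> A = B.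
Proof.
move=> sA sB e; have [s a0 d0] := (spd2P A).1 sA; have [t b0 c0] := (spd2P B).1 sB.
have a1 := spd2_11 sA; have b1 := spd2_11 sB.
have := congr1 (fun M : 'M[R]_2 => M 0 0) e; rewrite !mulmx2E s t => e00.
have := congr1 (fun M : 'M[R]_2 => M 0 1) e; rewrite !mulmx2E => e01.
have := congr1 (fun M : 'M[R]_2 => M 1 1) e; rewrite !mulmx2E s t => e11.
have dd : A 0 0 * A 1 1 - A 0 1 ^+ 2 = B 0 0 * B 1 1 - B 0 1 ^+ 2.
  apply/eqP; rewrite -(eqrXn2 (n := 2)) // ?ltW //; apply/eqP.
  rewrite [LHS](_ : _ = (A 0 0 * A 0 0 + A 0 1 * A 0 1) * (A 0 1 * A 0 1 + A 1 1 * A 1 1)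
    - (A 0 0 * A 0 1 + A 0 1 * A 1 1) ^+ 2); last by ring.
  by rewrite e00 e01 e11; ring.
have tt : A 0 0 + A 1 1 = B 0 0 + B 1 1.
  apply/eqP; rewrite -(eqrXn2 (n := 2)) // ?addr_ge0 ?ltW //; apply/eqP.
  rewrite [LHS](_ : _ = (A 0 0 * A 0 0 + A 0 1 * A 0 1) + (A 0 1 * A 0 1 + A 1 1 * A 1 1)
    + 2 * (A 0 0 * A 1 1 - A 0 1 ^+ 2)); last by ring.
  by rewrite e00 e11 dd; ring.
have t0 : A 0 0 + A 1 1 != 0 by rewrite gt_eqF // addr_gt0.
have x01 : A 0 1 = B 0 1.
  by apply: (mulfI t0); rewrite mulrDl (mulrC (A 1 1)) e01 tt; ring.
have x00 : A 0 0 = B 0 0.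
  apply: (mulfI t0); rewrite [LHS](_ : _ = A 0 0 * A 0 0 + A 0 1 * A 0 1
    + (A 0 0 * A 1 1 - A 0 1 ^+ 2)); last by ring.
  by rewrite e00 dd tt; ring.
by apply: matrix2P => //; rewrite ?s ?t //; apply: (addrI (A 0 0)); rewrite tt x00.
Qed.

(** For [B^2 = Y] with [d = det B] and [t = tr B], Cayley-Hamilton reads [Y = t B - d I], while
    [d^2 = det Y] and [t^2 = tr Y + 2 d]. Solving for [B] with positive roots gives this formula. *)
Definition sqrtmx2 Y : 'M[R]_2 :=
  (Num.sqrt (\tr Y + 2 * Num.sqrt (\det Y)))^-1 *: (Y + (Num.sqrt (\det Y))%:M).

Lemma sqrtmx2P Y : spd Y -> spd (sqrtmx2 Y) /\ sqrtmx2 Y *m sqrtmx2 Y = Y.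
Proof.
move=> sY; have [s y0 d0] := (spd2P Y).1 sY; have y1 := spd2_11 sY.
have d1 := spd2_det sY; rewrite /sqrtmx2.
set d := Num.sqrt (\det Y); have dp : 0 < d by rewrite sqrtr_gt0.
have dE : d ^+ 2 = Y 0 0 * Y 1 1 - Y 0 1 ^+ 2.
  by rewrite sqr_sqrtr ?ltW // det2E s expr2.
have tp : 0 < \tr Y + 2 * d by rewrite tr2E !addr_gt0 // mulr_gt0.
set t := Num.sqrt _; have t0 : 0 < t by rewrite sqrtr_gt0.
have tE : t ^+ 2 = Y 0 0 + Y 1 1 + 2 * d by rewrite sqr_sqrtr ?ltW // tr2E.
have tn : t != 0 by rewrite gt_eqF.
split.
  apply/spd2P; rewrite !mxE /= ?mulr1n ?mulr0n s; split=> //.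
    by rewrite mulr_gt0 ?invr_gt0 // addr_gt0.
  rewrite [X in 0 < X](_ : _ = (Y 0 0 * Y 1 1 - Y 0 1 ^+ 2 + d * (Y 0 0 + Y 1 1) + d ^+ 2)
    / t ^+ 2); last by field.
  rewrite divr_gt0 ?exprn_gt0 //; apply: addr_gt0; last exact: exprn_gt0.
  by apply: addr_gt0 => //; rewrite mulr_gt0 // addr_gt0.
have tV : (Y 0 0 + Y 1 1 + 2 * d) / t ^+ 2 = 1 by rewrite tE divff // -tE expf_neq0.
(* Each entry of the square carries [t^-2]; multiplying the right-hand side by the unit [tV] gives
   both sides the same denominator. *)
apply: matrix2P; rewrite mulmx2E !mxE /= ?mulr1n ?mulr0n ?s ?addr0.
- rewrite -[RHS]mulr1 -tV [LHS](_ : _ = (Y 0 0 ^+ 2 + 2 * d * Y 0 0 + d ^+ 2 + Y 0 1 ^+ 2)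
    / t ^+ 2); last by field.
  by rewrite dE; field.
- by rewrite -[RHS]mulr1 -tV; field.
- by rewrite -[RHS]mulr1 -tV; field.
- rewrite -[RHS]mulr1 -tV [LHS](_ : _ = (Y 1 1 ^+ 2 + 2 * d * Y 1 1 + d ^+ 2 + Y 0 1 ^+ 2)
    / t ^+ 2); last by field.
  by rewrite dE; field.
Qed.

Lemma invsqrtmxP Y : spd Y ->
  spd (invsqrtmx Y) /\ invsqrtmx Y *m invsqrtmx Y = invmx Y.
Proof.
move=> sY; have [sB BB] := sqrtmx2P sY.
(* [get] falls back on a default only when no candidate exists, and [invmx (sqrtmx2 Y)] is one. *)
rewrite /invsqrtmx; case: xgetP => [A _ // | /(_ (invmx (sqrtmx2 Y))) []].
split; first exact: spd2_inv.
have uB := spd2_unit sB.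
rewrite -[in RHS]BB; apply/esym/invmx_right.
by rewrite mulmxA -(mulmxA (sqrtmx2 Y)) mulmxV // mulmx1 mulmxV.
Qed.

Lemma invsqrtmx_uniq Y A : spd Y -> spd A -> A *m A = invmx Y -> invsqrtmx Y = A.
Proof.
by move=> sY sA e; have [s1 e1] := invsqrtmxP sY; apply: spd2_sqr_inj; rewrite ?e1.
Qed.

(** Uniqueness of the root replaces the choice operator by an explicit expression, from which
    smoothness in [Y] is read off. *)
Lemma invsqrtmxE Y : spd Y -> invsqrtmx Y = invmx (sqrtmx2 Y).
Proof.
move=> sY; have [sB BB] := sqrtmx2P sY; have uB := spd2_unit sB.
apply: invsqrtmx_uniq => //; first exact: spd2_inv.
rewrite -[in RHS]BB; apply/esym/invmx_right.
by rewrite mulmxA -(mulmxA (sqrtmx2 Y)) mulmxV // mulmx1 mulmxV.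
Qed.

(* The equation E B + B E = 0, componentwise for symmetric matrices. *)
Lemma lyapunov_inj (b0 b1 b2 e0 e1 e2 : R) :
  0 < b0 -> 0 < b0 * b2 - b1 ^+ 2 ->
  b0 * e0 + b1 * e1 = 0 -> b1 * (e0 + e2) + e1 * (b0 + b2) = 0 ->
  b1 * e1 + b2 * e2 = 0 -> [/\ e0 = 0, e1 = 0 & e2 = 0].
Proof.
move=> b00 d E0 E1 E2.
have b20 : 0 < b2.
  by rewrite -(pmulr_rgt0 _ b00); apply: lt_le_trans d _; rewrite gerBl sqr_ge0.
have n0 : b0 != 0 by rewrite gt_eqF.
have n2 : b2 != 0 by rewrite gt_eqF.
have e1E : e1 = 0.
  (* Eliminating [e0] and [e2] leaves [e1] times [tr B det B]. *)
  have : (b0 + b2) * (b0 * b2 - b1 ^+ 2) * e1 = 0.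
    rewrite [LHS](_ : _ = b0 * b2 * (b1 * (e0 + e2) + e1 * (b0 + b2))
      - b1 * b2 * (b0 * e0 + b1 * e1) - b1 * b0 * (b1 * e1 + b2 * e2)); last by ring.
    by rewrite E0 E1 E2 !mulr0 !subr0.
  move/eqP; rewrite !mulf_eq0 (gt_eqF d) (gt_eqF (addr_gt0 b00 b20)) /=.
  by move/eqP.
move: E0 E2; rewrite e1E !mulr0 addr0 add0r => /eqP; rewrite mulf_eq0 (negPf n0).
by move=> /eqP -> /eqP; rewrite mulf_eq0 (negPf n2) => /eqP ->.
Qed.

End TwoByTwo.

(** * States *)

Section States.
Context {R : realType}.
Implicit Types (q u v : 'rV[R]_11).

Lemma vecsymE (v : 'rV[R]_3) i j : vecsym v i j = v 0 (inord (i + j)).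
Proof. by rewrite mxE. Qed.

Lemma vecsym_symvec (W : 'M[R]_2) : W 1 0 = W 0 1 -> vecsym (symvec W) = W.
Proof.
have i0 : inord 0 = 0 :> 'I_2 by apply/val_inj; rewrite /= inordK.
have i1 : inord 1 = 1 :> 'I_2 by apply/val_inj; rewrite /= inordK.
by move=> s; apply: matrix2P; rewrite vecsymE mxE inordK //= ?i0 ?i1.
Qed.

Lemma vecsym_sym (v : 'rV[R]_3) : vecsym v 1 0 = vecsym v 0 1.
Proof. by rewrite !vecsymE. Qed.

Lemma vecsym_inj : injective (@vecsym R).
Proof.
move=> u v e; apply/rowP => k.
have h (i j : 'I_2) : u 0 (inord (i + j)) = v 0 (inord (i + j)).
  by rewrite -!vecsymE e.
have := h 0 0; have := h 0 1; have := h 1 1 => /=.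
case: k => -[|[|[|//]]] k3 h2 h1 h0.
- by rewrite (_ : Ordinal k3 = inord 0) //; apply/val_inj; rewrite /= inordK.
- by rewrite (_ : Ordinal k3 = inord 1) //; apply/val_inj; rewrite /= inordK.
- by rewrite (_ : Ordinal k3 = inord 2) //; apply/val_inj; rewrite /= inordK.
Qed.

Section Pack.
Context (H : R) (m : 'rV[R]_2) (P W : 'M[R]_2) (w : R).

Lemma qH_pack : qH (pack H m P W w) = H.
Proof. by rewrite /qH /pack row_mxKl mxE eqxx mulr1n. Qed.

Lemma qHU_pack : qHU (pack H m P W w) = m.
Proof. by rewrite /qHU /tail1 /pack row_mxKr row_mxKl. Qed.

Lemma qHF_pack : qHF (pack H m P W w) = P.
Proof. by rewrite /qHF /tail2 /tail1 /pack !row_mxKr row_mxKl mxvecK. Qed.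

Lemma qHW_pack : qHW (pack H m P W w) = vecsym (symvec W).
Proof. by rewrite /qHW /tail3 /tail2 /tail1 /pack !row_mxKr row_mxKl. Qed.

Lemma qHw_pack : qHw (pack H m P W w) = w.
Proof.
by rewrite /qHw /tail3 /tail2 /tail1 /pack !row_mxKr mxE eqxx mulr1n.
Qed.

End Pack.

Lemma state_eq u v : qH u = qH v -> qHU u = qHU v -> qHF u = qHF v ->
  qHW u = qHW v -> qHw u = qHw v -> u = v.
Proof.
move=> eH eU eF eW ew.
have split_eq m n (a b : 'rV[R]_(m + n)) :
    lsubmx a = lsubmx b -> rsubmx a = rsubmx b -> a = b.
  by move=> el er; rewrite -[a]hsubmxK -[b]hsubmxK el er.
apply: (@split_eq 1 10); first by apply/rowP => i; rewrite ord1.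
apply: (@split_eq 2 8); first exact: eU.
apply: (@split_eq 4 4); first exact: (can_inj vec_mxK eF).
apply: (@split_eq 3 1); first exact: vecsym_inj eW.
by apply/rowP => i; rewrite ord1.
Qed.

Lemma qHW_sym q : qHW q 1 0 = qHW q 0 1.
Proof. exact: vecsym_sym. Qed.

Lemma scalar_qH : scalar (@qH R).
Proof. by move=> a u v; rewrite /qH !mxE. Qed.

Lemma scalar_qHU i : scalar (fun q => qHU q 0 i).
Proof. by move=> a u v; rewrite /qHU /tail1 !mxE. Qed.

Lemma scalar_qHF i al : scalar (fun q => qHF q i al).
Proof. by move=> a u v; rewrite /qHF /tail2 /tail1 !mxE. Qed.

Lemma scalar_qHW i j : scalar (fun q => qHW q i j).
Proof. by move=> a u v; rewrite /qHW /tail3 /tail2 /tail1 !mxE. Qed.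

Lemma scalar_qHw : scalar (@qHw R).
Proof. by move=> a u v; rewrite /qHw /tail3 /tail2 /tail1 !mxE. Qed.

Lemma tenW_sym q : tenW q 1 0 = tenW q 0 1.
Proof. by rewrite !mxE; congr (_ * _); exact: qHW_sym. Qed.

Lemma dotMl n (A B : 'M[R]_n) a b (v : 'rV[R]_n) :
  dot (v *m (a *: A + b *: B)) v = a * dot (v *m A) v + b * dot (v *m B) v.
Proof. by rewrite /dot mulmxDr -!scalemxAr mulmxDl -!scalemxAl !mxE. Qed.

Lemma spd_conv n (A B : 'M[R]_n) (s : R) : spd A -> spd B -> 0 <= s <= 1 ->
  spd ((1 - s) *: A + s *: B).
Proof.
move=> [sA pA] [sB pB] /andP[s0 s1]; split=> [|v v0].
  by rewrite linearD !linearZ /= sA sB.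
rewrite dotMl; have [->|sn] := eqVneq s 1.
  by rewrite subrr mul0r add0r mul1r pB.
have a0 : 0 < (1 - s) * dot (v *m A) v.
  by rewrite mulr_gt0 ?pA // subr_gt0 lt_neqAle sn.
by apply: ltr_pwDl => //; rewrite mulr_ge0 // ltW // pB.
Qed.

Lemma spd_scale n (A : 'M[R]_n) (a : R) : 0 < a -> spd A -> spd (a *: A).
Proof.
move=> a0 [sA pA]; split=> [|v v0]; first by rewrite linearZ /= sA.
by have := dotMl A 0 a 0 v; rewrite scaler0 addr0 mul0r addr0 => ->; rewrite mulr_gt0 ?pA.
Qed.

(** Multiplying by the positive depth preserves the conditions and makes them bear on linear
    functions of the state, where openness and convexity are visible. *)
Lemma admissibleP q : admissible q <-> [/\ 0 < qH q, spd (qHW q) & 0 < qHw q].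
Proof.
have hw : 0 < qH q -> (0 < scaw q) = (0 < qHw q).
  by move=> h0; rewrite /scaw pmulr_rgt0 // invr_gt0.
split=> -[h0 sW w0]; split=> //; rewrite ?hw // -?hw //.
  rewrite -[qHW q]scale1r -(divff (lt0r_neq0 h0)) -scalerA.
  exact: spd_scale.
by apply: spd_scale; rewrite ?invr_gt0.
Qed.

Lemma convex_admissible q q' (s : R) : admissible q -> admissible q' ->
  0 <= s <= 1 -> admissible ((1 - s) *: q + s *: q').
Proof.
move=> /admissibleP[h w y] /admissibleP[h' w' y'] s01; apply/admissibleP.
have conv (a b : R) : 0 < a -> 0 < b -> 0 < (1 - s) * a + s * b.
  case/andP: s01 => s0 s1 a0 b0; have [->|sn] := eqVneq s 1.
    by rewrite subrr mul0r add0r mul1r.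
  apply: ltr_pwDl; last by rewrite mulr_ge0 // ltW.
  by rewrite mulr_gt0 // subr_gt0 lt_neqAle sn.
have lin (l : 'rV[R]_11 -> R) : scalar l ->
    l ((1 - s) *: q + s *: q') = (1 - s) * l q + s * l q'.
  move=> sl; rewrite sl; congr (_ + _).
  have := sl s q' 0; rewrite addr0 => ->.
  by have := sl (-1) 0 0; rewrite scaler0 addr0 mulN1r addNr => ->; rewrite addr0.
split; rewrite ?(lin _ scalar_qH) ?(lin _ scalar_qHw) ?conv //.
rewrite (_ : qHW _ = (1 - s) *: qHW q + s *: qHW q'); first exact: spd_conv.
by apply/matrixP => i j; rewrite (lin _ (scalar_qHW i j)) !mxE.
Qed.

Lemma smooth_linear (D : set 'rV[R]_11) (l : 'rV[R]_11 -> R) :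
  open D -> scalar l -> smooth_on D l.
Proof.
move=> oD sl; apply: (smooth_scalar oD sl (f := id)); apply: smooth_row => // k.
have sk : scalar (fun v : 'rV[R]_11 => v 0 k) by move=> a u v; rewrite !mxE.
elim=> [p _|j _]; first exact: coord_continuous.
split=> [p _|i]; first exact: differentiable_coord.
apply: (differentiable_upto_ext oD) (differentiable_upto_cst oD j (unitv i 0 k)) => x _.
by rewrite derive_scalar.
Qed.

Lemma open_admissible : open (@admissible R).
Proof.
have og (f : 'rV[R]_11 -> R) : smooth_on setT f -> open [set q | 0 < f q].
  move=> sf; apply: (@open_comp _ _ f [set x | 0 < x]); last exact: open_gt.
  by move=> x _; exact: (sf 0).
have sl l := @smooth_linear setT l openT.
(* Sylvester's criterion leaves four strict polynomial inequalities. *)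
have -> : @admissible R = [set q | 0 < qH q] `&` ([set q | 0 < qHW q 0 0]
    `&` ([set q | 0 < qHW q 0 0 * qHW q 1 1 - qHW q 0 1 ^+ 2]
    `&` [set q | 0 < qHw q])).
  apply/seteqP; split=> q.
    by move=> /admissibleP[h /spd2P[_ a b] w].
  by move=> [h [a [b w]]]; apply/admissibleP; split=> //; apply/spd2P; rewrite qHW_sym.
apply: openI; first exact/og/sl/scalar_qH.
apply: openI; first exact/og/sl/scalar_qHW.
apply: openI; last exact/og/sl/scalar_qHw.
apply: og; apply: smoothB; first exact: openT.
  by apply: smoothM; [exact: openT|exact/sl/scalar_qHW..].
by apply: smoothX; [exact: openT|exact/sl/scalar_qHW].
Qed.

End States.

Section SmoothPack.
Context {R : realType} (n : nat) (D : set 'rV[R]_n.+1).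
Hypothesis oD : open D.

Lemma smooth_row_mx m1 m2 (f : 'rV[R]_n.+1 -> 'rV[R]_m1)
    (g : 'rV[R]_n.+1 -> 'rV[R]_m2) :
  smooth_on D f -> smooth_on D g -> smooth_on D (fun x => row_mx (f x) (g x)).
Proof.
move=> sf sg; apply: smooth_row => // k.
case: (split_ordP k) => i ->.
  by apply: smooth_ext (smooth_coord oD i sf) => // x _; rewrite row_mxEl.
by apply: smooth_ext (smooth_coord oD i sg) => // x _; rewrite row_mxEr.
Qed.

Lemma smooth_pack (H w : 'rV[R]_n.+1 -> R) (m : 'rV[R]_n.+1 -> 'rV[R]_2)
    (P W : 'rV[R]_n.+1 -> 'M[R]_2) :
  smooth_on D H -> (forall i, smooth_on D (fun x => m x 0 i)) ->
  (forall i j, smooth_on D (fun x => P x i j)) ->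
  (forall i j, smooth_on D (fun x => W x i j)) -> smooth_on D w ->
  smooth_on D (fun x => pack (H x) (m x) (P x) (W x) (w x)).
Proof.
move=> sH sm sP sW sw.
have s1 (f : 'rV[R]_n.+1 -> R) : smooth_on D f ->
    smooth_on D (fun x => (f x)%:M : 'rV_1).
  move=> sf; apply: smooth_row => // k; apply: smooth_ext sf => // x _.
  by rewrite mxE ord1 eqxx mulr1n.
apply: smooth_row_mx; first exact: s1.
apply: smooth_row_mx; first exact: smooth_row.
apply: smooth_row_mx.
  apply: smooth_row => // k; case: (mxvec_indexP k) => i j.
  by apply: smooth_ext (sP i j) => // x _; rewrite mxvecE.
apply: smooth_row_mx; last exact: s1.
by apply: smooth_row => // k; apply: smooth_ext (sW _ _) => // x _; rewrite mxE.
Qed.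

End SmoothPack.

(** * Derivatives of matrix fields and the Lyapunov equation *)

Section MatrixDerivatives.
Context {R : realType} (V : normedModType R).

Definition dmx m n (F : V -> 'M[R]_(m, n)) (v p : V) : 'M[R]_(m, n) :=
  \matrix_(i, j) 'D_v (fun x => F x i j) p.

Lemma dmxM (F G : V -> 'M[R]_2) v p :
  (forall i j, differentiable (fun x => F x i j) p) ->
  (forall i j, differentiable (fun x => G x i j) p) ->
  dmx (fun x => F x *m G x) v p = dmx F v p *m G p + F p *m dmx G v p.
Proof.
move=> dF dG; apply/matrixP => i j; rewrite mxE [RHS]mxE !mulmx2E.
have e : (fun x => (F x *m G x) i j)
    = (fun x => F x i 0 * G x 0 j + F x i 1 * G x 1 j).
  by apply/funext => x; rewrite mulmx2E.
rewrite e derive_fadd; try exact: differentiableM.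
rewrite (derive_fmul v (dF i 0) (dG 0 j)) (derive_fmul v (dF i 1) (dG 1 j)).
rewrite [dmx F v p i 0]mxE [dmx F v p i 1]mxE [dmx G v p 0 j]mxE.
rewrite [dmx G v p 1 j]mxE (mulrC (G p 0 j)) (mulrC (G p 1 j)).
by rewrite addrACA [LHS]addrC.
Qed.

End MatrixDerivatives.

Section Lyapunov.
Context {R : realType}.

Lemma lyapunov_uniq (A E E' : 'M[R]_2) : spd A ->
  E 1 0 = E 0 1 -> E' 1 0 = E' 0 1 ->
  A *m E + E *m A = A *m E' + E' *m A -> E = E'.
Proof.
move=> /spd2P[sA a0 d0] sE sE' e.
have ent i j : (A i 0 * (E 0 j - E' 0 j) + A i 1 * (E 1 j - E' 1 j))
  + ((E i 0 - E' i 0) * A 0 j + (E i 1 - E' i 1) * A 1 j) = 0.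
  have := congr1 (fun M : 'M[R]_2 => M i j) e.
  rewrite [LHS]mxE [RHS]mxE !mulmx2E => /eqP; rewrite -subr_eq0 => /eqP <-; ring.
have := lyapunov_inj (e0 := E 0 0 - E' 0 0) (e1 := E 0 1 - E' 0 1)
  (e2 := E 1 1 - E' 1 1) a0 d0.
have e00 := ent 0 0; have e01 := ent 0 1; have e11 := ent 1 1.
rewrite ?sA ?sE ?sE' in e00 e01 e11.
case.
- have two : (2 : R) != 0 by rewrite pnatr_eq0.
  by apply: (mulfI two); rewrite mulr0 -e00; ring.
- by rewrite -e01; ring.
- have two : (2 : R) != 0 by rewrite pnatr_eq0.
  by apply: (mulfI two); rewrite mulr0 -e11; ring.
move=> /subr0_eq x0 /subr0_eq x1 /subr0_eq x2.
by apply: matrix2P; rewrite ?sE ?sE'.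
Qed.

End Lyapunov.

Section DeriveRules.
Context {R : realType} (V : normedModType R) (p v : V).
Implicit Types f g : V -> R.

Lemma is_derive_add f g df dg : is_derive p v f df -> is_derive p v g dg ->
  is_derive p v (fun x => f x + g x) (df + dg).
Proof. exact: is_deriveD. Qed.

Lemma is_derive_opp f df : is_derive p v f df ->
  is_derive p v (fun x => - f x) (- df).
Proof. exact: is_deriveN. Qed.

Lemma is_derive_mul f g df dg : is_derive p v f df -> is_derive p v g dg ->
  is_derive p v (fun x => f x * g x) (f p * dg + g p * df).
Proof. exact: is_deriveM. Qed.

Lemma is_derive_exp f df n : is_derive p v f df ->
  is_derive p v (fun x => f x ^+ n.+1) (n.+1%:R * f p ^+ n * df).
Proof.
move=> df'; have -> : (fun x => f x ^+ n.+1) = f ^+ n.+1.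
  by apply/funext => x; rewrite exprfctE.
exact: is_deriveX.
Qed.

Lemma is_derive_inv f df : f p != 0 -> is_derive p v f df ->
  is_derive p v (fun x => (f x)^-1) (- (f p ^- 2 * df)).
Proof.
move=> f0 [d <-]; split; first exact: derivableV.
by rewrite deriveV // scaleNr.
Qed.

Lemma is_derive_const (c : R) : is_derive p v (fun=> c) 0.
Proof. exact: is_derive_cst. Qed.

End DeriveRules.

(** Follows the syntax of the function. The leaves and the nonvanishing of denominators are taken
    from the context, which is why instances such as [dh x] are introduced beforehand. Used under
    [is_derive_eq], it computes the derivative and leaves an algebraic identity with the expected
    one. *)
Ltac der := lazymatch goal with
  | |- is_derive _ _ (fun _ => ?c) _ => notypeclasses refine (is_derive_const _ _ _)
  | |- is_derive _ _ (fun x => @?f x + @?g x) _ =>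
      notypeclasses refine (@is_derive_add _ _ _ _ f g _ _ _ _); der
  | |- is_derive _ _ (fun x => - @?f x) _ =>
      notypeclasses refine (@is_derive_opp _ _ _ _ f _ _); der
  | |- is_derive _ _ (fun x => @?f x * @?g x) _ =>
      notypeclasses refine (@is_derive_mul _ _ _ _ f g _ _ _ _); der
  | |- is_derive _ _ (fun x => @?f x ^+ _) _ =>
      notypeclasses refine (@is_derive_exp _ _ _ _ f _ _ _); der
  | |- is_derive _ _ (fun x => (@?f x)^-1) _ =>
      notypeclasses refine (@is_derive_inv _ _ _ _ f _ _ _); [by []|der]
  | |- _ => eassumption
  end.

(** * Smoothness and derivatives of the primitive variables *)

Section Primitives.
Context {R : realType}.
Implicit Types (q u v : 'rV[R]_11).
Let D := @admissible R.
Let oD : open D := open_admissible.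

Lemma admissible_qH q : D q -> qH q != 0.
Proof. by move=> [h _ _]; rewrite gt_eqF. Qed.

Lemma smooth_qH : smooth_on D (@qH R).
Proof. exact: smooth_linear oD scalar_qH. Qed.

Lemma smooth_qHV : smooth_on D (fun q => (qH q)^-1).
Proof. exact (smoothV oD (@admissible_qH) smooth_qH). Qed.

Lemma smooth_vel i : smooth_on D (fun q => vel q 0 i).
Proof.
apply: (smooth_ext oD) (smoothM oD smooth_qHV (smooth_linear oD (scalar_qHU i))).
by move=> q _; rewrite [in RHS]mxE.
Qed.

Lemma smooth_defF i j : smooth_on D (fun q => defF q i j).
Proof.
apply: (smooth_ext oD) (smoothM oD smooth_qHV (smooth_linear oD (scalar_qHF i j))).
by move=> q _; rewrite [in RHS]mxE.
Qed.

Lemma smooth_tenW i j : smooth_on D (fun q => tenW q i j).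
Proof.
apply: (smooth_ext oD) (smoothM oD smooth_qHV (smooth_linear oD (scalar_qHW i j))).
by move=> q _; rewrite [in RHS]mxE.
Qed.

Lemma smooth_scaw : smooth_on D (@scaw R).
Proof.
by apply: (smooth_ext oD) (smoothM oD smooth_qHV (smooth_linear oD scalar_qHw)).
Qed.

Lemma smooth_stressAcc : smooth_on D (@stressAcc R).
Proof. by apply: (smooth_ext oD) (smoothX oD 4 smooth_scaw). Qed.

Lemma smooth_mxdet (F : 'rV[R]_11 -> 'M[R]_2) :
  (forall i j, smooth_on D (fun q => F q i j)) ->
  smooth_on D (fun q => F q 0 0 * F q 1 1 - F q 0 1 * F q 1 0).
Proof. by move=> sF; apply: smoothB => //; apply: smoothM. Qed.

Lemma smooth_mxinv (F : 'rV[R]_11 -> 'M[R]_2) :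
  (forall q, D q -> spd (F q)) ->
  (forall i j, smooth_on D (fun q => F q i j)) ->
  forall i j, smooth_on D (fun q => invmx (F q) i j).
Proof.
move=> pF sF i j; have sd := smooth_mxdet sF.
have d0 q : D q -> F q 0 0 * F q 1 1 - F q 0 1 * F q 1 0 != 0.
  by move=> /pF /spd2_det; rewrite det2E => d; rewrite gt_eqF.
have sdV := smoothV oD d0 sd.
have s (f : 'rV[R]_11 -> R) : smooth_on D f ->
    (forall q, f q = mx2 (F q 1 1) (- F q 0 1) (- F q 1 0) (F q 0 0) i j) ->
    smooth_on D (fun q => invmx (F q) i j).
  move=> sf fE; apply: (smooth_ext oD) (smoothM oD sdV sf) => q Dq.
  by rewrite invmx2E ?d0 // [in RHS]mxE fE.
move: i j s; apply: ord2P; apply: ord2P => s.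
- by apply: (s _ (sF 1 1)) => q; rewrite mx2E.
- by apply: (s _ (smoothN oD (sF 0 1))) => q; rewrite mx2E.
- by apply: (s _ (smoothN oD (sF 1 0))) => q; rewrite mx2E.
- by apply: (s _ (sF 0 0)) => q; rewrite mx2E.
Qed.

Lemma smooth_sqrtmx2 i j : smooth_on D (fun q => sqrtmx2 (tenW q) i j).
Proof.
have dE q : D q -> 0 < tenW q 0 0 * tenW q 1 1 - tenW q 0 1 * tenW q 1 0.
  by move=> [_ /spd2_det]; rewrite det2E.
have sd := smooth_sqrt oD dE (smooth_mxdet smooth_tenW).
have t0 q : D q -> 0 < tenW q 0 0 + tenW q 1 1
    + 2 * Num.sqrt (tenW q 0 0 * tenW q 1 1 - tenW q 0 1 * tenW q 1 0).
  move=> Dq; have [_ sW _] := Dq; have [_ w0 _] := (spd2P _).1 sW.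
  by rewrite !addr_gt0 ?(spd2_11 sW) // mulr_gt0 // sqrtr_gt0 dE.
have st := smooth_sqrt oD t0 (smoothD oD (smoothD oD (smooth_tenW 0 0)
  (smooth_tenW 1 1)) (smoothM oD (smooth_cst oD (2 : R)) sd)).
have n0 q : D q -> Num.sqrt (tenW q 0 0 + tenW q 1 1
    + 2 * Num.sqrt (tenW q 0 0 * tenW q 1 1 - tenW q 0 1 * tenW q 1 0)) != 0.
  by move=> Dq; rewrite gt_eqF // sqrtr_gt0 t0.
have s := smoothM oD (smoothV oD n0 st) (smoothD oD (smooth_tenW i j)
  (smoothM oD sd (smooth_cst oD ((i == j)%:R : R)))).
apply: (smooth_ext oD) s => q _.
by rewrite /sqrtmx2 [RHS]mxE [(tenW q + _) i j]mxE [(_%:M) i j]mxE det2E tr2E mulr_natr.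
Qed.

Lemma smooth_stressA i j : smooth_on D (fun q => stressA q i j).
Proof.
have s := smooth_mxinv (F := fun q => sqrtmx2 (tenW q)) _ smooth_sqrtmx2 i j.
apply: (smooth_ext oD) (s _) => [q [_ sW _]|q [_ /sqrtmx2P[] //]].
by rewrite /stressA invsqrtmxE.
Qed.

Lemma stressA_spd q : D q -> spd (stressA q).
Proof. by move=> [_ /invsqrtmxP[]]. Qed.

Lemma stressA_sqr q : D q -> stressA q *m stressA q = invmx (tenW q).
Proof. by move=> [_ /invsqrtmxP[]]. Qed.

Lemma stressA_sym q : D q -> stressA q 1 0 = stressA q 0 1.
Proof. by move=> /stressA_spd /spd2P[]. Qed.

(** Differentiate [A A Y = 1], then multiply on the right by [A A = Y^-1]. *)
Lemma stressA_lyapunov q v : D q ->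
  stressA q *m dmx stressA v q + dmx stressA v q *m stressA q
  = - (stressA q *m stressA q *m dmx tenW v q *m (stressA q *m stressA q)).
Proof.
move=> Dq; have dA i j := smooth_differentiable (smooth_stressA i j) Dq.
have dY i j := smooth_differentiable (smooth_tenW i j) Dq.
have dAA i j : differentiable (fun x => (stressA x *m stressA x) i j) q.
  have -> : (fun x => (stressA x *m stressA x) i j) = (fun x : 'rV[R]_11 =>
      stressA x i 0 * stressA x 0 j + stressA x i 1 * stressA x 1 j).
    by apply/funext => x; rewrite mulmx2E.
  by apply: (@differentiableD R _ R^o); exact: differentiableM.
have uY x : D x -> tenW x \in unitmx by move=> [_ /spd2_unit].
have e : dmx (fun x => stressA x *m stressA x *m tenW x) v q = 0.
  apply/matrixP => i j; rewrite !mxE -(derive_cst ((1%:M : 'M[R]_2) i j) q v).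
  apply: (derive_ext oD) => // x Dx.
  by rewrite stressA_sqr // mulVmx // uY.
rewrite dmxM // dmxM // in e.
have := congr1 (fun M => M *m (stressA q *m stressA q)) e.
rewrite mul0mx mulmxDl -mulmxA [X in _ *m (tenW q *m X)]stressA_sqr //.
rewrite mulmxV ?uY // mulmx1 => /eqP; rewrite addr_eq0 addrC => /eqP //.
Qed.

(** The working form: a derivative of [Y^(-1/2)] is identified by guessing a symmetric solution of
    its Lyapunov equation. *)
Lemma dmx_stressA_uniq q v (E : 'M[R]_2) : D q -> E 1 0 = E 0 1 ->
  stressA q *m E + E *m stressA q
  = - (stressA q *m stressA q *m dmx tenW v q *m (stressA q *m stressA q)) ->
  dmx stressA v q = E.
Proof.
move=> Dq sE e; apply: (lyapunov_uniq (stressA_spd Dq)) => //.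
  rewrite mxE [RHS]mxE; apply: (derive_ext oD) => // x Dx; exact: stressA_sym.
by rewrite e stressA_lyapunov.
Qed.

(** The Lyapunov equation is linear in the variation of [Y]. It is applied with [c] a velocity
    component for advection, and with [c = 0] for directions that leave [Y] fixed. *)
Lemma stressA_transport q v w (c : R) : D q ->
  dmx tenW w q = c *: dmx tenW v q ->
  dmx stressA w q = c *: dmx stressA v q.
Proof.
move=> Dq e; apply: dmx_stressA_uniq => //.
  rewrite !mxE; congr (_ * _).
  apply: (derive_ext oD) => // x Dx; exact: stressA_sym.
rewrite e -scalemxAr -scalemxAl -scalemxAr -!scalemxAl -scalerDr.
by rewrite stressA_lyapunov // scalerN.
Qed.

Section Directional.
Context (q u : 'rV[R]_11) (Dq : D q).

Lemma is_derive_linear (l : 'rV[R]_11 -> R) : scalar l ->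
  is_derive q u l (l u).
Proof.
move=> sl; split; first exact/diff_derivable/differentiable_scalar.
exact: derive_scalar.
Qed.

Lemma is_derive_smooth (f : 'rV[R]_11 -> R) : smooth_on D f ->
  is_derive q u f ('D_u f q).
Proof.
by move=> sf; split=> //; exact/diff_derivable/(smooth_differentiable sf).
Qed.

Lemma is_derive_ratio (l : 'rV[R]_11 -> R) : scalar l ->
  is_derive q u (fun x => (qH x)^-1 * l x)
    ((l u - (qH q)^-1 * l q * qH u) / qH q).
Proof.
move=> /is_derive_linear dl; have dh := is_derive_linear scalar_qH.
have h0 := admissible_qH Dq.
notypeclasses refine (is_derive_eq _ _); [der|cbv beta].
by field.
Qed.

Lemma is_derive_vel i : is_derive q u (fun x => vel x 0 i)
  ((qHU u 0 i - vel q 0 i * qH u) / qH q).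
Proof.
rewrite [vel q 0 i]mxE.
have -> : (fun x : 'rV[R]_11 => vel x 0 i) = (fun x => (qH x)^-1 * qHU x 0 i).
  by apply/funext => x; rewrite [LHS]mxE.
exact: is_derive_ratio (scalar_qHU i).
Qed.

Lemma is_derive_defF i j : is_derive q u (fun x => defF x i j)
  ((qHF u i j - defF q i j * qH u) / qH q).
Proof.
rewrite [defF q i j]mxE.
have -> : (fun x : 'rV[R]_11 => defF x i j) = (fun x => (qH x)^-1 * qHF x i j).
  by apply/funext => x; rewrite [LHS]mxE.
exact: is_derive_ratio (scalar_qHF i j).
Qed.

Lemma is_derive_tenW i j : is_derive q u (fun x => tenW x i j)
  ((qHW u i j - tenW q i j * qH u) / qH q).
Proof.
rewrite [tenW q i j]mxE.
have -> : (fun x : 'rV[R]_11 => tenW x i j) = (fun x => (qH x)^-1 * qHW x i j).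
  by apply/funext => x; rewrite [LHS]mxE.
exact: is_derive_ratio (scalar_qHW i j).
Qed.

Lemma is_derive_scaw : is_derive q u (@scaw R)
  ((qHw u - scaw q * qH u) / qH q).
Proof. exact: is_derive_ratio scalar_qHw. Qed.

Lemma is_derive_stressA i j : is_derive q u (fun x => stressA x i j)
  (dmx stressA u q i j).
Proof. by rewrite mxE; exact: is_derive_smooth (smooth_stressA i j). Qed.

End Directional.

End Primitives.

(** Unknown leaves, such as the conformation in [flux_with], are left as goals to the caller. *)
Ltac smooth oD := lazymatch goal with
  | |- smooth_on _ (fun _ => ?c) => exact (smooth_cst oD c)
  | |- smooth_on _ (fun x => @?f x + - @?g x) =>
      notypeclasses refine (@smoothB _ _ _ oD f g _ _); smooth oD
  | |- smooth_on _ (fun x => @?f x + @?g x) =>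
      notypeclasses refine (@smoothD _ _ _ oD f g _ _); smooth oD
  | |- smooth_on _ (fun x => - @?f x) =>
      notypeclasses refine (@smoothN _ _ _ oD f _); smooth oD
  | |- smooth_on _ (fun x => @?f x * @?g x) =>
      notypeclasses refine (@smoothM _ _ _ oD f g _ _); smooth oD
  | |- smooth_on _ (fun x => @?f x ^+ ?n) =>
      notypeclasses refine (@smoothX _ _ _ oD f n _); smooth oD
  | |- smooth_on _ (fun x => (@?f x)^-1) =>
      notypeclasses refine (@smoothV _ _ _ oD f _ _); [|smooth oD]
  | |- smooth_on _ (fun x => qH x) => exact smooth_qH
  | |- smooth_on _ (fun x => fun_of_matrix (vel x) _ ?i) => exact (smooth_vel i)
  | |- smooth_on _ (fun x => fun_of_matrix (defF x) ?i ?k) => exact (smooth_defF i k)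
  | |- smooth_on _ (fun x => fun_of_matrix (tenW x) ?i ?k) => exact (smooth_tenW i k)
  | |- smooth_on _ (fun x => scaw x) => exact smooth_scaw
  | |- smooth_on _ (fun x => fun_of_matrix (stressA x) ?i ?k) => exact (smooth_stressA i k)
  | |- _ => idtac
  end.

(** * Compatibility of the energy with the fluxes *)

Section EnergyCompatibility.
Context {R : realType} (P : physics R).
Implicit Types (q u v x : 'rV[R]_11).
Let D := @admissible R.
Let oD : open D := open_admissible.
Let g := grav P.
Let G := elas P.

Lemma mulFAFtE (F A : 'M[R]_2) i j : (F *m A *m F^T) i j
  = (F i 0 * A 0 0 + F i 1 * A 1 0) * F j 0
    + (F i 0 * A 0 1 + F i 1 * A 1 1) * F j 1.
Proof. by rewrite !mulmx2E !mxE. Qed.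

Section FluxComponents.
Context (A : 'rV[R]_11 -> 'M[R]_2) (Acc : 'rV[R]_11 -> R) (j : 'I_2).
Let f := flux_with P A Acc j.

Lemma qH_flux x : qH (f x) = qH x * vel x 0 j.
Proof. exact: qH_pack. Qed.

Lemma qHU_flux x i : qHU (f x) 0 i = qH x * vel x 0 j * vel x 0 i
  + (g / 2 * qH x ^+ 2 + G * Acc x * qH x ^+ 3) * (j == i)%:R
  - G * qH x * ((defF x j 0 * A x 0 0 + defF x j 1 * A x 1 0) * defF x i 0
                + (defF x j 0 * A x 0 1 + defF x j 1 * A x 1 1) * defF x i 1).
Proof. by rewrite -mulFAFtE /f /flux_with qHU_pack mxE. Qed.

Lemma qHF_flux x i al : qHF (f x) i al
  = qH x * vel x 0 j * defF x i al - qH x * defF x j al * vel x 0 i.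
Proof. by rewrite /f /flux_with qHF_pack mxE. Qed.

Lemma qHW_flux x i k : qHW (f x) i k = qH x * vel x 0 j * tenW x i k.
Proof.
rewrite /f /flux_with qHW_pack vecsym_symvec; first by rewrite mxE.
by rewrite mxE [RHS]mxE tenW_sym.
Qed.

Lemma qHw_flux x : qHw (f x) = qH x * vel x 0 j * scaw x.
Proof. exact: qHw_pack. Qed.

Lemma smooth_flux_with : (forall i k, smooth_on D (fun x => A x i k)) ->
  smooth_on D Acc -> smooth_on D f.
Proof.
move=> sA sAcc; apply: smooth_pack => //.
- by smooth oD.
- move=> i; refine (smooth_ext oD (f := fun x => qH x * vel x 0 j * vel x 0 i
    + (g / 2 * qH x ^+ 2 + G * Acc x * qH x ^+ 3) * (j == i)%:R
    - G * qH x * ((defF x j 0 * A x 0 0 + defF x j 1 * A x 1 0) * defF x i 0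
      + (defF x j 0 * A x 0 1 + defF x j 1 * A x 1 1) * defF x i 1)) _ _).
    by move=> x _; rewrite [RHS]mxE mulFAFtE.
  by smooth oD; first [exact (sA _ _)|exact sAcc].
- move=> i al; refine (smooth_ext oD (f := fun x =>
    qH x * vel x 0 j * defF x i al - qH x * defF x j al * vel x 0 i) _ _).
    by move=> x _; rewrite [RHS]mxE.
  by smooth oD; first [exact (sA _ _)|exact sAcc].
- move=> i k; refine (smooth_ext oD (f := fun x =>
    qH x * vel x 0 j * tenW x i k) _ _).
    by move=> x _; rewrite [RHS]mxE.
  by smooth oD; first [exact (sA _ _)|exact sAcc].
- by smooth oD.
Qed.

End FluxComponents.

(** The trace of [SigmaH], in entries. *)
Definition elastic x := G * (
  (defF x 0 0 * stressA x 0 0 + defF x 0 1 * stressA x 1 0) * defF x 0 0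
  + (defF x 0 0 * stressA x 0 1 + defF x 0 1 * stressA x 1 1) * defF x 0 1
  + ((defF x 1 0 * stressA x 0 0 + defF x 1 1 * stressA x 1 0) * defF x 1 0
  + (defF x 1 0 * stressA x 0 1 + defF x 1 1 * stressA x 1 1) * defF x 1 1)).

Lemma energyE x : energy P x = qH x / 2 *
  (vel x 0 0 ^+ 2 + vel x 0 1 ^+ 2 + g * qH x
   + (G * ((defF x 0 0 * stressA x 0 0 + defF x 0 1 * stressA x 1 0) * defF x 0 0
         + (defF x 0 0 * stressA x 0 1 + defF x 0 1 * stressA x 1 1) * defF x 0 1
         + ((defF x 1 0 * stressA x 0 0 + defF x 1 1 * stressA x 1 0) * defF x 1 0
         + (defF x 1 0 * stressA x 0 1 + defF x 1 1 * stressA x 1 1) * defF x 1 1))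
      + G * scaw x ^+ 4 * qH x ^+ 2
      + (tenW x 0 0 ^+ 2 + 2 * tenW x 0 1 ^+ 2 + tenW x 1 1 ^+ 2))).
Proof.
rewrite /energy /SigmaH /Sigmazz /stressAcc; congr (_ * (_ + _ + (_ + _ + _))).
- by rewrite /dot mulmx2E !mxE -!expr2.
- by rewrite linearZ /= tr2E !mulFAFtE.
- by rewrite tr2E !mulmx2E tenW_sym; ring.
Qed.

Lemma energy_fluxE j x : energy_flux P j x
  = vel x 0 j * (energy P x + g / 2 * qH x ^+ 2)
  + qH x * (G * scaw x ^+ 4 * qH x ^+ 2 * vel x 0 j
     - G * ((defF x j 0 * stressA x 0 0 + defF x j 1 * stressA x 1 0) * defF x 0 0
       + (defF x j 0 * stressA x 0 1 + defF x j 1 * stressA x 1 1) * defF x 0 1)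
       * vel x 0 0
     - G * ((defF x j 0 * stressA x 0 0 + defF x j 1 * stressA x 1 0) * defF x 1 0
       + (defF x j 0 * stressA x 0 1 + defF x j 1 * stressA x 1 1) * defF x 1 1)
       * vel x 0 1).
Proof.
rewrite /energy_flux sum2E; congr (_ + _ * _).
have S i : ((Sigmazz P x)%:M - SigmaH P x) j i
    = G * scaw x ^+ 4 * qH x ^+ 2 * (j == i)%:R
      - G * ((defF x j 0 * stressA x 0 0 + defF x j 1 * stressA x 1 0) * defF x i 0
       + (defF x j 0 * stressA x 0 1 + defF x j 1 * stressA x 1 1) * defF x i 1).
  rewrite [LHS]mxE [X in X + _]mxE [X in _ + X]mxE [X in - X]mxE mulFAFtE.
  by rewrite mulr_natr.
rewrite !S; move: j {S}; apply: ord2P; rewrite /=; ring.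
Qed.

Lemma smooth_energy : smooth_on D (energy P).
Proof. refine (smooth_ext oD (fun x _ => esym (energyE x)) _); by smooth oD. Qed.

Lemma smooth_energy_flux j : smooth_on D (energy_flux P j).
Proof.
refine (smooth_ext oD (fun x _ => esym (energy_fluxE j x)) _).
by smooth oD; exact smooth_energy.
Qed.

Lemma derive_comp_scalar (f : 'rV[R]_11 -> 'rV[R]_11) (l : 'rV[R]_11 -> R) q v :
  scalar l -> differentiable f q -> is_derive q v (fun x => l (f x)) (l ('D_v f q)).
Proof.
move=> sl df; have dl := differentiable_scalar (f q) sl.
split; first exact/diff_derivable/(differentiable_comp df dl).
by rewrite (derive_chain v df dl) derive_scalar.
Qed.

Lemma is_derive_unique (f : 'rV[R]_11 -> R) q v (a b : R) :
  is_derive q v f a -> is_derive q v f b -> a = b.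
Proof. by move=> [_ <-] [_ <-]. Qed.

Section Rates.
Context (q u : 'rV[R]_11).

(** The rates of the primitive variables in the direction [u]. They become the atoms of the final
    computation, so that no conservative component other than the depth has to be expanded there. *)
Definition dvel i := (qHU u 0 i - vel q 0 i * qH u) / qH q.
Definition ddefF i j := (qHF u i j - defF q i j * qH u) / qH q.
Definition dtenW i j := (qHW u i j - tenW q i j * qH u) / qH q.
Definition dscaw := (qHw u - scaw q * qH u) / qH q.
Definition dstressA := dmx stressA u q.

End Rates.

Definition piola_factor al x := - G *
  (vel x 0 0 * (defF x 0 0 * stressA x 0 al + defF x 0 1 * stressA x 1 al)
   + vel x 0 1 * (defF x 1 0 * stressA x 0 al + defF x 1 1 * stressA x 1 al)).

Lemma smooth_piola_factor al : smooth_on D (piola_factor al).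
Proof. by rewrite /piola_factor; smooth oD. Qed.

Section Compat.
Context (j : 'I_2) (q v : 'rV[R]_11) (Dq : D q).
Let f := flux_with P stressA (@stressAcc R) j.
Let w := 'D_v f q.

Let df : differentiable f q.
Proof.
apply: (smooth_differentiable (D := D)) => //.
exact: smooth_flux_with smooth_stressA smooth_stressAcc.
Qed.

Let is_derive_prims u :
  [/\ is_derive q u (@qH R) (qH u),
      forall i, is_derive q u (fun x => vel x 0 i) (dvel q u i),
      forall i k, is_derive q u (fun x => defF x i k) (ddefF q u i k),
      forall i k, is_derive q u (fun x => tenW x i k) (dtenW q u i k)
    & is_derive q u (@scaw R) (dscaw q u)
      /\ forall i k, is_derive q u (fun x => stressA x i k) (dstressA q u i k)].
Proof.
split=> *; first exact: is_derive_linear scalar_qH.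
- exact: is_derive_vel.
- exact: is_derive_defF.
- exact: is_derive_tenW.
- by split=> *; [exact: is_derive_scaw|exact: is_derive_stressA].
Qed.

Lemma qH_dflux : qH w = qH q * dvel q v j + vel q 0 j * qH v.
Proof.
have [dh dU _ _ _] := is_derive_prims v; have dUj := dU j.
apply: is_derive_unique (derive_comp_scalar v scalar_qH df) _.
have -> : (fun x => qH (f x)) = (fun x => qH x * vel x 0 j).
  by apply/funext => x; exact: qH_flux.
by der.
Qed.

Lemma qHw_dflux : qHw w = qH q * vel q 0 j * dscaw q v + scaw q * qH w.
Proof.
have [dh dU _ _ [dy _]] := is_derive_prims v; have dUj := dU j.
rewrite qH_dflux; apply: is_derive_unique (derive_comp_scalar v scalar_qHw df) _.
have -> : (fun x => qHw (f x)) = (fun x => qH x * vel x 0 j * scaw x).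
  by apply/funext => x; exact: qHw_flux.
by der.
Qed.

Lemma qHW_dflux i k : qHW w i k
  = qH q * vel q 0 j * dtenW q v i k + tenW q i k * qH w.
Proof.
have [dh dU _ dY _] := is_derive_prims v; have dUj := dU j; have dYik := dY i k.
rewrite qH_dflux.
apply: is_derive_unique (derive_comp_scalar v (scalar_qHW i k) df) _.
have -> : (fun x => qHW (f x) i k) = (fun x => qH x * vel x 0 j * tenW x i k).
  by apply/funext => x; exact: qHW_flux.
by der.
Qed.

Lemma qHF_dflux i al : qHF w i al
  = qH q * vel q 0 j * ddefF q v i al + defF q i al * qH w
    - (qH q * defF q j al * dvel q v i
       + vel q 0 i * (qH q * ddefF q v j al + defF q j al * qH v)).
Proof.
have [dh dU dF _ _] := is_derive_prims v; have dUj := dU j; have dUi := dU i.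
have dFj := dF j al; have dFi := dF i al; rewrite qH_dflux.
apply: is_derive_unique (derive_comp_scalar v (scalar_qHF i al) df) _.
have -> : (fun x => qHF (f x) i al) = (fun x =>
    qH x * vel x 0 j * defF x i al - qH x * defF x j al * vel x 0 i).
  by apply/funext => x; exact: qHF_flux.
by der.
Qed.

(** The flux of [H y] is the mass flux times [y]: the variation of the mass flux cancels in the
    quotient and pure advection remains. The same holds for [tenW], and for [stressA] by
    transport. *)
Lemma dscaw_dflux : dscaw q w = vel q 0 j * dscaw q v.
Proof.
rewrite {1}/dscaw qHw_dflux addrK -(mulrA (qH q)) mulrAC divff ?mul1r //.
exact: admissible_qH.
Qed.

Lemma dtenW_dflux i k : dtenW q w i k = vel q 0 j * dtenW q v i k.
Proof.
rewrite {1}/dtenW qHW_dflux addrK -(mulrA (qH q)) mulrAC divff ?mul1r //.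
exact: admissible_qH.
Qed.

Lemma dstressA_dflux : dstressA q w = vel q 0 j *: dstressA q v.
Proof.
apply: stressA_transport => //; apply/matrixP => i k; rewrite [LHS]mxE [RHS]mxE [X in _ * X]mxE.
have [_ ew] := is_derive_tenW w Dq i k; have [_ ev] := is_derive_tenW v Dq i k.
exact: (etrans ew (etrans (dtenW_dflux i k) (congr1 (fun z => _ * z) (esym ev)))).
Qed.

(** Expressed by primitive rates, with the symmetry of [A] and [Y] already used: each off-diagonal
    entry counts twice. *)
Definition denergy u := qH u / 2 * (vel q 0 0 ^+ 2 + vel q 0 1 ^+ 2 + g * qH q
   + (elastic q + G * scaw q ^+ 4 * qH q ^+ 2
      + (tenW q 0 0 ^+ 2 + 2 * tenW q 0 1 ^+ 2 + tenW q 1 1 ^+ 2)))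
  + qH q / 2 * (2 * (vel q 0 0 * dvel q u 0 + vel q 0 1 * dvel q u 1) + g * qH u
    + (G * (2 * (defF q 0 0 * ddefF q u 0 0 + defF q 1 0 * ddefF q u 1 0) * stressA q 0 0
       + 2 * (defF q 0 1 * ddefF q u 0 0 + defF q 0 0 * ddefF q u 0 1
              + defF q 1 1 * ddefF q u 1 0 + defF q 1 0 * ddefF q u 1 1) * stressA q 0 1
       + 2 * (defF q 0 1 * ddefF q u 0 1 + defF q 1 1 * ddefF q u 1 1) * stressA q 1 1
       + (defF q 0 0 ^+ 2 + defF q 1 0 ^+ 2) * dstressA q u 0 0
       + 2 * (defF q 0 0 * defF q 0 1 + defF q 1 0 * defF q 1 1) * dstressA q u 0 1
       + (defF q 0 1 ^+ 2 + defF q 1 1 ^+ 2) * dstressA q u 1 1)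
      + G * (4 * scaw q ^+ 3 * dscaw q u * qH q ^+ 2 + 2 * scaw q ^+ 4 * qH q * qH u)
      + 2 * (tenW q 0 0 * dtenW q u 0 0 + 2 * tenW q 0 1 * dtenW q u 0 1
             + tenW q 1 1 * dtenW q u 1 1))).

Lemma dstressA_sym u : dstressA q u 1 0 = dstressA q u 0 1.
Proof.
rewrite mxE [RHS]mxE; apply: (derive_ext oD) => // x Dx; exact: stressA_sym.
Qed.

Lemma is_derive_energy u : is_derive q u (energy P) (denergy u).
Proof.
have [dh dU dF dY [dy dA]] := is_derive_prims u.
have [U0 U1] := (dU 0, dU 1); have [F00 F01] := (dF 0 0, dF 0 1).
have [F10 F11] := (dF 1 0, dF 1 1); have [Y00 Y01] := (dY 0 0, dY 0 1).
have Y11 := dY 1 1; have [A00 A01] := (dA 0 0, dA 0 1).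
have [A10 A11] := (dA 1 0, dA 1 1).
rewrite (funext energyE).
notypeclasses refine (is_derive_eq _ _); [der|cbv beta].
rewrite dstressA_sym (stressA_sym Dq) /denergy /elastic (stressA_sym Dq).
ring.
Qed.

Lemma qHF_rate i al : qHF v i al = qH q * ddefF q v i al + defF q i al * qH v.
Proof. by rewrite /ddefF; field; exact: admissible_qH. Qed.

(** The last bracket is [qHF v j al / qH q]. Contracted with [G H F A], the derivative of the energy
    in [F], it gives the Piola term of [flux_compat]. *)
Lemma ddefF_dflux i al : ddefF q w i al = vel q 0 j * ddefF q v i al
  - (defF q j al * dvel q v i
     + vel q 0 i * (ddefF q v j al + defF q j al * qH v / qH q)).
Proof.
by rewrite [LHS]/ddefF qHF_dflux; field; exact: admissible_qH.
Qed.

(** The momentum equation in primitive form: advection, then the variations of the pressure and of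
    [- G H F A F^T], both divided by [H]. *)
Lemma dvel_dflux i : dvel q w i = vel q 0 j * dvel q v i
  + (g * qH v + G * (4 * scaw q ^+ 3 * dscaw q v * qH q ^+ 2
                     + 3 * scaw q ^+ 4 * qH q * qH v)) * (j == i)%:R
  - G * (qH v / qH q
      * ((defF q j 0 * stressA q 0 0 + defF q j 1 * stressA q 0 1) * defF q i 0
       + (defF q j 0 * stressA q 0 1 + defF q j 1 * stressA q 1 1) * defF q i 1)
    + (ddefF q v j 0 * stressA q 0 0 + ddefF q v j 1 * stressA q 0 1
       + defF q j 0 * dstressA q v 0 0 + defF q j 1 * dstressA q v 0 1)
       * defF q i 0
    + (ddefF q v j 0 * stressA q 0 1 + ddefF q v j 1 * stressA q 1 1
       + defF q j 0 * dstressA q v 0 1 + defF q j 1 * dstressA q v 1 1)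
       * defF q i 1
    + (defF q j 0 * stressA q 0 0 + defF q j 1 * stressA q 0 1) * ddefF q v i 0
    + (defF q j 0 * stressA q 0 1 + defF q j 1 * stressA q 1 1) * ddefF q v i 1).
Proof.
have [dh dU dF dY [dy dA]] := is_derive_prims v.
have [Uj Ui Fj0] := And3 (dU j) (dU i) (dF j 0).
have [Fj1 Fi0 Fi1] := And3 (dF j 1) (dF i 0) (dF i 1).
have [A00 A01] := (dA 0 0, dA 0 1); have [A10 A11] := (dA 1 0, dA 1 1).
have h0 := admissible_qH Dq.
have e := is_derive_unique (derive_comp_scalar v (scalar_qHU i) df).
rewrite [LHS]/dvel; have -> : qHU w 0 i = qH w * vel q 0 i + qH q * (
    vel q 0 j * dvel q v i
  + (g * qH v + G * (4 * scaw q ^+ 3 * dscaw q v * qH q ^+ 2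
                     + 3 * scaw q ^+ 4 * qH q * qH v)) * (j == i)%:R
  - G * (qH v / qH q
      * ((defF q j 0 * stressA q 0 0 + defF q j 1 * stressA q 0 1) * defF q i 0
       + (defF q j 0 * stressA q 0 1 + defF q j 1 * stressA q 1 1) * defF q i 1)
    + (ddefF q v j 0 * stressA q 0 0 + ddefF q v j 1 * stressA q 0 1
       + defF q j 0 * dstressA q v 0 0 + defF q j 1 * dstressA q v 0 1)
       * defF q i 0
    + (ddefF q v j 0 * stressA q 0 1 + ddefF q v j 1 * stressA q 1 1
       + defF q j 0 * dstressA q v 0 1 + defF q j 1 * dstressA q v 1 1)
       * defF q i 1
    + (defF q j 0 * stressA q 0 0 + defF q j 1 * stressA q 0 1) * ddefF q v i 0
    + (defF q j 0 * stressA q 0 1 + defF q j 1 * stressA q 1 1) * ddefF q v i 1)).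
  apply: e; rewrite (funext (fun x => qHU_flux _ _ j x i)) /stressAcc qH_dflux.
  notypeclasses refine (is_derive_eq _ _); [der|cbv beta].
  by rewrite dstressA_sym (stressA_sym Dq); field.
by field.
Qed.

Lemma flux_compat : 'D_w (energy P) q
  = 'D_v (energy_flux P j) q + \sum_(al < 2) piola_factor al q * qHF v j al.
Proof.
have [dh dU dF dY [dy dA]] := is_derive_prims v.
have [U0 U1] := (dU 0, dU 1); have [F00 F01] := (dF 0 0, dF 0 1).
have [F10 F11] := (dF 1 0, dF 1 1); have [Y00 Y01] := (dY 0 0, dY 0 1).
have Y11 := dY 1 1; have [A00 A01] := (dA 0 0, dA 0 1).
have [A10 A11] := (dA 1 0, dA 1 1).
have [Uj Fj0 Fj1] := And3 (dU j) (dF j 0) (dF j 1).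
have de := is_derive_energy v; have [_ ew] := is_derive_energy w.
have h0 := admissible_qH Dq.
(* Phrased as the value of a derivative, so that [der] differentiates [energy_flux] and only an
   equation between rates is left. *)
suff ez : is_derive q v (energy_flux P j)
    (denergy w - \sum_(al < 2) piola_factor al q * qHF v j al).
  have [_ e] := ez; apply: etrans ew _.
  by apply: (etrans (esym (subrK _ _)) (congr1 (fun z => z + _) (esym e))).
rewrite (funext (energy_fluxE j)).
notypeclasses refine (is_derive_eq _ _); [der|cbv beta].
rewrite energyE sum2E /piola_factor !qHF_rate /denergy !dvel_dflux !ddefF_dflux.
rewrite !dtenW_dflux // dscaw_dflux // dstressA_dflux // qH_dflux.
rewrite [(vel q 0 j *: dstressA q v) 0 0]mxE [(vel q 0 j *: dstressA q v) 0 1]mxE.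
rewrite [(vel q 0 j *: dstressA q v) 1 1]mxE /elastic.
rewrite dstressA_sym (stressA_sym Dq).
clear de ew dh dU dF dY dy dA U0 U1 F00 F01 F10 F11 Y00 Y01 Y11 A00 A01 A10 A11.
clear Uj Fj0 Fj1.
(* Entries with index [j] coincide with entries of index 0 or 1 only once [j] is fixed; those
   without [j] are generalized before the split. *)
have : j = 0 \/ j = 1 by move: (j); apply: ord2P; [left|right].
move: h0; move: (dstressA q v 0 0) (dstressA q v 0 1) (dstressA q v 1 1).
move: (stressA q 0 0) (stressA q 0 1) (stressA q 1 1).
move: (scaw q) (dscaw q v) (qH q) (qH v) (g) (G).
move: (dtenW q v 0 0) (dtenW q v 0 1) (dtenW q v 1 1).
move: (tenW q 0 0) (tenW q 0 1) (tenW q 1 1).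
move=> Y0 Y1 Y2 dY0 dY1 dY2 y dy h dh g' G' A0 A1 A2 dA0 dA1 dA2 h0.
case=> ->; move: (ddefF q v 0 0) (ddefF q v 0 1) (ddefF q v 1 0) (ddefF q v 1 1).
  move: (defF q 0 0) (defF q 0 1) (defF q 1 0) (defF q 1 1).
  move: (dvel q v 0) (dvel q v 1) (vel q 0 0) (vel q 0 1).
  by move=> *; rewrite /=; field.
move: (defF q 0 0) (defF q 0 1) (defF q 1 0) (defF q 1 1).
move: (dvel q v 0) (dvel q v 1) (vel q 0 0) (vel q 0 1).
by move=> *; rewrite /=; field.
Qed.

End Compat.

End EnergyCompatibility.

(** * Convexity of the energy *)

Section SecondDerivatives.
Context {R : realType} (n : nat) (D : set 'rV[R]_n.+1).
Hypothesis oD : open D.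

Lemma derive2E (f f' : 'rV[R]_n.+1 -> R) q v (f2 : R) : D q ->
  (forall x, D x -> is_derive x v f (f' x)) -> is_derive q v f' f2 ->
  'D_v ('D_v f) q = f2.
Proof.
move=> Dq df [_ e2]; apply: (etrans _ e2).
by apply: (derive_ext oD v _ Dq) => x Dx; have [_ e] := df x Dx; exact: e.
Qed.

(** The means of differentiating the relation [C C = H X] twice without knowing [C] explicitly. *)
Lemma derive2_eq (f f' g g' : 'rV[R]_n.+1 -> R) q v (f2 g2 : R) : D q ->
  (forall x, D x -> f x = g x) ->
  (forall x, D x -> is_derive x v f (f' x)) -> is_derive q v f' f2 ->
  (forall x, D x -> is_derive x v g (g' x)) -> is_derive q v g' g2 ->
  f' q = g' q /\ f2 = g2.
Proof.
move=> Dq fg df df' dg dg'; have fg' x : D x -> f' x = g' x.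
  move=> Dx; have [_ e1] := df x Dx; have [_ e2] := dg x Dx.
  exact: (etrans (esym e1) (etrans (derive_ext oD v fg Dx) e2)).
split; first exact: fg'.
have [_ e1] := df'; have [_ e2] := dg'.
exact: (etrans (esym e1) (etrans (derive_ext oD v fg' Dq) e2)).
Qed.

End SecondDerivatives.

(** * Algebra of the Lyapunov equation and of the matrix fractional function *)

Section ConvexityAlgebra.
Context {R : realType}.
Implicit Types (a b c k p r z : R).

(* If C E + E C = 2 S then E = (det C S + adj C S adj C) / (tr C det C). *)
Lemma lyapunov_solve (c0 c1 c2 e0 e1 e2 s0 s1 s2 z0 z1 : R) :
  0 < c0 -> 0 < c0 * c2 - c1 ^+ 2 ->
  c0 * e0 + c1 * e1 = s0 -> c1 * (e0 + e2) + e1 * (c0 + c2) = 2 * s1 ->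
  c1 * e1 + c2 * e2 = s2 ->
  z0 ^+ 2 * e0 + 2 * z0 * z1 * e1 + z1 ^+ 2 * e2
  = ((c0 * c2 - c1 ^+ 2) * (z0 ^+ 2 * s0 + 2 * z0 * z1 * s1 + z1 ^+ 2 * s2)
     + ((c2 * z0 - c1 * z1) ^+ 2 * s0
        + 2 * (c2 * z0 - c1 * z1) * (c0 * z1 - c1 * z0) * s1
        + (c0 * z1 - c1 * z0) ^+ 2 * s2))
    / ((c0 + c2) * (c0 * c2 - c1 ^+ 2)).
Proof.
move=> c00 d0 E0 E1 E2.
have c20 : 0 < c2.
  by rewrite -(pmulr_rgt0 _ c00); apply: lt_le_trans d0 _; rewrite gerBl sqr_ge0.
have n0 : c0 != 0 by rewrite gt_eqF.
have n2 : c2 != 0 by rewrite gt_eqF.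
have nd : c0 * c2 - c1 ^+ 2 != 0 by rewrite gt_eqF.
have nt : c0 + c2 != 0 by rewrite gt_eqF // addr_gt0.
(* The elimination of the homogeneous case, with the right-hand sides kept. *)
have e1E : e1 = (c0 * c2 * (2 * s1) - c1 * c2 * s0 - c1 * c0 * s2)
    / ((c0 + c2) * (c0 * c2 - c1 ^+ 2)).
  by rewrite -E0 -E1 -E2; field; rewrite nd nt.
have e0E : e0 = (s0 - c1 * e1) / c0 by rewrite -E0; field.
have e2E : e2 = (s2 - c1 * e1) / c2 by rewrite -E2; field.
by rewrite e0E e2E e1E; field; rewrite nd nt n0 n2.
Qed.

(** The form is [r adj(C) r^T], that is [det C] times [r C^-1 r^T]; multiplied by [c0] it is a sum
    of squares. *)
Lemma quadform_ge0 (c0 c1 c2 r0 r1 : R) :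
  0 < c0 -> 0 < c0 * c2 - c1 ^+ 2 ->
  0 <= r0 ^+ 2 * c2 - 2 * r0 * r1 * c1 + r1 ^+ 2 * c0.
Proof.
move=> c00 d0; rewrite -(pmulr_rge0 _ c00).
rewrite [X in 0 <= X](_ : _ = (r1 * c0 - r0 * c1) ^+ 2
   + (c0 * c2 - c1 ^+ 2) * r0 ^+ 2); last by ring.
by rewrite addr_ge0 ?sqr_ge0 // mulr_ge0 ?sqr_ge0 // ltW.
Qed.

Lemma quadform_eq0 (c0 c1 c2 r0 r1 : R) :
  0 < c0 -> 0 < c0 * c2 - c1 ^+ 2 ->
  r0 ^+ 2 * c2 - 2 * r0 * r1 * c1 + r1 ^+ 2 * c0 = 0 -> r0 = 0 /\ r1 = 0.
Proof.
move=> c00 d0 e.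
have : (r1 * c0 - r0 * c1) ^+ 2 + (c0 * c2 - c1 ^+ 2) * r0 ^+ 2 = 0.
  by rewrite -[RHS](mulr0 c0) -e; ring.
have n0 : 0 <= (c0 * c2 - c1 ^+ 2) * r0 ^+ 2.
  by rewrite mulr_ge0 ?sqr_ge0 // ltW.
move/eqP; rewrite paddr_eq0 ?sqr_ge0 //.
case/andP; rewrite sqrf_eq0 => /eqP e1.
rewrite mulf_eq0 (gt_eqF d0) sqrf_eq0 => /eqP e0.
by move: e1; rewrite e0 mul0r subr0 => /eqP; rewrite mulf_eq0 (gt_eqF c00) orbF
  => /eqP.
Qed.

(* Second derivative of p C^-1 p^T along a line on which C'' solves the
   Lyapunov equation C C'' + C'' C = - 2 K^2. *)
Lemma matrix_fractional_derive2
    (c0 c1 c2 a0 a1 a2 e0 e1 e2 k0 k1 k2 p0 p1 b0 b1 : R) :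
  0 < c0 -> 0 < c0 * c2 - c1 ^+ 2 ->
  c0 * e0 + c1 * e1 = - (k0 ^+ 2 + k1 ^+ 2) ->
  c1 * (e0 + e2) + e1 * (c0 + c2) = 2 * - (k1 * (k0 + k2)) ->
  c1 * e1 + c2 * e2 = - (k1 ^+ 2 + k2 ^+ 2) ->
  let d := c0 * c2 - c1 ^+ 2 in
  let d' := a0 * c2 + c0 * a2 - 2 * c1 * a1 in
  let d2 := e0 * c2 + 2 * a0 * a2 + c0 * e2 - 2 * a1 ^+ 2 - 2 * c1 * e1 in
  let m := p0 ^+ 2 * c2 - 2 * p0 * p1 * c1 + p1 ^+ 2 * c0 in
  let m' := 2 * p0 * b0 * c2 + p0 ^+ 2 * a2 - 2 * (b0 * p1 + p0 * b1) * c1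
            - 2 * p0 * p1 * a1 + 2 * p1 * b1 * c0 + p1 ^+ 2 * a0 in
  let m2 := 2 * b0 ^+ 2 * c2 + 4 * p0 * b0 * a2 + p0 ^+ 2 * e2
            - 4 * b0 * b1 * c1 - 4 * (b0 * p1 + p0 * b1) * a1
            - 2 * p0 * p1 * e1
            + 2 * b1 ^+ 2 * c0 + 4 * p1 * b1 * a0 + p1 ^+ 2 * e0 in
  let z0 := (c2 * p0 - c1 * p1) / d in
  let z1 := (c0 * p1 - c1 * p0) / d in
  let r0 := b0 - (a0 * z0 + a1 * z1) in
  let r1 := b1 - (a1 * z0 + a2 * z1) in
  let y0 := c2 * z0 - c1 * z1 in
  let y1 := c0 * z1 - c1 * z0 in
  m2 / d - 2 * m' * d' / d ^+ 2 - m * d2 / d ^+ 2 + 2 * m * d' ^+ 2 / d ^+ 3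
  = 2 * ((r0 ^+ 2 * c2 - 2 * r0 * r1 * c1 + r1 ^+ 2 * c0) / d)
    + (d * ((k0 * z0 + k1 * z1) ^+ 2 + (k1 * z0 + k2 * z1) ^+ 2)
       + ((k0 * y0 + k1 * y1) ^+ 2 + (k1 * y0 + k2 * y1) ^+ 2))
      / ((c0 + c2) * d).
Proof.
move=> c00 d0 E0 E1 E2 d d' d2 m m' m2 z0 z1 r0 r1 y0 y1.
have nd : d != 0 by rewrite gt_eqF.
(* With [z = C^-1 p] and [r = p' - C' z], the second derivative is twice the form [C^-1] at [r]
   minus the form [C''] at [z]. Solving the Lyapunov equation makes the latter minus a sum of
   squares, at [z] and at [y = adj(C) z]. *)
have := lyapunov_solve z0 z1 c00 d0 E0 E1 E2; rewrite -/d -/y0 -/y1 => L.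
rewrite [X in _ = _ + X](_ : _ =
  - (z0 ^+ 2 * e0 + 2 * z0 * z1 * e1 + z1 ^+ 2 * e2)); last first.
  by rewrite L -mulNr; congr (_ / _); ring.
rewrite /r0 /r1 /z0 /z1 /m2 /m' /m /d2 /d' {y0 y1 L}.
move: nd; rewrite /d => nd; field.
exact: nd.
Qed.

End ConvexityAlgebra.

Section LyapunovPair.
Context {R : realType}.

(* First and second derivatives of C^2 = h X along a line, where h and X are
   affine, written with K = C' - (h' / h) C. *)
Lemma lyapunov_pair (x0 x1 x2 b0 b1 b2 c0 c1 c2 h h' a0 a1 a2 e0 e1 e2 : R) :
  h != 0 ->
  c0 ^+ 2 + c1 ^+ 2 = h * x0 -> c1 * (c0 + c2) = h * x1 ->
  c1 ^+ 2 + c2 ^+ 2 = h * x2 ->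
  2 * c0 * a0 + 2 * c1 * a1 = h * b0 + x0 * h' ->
  c1 * (a0 + a2) + (c0 + c2) * a1 = h * b1 + x1 * h' ->
  2 * c1 * a1 + 2 * c2 * a2 = h * b2 + x2 * h' ->
  2 * (a0 ^+ 2 + c0 * e0) + 2 * (a1 ^+ 2 + c1 * e1) = 2 * (h' * b0) ->
  c1 * (e0 + e2) + e1 * (c0 + c2) + 2 * (a1 * (a0 + a2)) = 2 * (h' * b1) ->
  2 * (a1 ^+ 2 + c1 * e1) + 2 * (a2 ^+ 2 + c2 * e2) = 2 * (h' * b2) ->
  let k0 := a0 - h' / h * c0 in let k1 := a1 - h' / h * c1 in
  let k2 := a2 - h' / h * c2 in
  [/\ c0 * k0 + c1 * k1 = (h * b0 - h' * x0) / 2,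
      c1 * (k0 + k2) + k1 * (c0 + c2) = h * b1 - h' * x1
    & c1 * k1 + c2 * k2 = (h * b2 - h' * x2) / 2]
  /\ [/\ c0 * e0 + c1 * e1 = - (k0 ^+ 2 + k1 ^+ 2),
      c1 * (e0 + e2) + e1 * (c0 + c2) = 2 * - (k1 * (k0 + k2))
    & c1 * e1 + c2 * e2 = - (k1 ^+ 2 + k2 ^+ 2)].
Proof.
move=> h0 r0 r1 r2 u0 u1 u2 w0 w1 w2 k0 k1 k2; rewrite /k0 /k1 /k2.
(* For affine [h] and [X], [(h X)'' - 2 (h'/h) (h X)' + 2 (h'/h)^2 h X = 0]. The same combination
   for [C C] is [C C'' + C'' C + 2 K^2], which explains both [K] and the right-hand side. The two
   diagonal entries share one computation. *)
have diag c d a b e f x z :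
    c ^+ 2 + d ^+ 2 = h * x -> 2 * c * a + 2 * d * b = h * z + x * h' ->
    2 * (a ^+ 2 + c * e) + 2 * (b ^+ 2 + d * f) = 2 * (h' * z) ->
    c * (a - h' / h * c) + d * (b - h' / h * d) = (h * z - h' * x) / 2 /\
    c * e + d * f = - ((a - h' / h * c) ^+ 2 + (b - h' / h * d) ^+ 2).
  move=> r u w; split.
    rewrite [LHS](_ : _ = (2 * c * a + 2 * d * b) / 2 - h' / h * (c ^+ 2 + d ^+ 2)).
      by rewrite u r; field.
    by field.
  apply/eqP; rewrite -addr_eq0; apply/eqP.
  rewrite [LHS](_ : _ = (2 * (a ^+ 2 + c * e) + 2 * (b ^+ 2 + d * f)) / 2
    - h' / h * (2 * c * a + 2 * d * b) + (h' / h) ^+ 2 * (c ^+ 2 + d ^+ 2)).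
    by rewrite w u r; field.
  by field.
have [d1 d4] := diag _ _ _ _ _ _ _ _ r0 u0 w0.
have [d3 d6] := diag _ _ _ _ _ _ _ _ r2 u2 w2.
split; split=> //.
  rewrite [LHS](_ : _ = c1 * (a0 + a2) + (c0 + c2) * a1
    - 2 * (h' / h) * (c1 * (c0 + c2))).
    by rewrite u1 r1; field.
  by field.
apply/eqP; rewrite mulrN -addr_eq0; apply/eqP.
rewrite [LHS](_ : _ = c1 * (e0 + e2) + e1 * (c0 + c2) + 2 * (a1 * (a0 + a2))
  - 2 * (h' / h) * (c1 * (a0 + a2) + (c0 + c2) * a1)
  + 2 * (h' / h) ^+ 2 * (c1 * (c0 + c2))).
  by rewrite w1 u1 r1; field.
by field.
Qed.

End LyapunovPair.

(** * Second derivatives of the energy in conservative variables *)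

Section EnergyHessian.
Context {R : realType} (P : physics R).
Implicit Types (q u v x : 'rV[R]_11).
Let D := @admissible R.
Let oD : open D := open_admissible.
Let g := grav P.
Let G := elas P.

(** The first derivative is required on the whole open set, since the second one is the derivative
    at [q] of that function; leaving [f'] existential lets terms be added and scaled freely. *)
Definition has_derive2 q v (f : 'rV[R]_11 -> R) (f2 : R) := exists2 f',
  (forall x, D x -> is_derive x v f (f' x)) & is_derive q v f' f2.

Lemma has_derive2_add q v f f1 f2 f12 : has_derive2 q v f f2 ->
  has_derive2 q v f1 f12 -> has_derive2 q v (fun x => f x + f1 x) (f2 + f12).
Proof.
move=> [f' df df'] [f1' df1 df1']; exists (fun x => f' x + f1' x).
  by move=> x Dx; apply: is_derive_add; [exact: df|exact: df1].
exact: is_derive_add.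
Qed.

Lemma has_derive2_scale q v f f2 (c : R) : has_derive2 q v f f2 ->
  has_derive2 q v (fun x => c * f x) (c * f2).
Proof.
move=> [f' df df']; exists (fun x => c * f' x) => [x Dx|].
  have dfx := df x Dx.
  by notypeclasses refine (is_derive_eq _ _); [der|cbv beta; rewrite mulr0 addr0].
by notypeclasses refine (is_derive_eq _ _); [der|cbv beta; rewrite mulr0 addr0].
Qed.

Lemma has_derive2E q v f f1 f2 : D q -> (forall x, D x -> f1 x = f x) ->
  has_derive2 q v f f2 -> 'D_v ('D_v f1) q = f2.
Proof.
move=> Dq fg [f' df df']; apply: (etrans _ (derive2E oD Dq df df')).
by apply: (derive_ext oD) => // x Dx; exact: (derive_ext oD v fg Dx).
Qed.

(* The matrix C = H Y^(1/2). Its square H * HY is a product of affine functions of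
   the state, which gives access to C' and C'' along lines. *)
Definition geomean x : 'M[R]_2 := qH x *: sqrtmx2 (tenW x).

Lemma smooth_geomean i j : smooth_on D (fun x => geomean x i j).
Proof.
refine (smooth_ext oD _ (smoothM oD smooth_qH (smooth_sqrtmx2 i j))).
by move=> x _; rewrite [RHS]mxE.
Qed.

Lemma geomean_spd x : D x -> spd (geomean x).
Proof. by move=> [h sW _]; apply: spd_scale => //; have [] := sqrtmx2P sW. Qed.

Lemma geomean_sqr x : D x -> geomean x *m geomean x = qH x *: qHW x.
Proof.
move=> Dx; have h0 := admissible_qH Dx; have [h sW _] := Dx.
have [_ e] := sqrtmx2P sW.
rewrite /geomean -scalemxAl -scalemxAr e /tenW !scalerA.
by rewrite mulfK.
Qed.

Definition geodet x := geomean x 0 0 * geomean x 1 1 - geomean x 0 1 ^+ 2.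

Lemma geodet_gt0 x : D x -> 0 < geodet x.
Proof. by move=> /geomean_spd /spd2P[]. Qed.

Lemma geomean_rel x : D x ->
  [/\ geomean x 0 0 ^+ 2 + geomean x 0 1 ^+ 2 = qH x * qHW x 0 0,
      geomean x 0 1 * (geomean x 0 0 + geomean x 1 1) = qH x * qHW x 0 1
    & geomean x 0 1 ^+ 2 + geomean x 1 1 ^+ 2 = qH x * qHW x 1 1].
Proof.
move=> Dx; have [s _ _] := (spd2P _).1 (geomean_spd Dx).
have e i j := congr1 (fun M : 'M[R]_2 => M i j) (geomean_sqr Dx).
have e00 := e 0 0; have e01 := e 0 1; have e11 := e 1 1.
rewrite mulmx2E [in RHS]mxE s in e00; rewrite mulmx2E [in RHS]mxE in e01.
rewrite mulmx2E [in RHS]mxE s in e11.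
by split; rewrite -?e00 -?e01 -?e11; ring.
Qed.

(** Cramer's rule for [A = H C^-1]. *)
Lemma stressA_geomean x : D x ->
  [/\ stressA x 0 0 = qH x * geomean x 1 1 / geodet x,
      stressA x 0 1 = - (qH x * geomean x 0 1 / geodet x),
      stressA x 1 0 = - (qH x * geomean x 0 1 / geodet x)
    & stressA x 1 1 = qH x * geomean x 0 0 / geodet x].
Proof.
move=> Dx; have h0 := admissible_qH Dx; have [_ sW _] := Dx.
have [sB _] := sqrtmx2P sW; have [s b0 d0] := (spd2P _).1 sB.
have := invsqrtmxE sW; rewrite -[invsqrtmx _]/(stressA x).
rewrite invmx2E; last by rewrite s -expr2 gt_eqF.
have gE i j : geomean x i j = qH x * sqrtmx2 (tenW x) i j by rewrite mxE.
rewrite /geodet !gE; move: (sqrtmx2 (tenW x)) s d0 => B s d0 ->.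
have nd : B 0 0 * B 1 1 - B 0 1 ^+ 2 != 0 by rewrite gt_eqF.
have nd2 : qH x * B 0 0 * (qH x * B 1 1) - (qH x * B 0 1) ^+ 2 != 0.
  rewrite [X in X != 0](_ : _ = qH x ^+ 2 * (B 0 0 * B 1 1 - B 0 1 ^+ 2)); last by ring.
  by rewrite mulf_neq0 // expf_neq0.
by split; rewrite mxE mx2E s; field; rewrite ?h0 -?expr2 ?nd ?nd2.
Qed.

(** The matrix fractional function [p C^-1 p^T] at the row [p] of index [i] of [HF]. *)
Definition fractional i x := (qHF x i 0 ^+ 2 * geomean x 1 1
  - 2 * qHF x i 0 * qHF x i 1 * geomean x 0 1
  + qHF x i 1 ^+ 2 * geomean x 0 0) / geodet x.

Definition sqratio (l : 'rV[R]_11 -> R) x := l x ^+ 2 / (2 * qH x).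

Definition Hterm x := qH x ^+ 2 / 2.

(** This is [H^3 A^cc] with [A^cc = (w / H)^4]. With [w = H A^cc] as variable it would be [w H^2],
    which is not convex: hence the fourth power in the change of variables. *)
Definition wterm x := qHw x ^+ 4 / qH x.

(** Every summand is now a convex function of linear functions of the state, except that
    [fractional] also involves the geometric mean. *)
Lemma energy_conservative x : D x -> energy P x =
  sqratio (fun x => qHU x 0 0) x + sqratio (fun x => qHU x 0 1) x
  + g * Hterm x
  + (sqratio (fun x => qHW x 0 0) x + 2 * sqratio (fun x => qHW x 0 1) x
     + sqratio (fun x => qHW x 1 1) x)
  + G / 2 * (wterm x + (fractional 0 x + fractional 1 x)).
Proof.
move=> Dx; have h0 := admissible_qH Dx; have [a00 a01 a10 a11] := stressA_geomean Dx.
have d0 : geodet x != 0 by rewrite gt_eqF ?geodet_gt0.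
rewrite energyE a00 a01 a10 a11 /sqratio /Hterm /wterm /fractional.
have vE i : vel x 0 i = (qH x)^-1 * qHU x 0 i by rewrite [LHS]mxE.
have fE i j : defF x i j = (qH x)^-1 * qHF x i j by rewrite [LHS]mxE.
have tE i j : tenW x i j = (qH x)^-1 * qHW x i j by rewrite [LHS]mxE.
rewrite !vE !fE !tE {vE fE tE}.
rewrite /scaw -/g -/G.
move: d0 h0; move: (geodet x) (qH x) (qHw x) (geomean x 0 0) (geomean x 0 1).
move: (geomean x 1 1) (qHU x 0 0) (qHU x 0 1) (qHW x 0 0) (qHW x 0 1) (qHW x 1 1).
move: (qHF x 0 0) (qHF x 0 1) (qHF x 1 0) (qHF x 1 1) (g) (G) => *.
by field; apply/andP.
Qed.

Section AlongDirection.
Context (q v : 'rV[R]_11) (Dq : D q).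

Let dh x : is_derive x v (@qH R) (qH v).
Proof. exact: is_derive_linear scalar_qH. Qed.

Lemma has_derive2_sqratio l : scalar l ->
  has_derive2 q v (sqratio l) ((l v - l q * qH v / qH q) ^+ 2 / qH q).
Proof.
rewrite /sqratio => sl; have dl x : is_derive x v l (l v) by exact: is_derive_linear.
exists (fun x => l x * l v / qH x - l x ^+ 2 * qH v / (2 * qH x ^+ 2)).
  move=> x Dx; have h0 := admissible_qH Dx; have dlx := dl x; have dhx := dh x.
  have h2 : 2 * qH x != 0 by rewrite mulf_neq0 // pnatr_eq0.
  by notypeclasses refine (is_derive_eq _ _); [der|cbv beta; field].
have h0 := admissible_qH Dq; have dlq := dl q; have dhq := dh q.
have h2 : 2 * qH q ^+ 2 != 0 by rewrite mulf_neq0 ?expf_neq0 // pnatr_eq0.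
by notypeclasses refine (is_derive_eq _ _); [der|cbv beta; field].
Qed.

Lemma has_derive2_Hterm : has_derive2 q v Hterm (qH v ^+ 2).
Proof.
rewrite /Hterm; exists (fun x => qH x * qH v) => [x Dx|].
  have dhx := dh x.
  by notypeclasses refine (is_derive_eq _ _); [der|cbv beta; field].
have dhq := dh q.
by notypeclasses refine (is_derive_eq _ _); [der|cbv beta; ring].
Qed.

Lemma has_derive2_wterm : has_derive2 q v wterm (2 * qHw q ^+ 2 / qH q *
  ((qHw q * qH v / qH q - 2 * qHw v) ^+ 2 + 2 * qHw v ^+ 2)).
Proof.
rewrite /wterm.
have dw x : is_derive x v (@qHw R) (qHw v) by exact: is_derive_linear scalar_qHw.
exists (fun x => 4 * qHw x ^+ 3 * qHw v / qH x - qHw x ^+ 4 * qH v / qH x ^+ 2).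
  move=> x Dx; have h0 := admissible_qH Dx; have dwx := dw x; have dhx := dh x.
  by notypeclasses refine (is_derive_eq _ _); [der|cbv beta; field].
have h0 := admissible_qH Dq; have dwq := dw q; have dhq := dh q.
have h2 : qH q ^+ 2 != 0 by rewrite expf_neq0.
by notypeclasses refine (is_derive_eq _ _); [der|cbv beta; field].
Qed.

Let a i j := 'D_v (fun x => geomean x i j).
Let e i j := 'D_v (a i j) q.
Let k i j := a i j q - qH v / qH q * geomean q i j.

Let dc x i j : D x -> is_derive x v (fun x => geomean x i j) (a i j x).
Proof. by move=> Dx; exact: is_derive_smooth (smooth_geomean i j). Qed.

Let da i j : is_derive q v (a i j) (e i j).
Proof.
have s := smooth_derive oD v (smooth_geomean i j); exact (is_derive_smooth v Dq s).
Qed.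

Let dX x i j : is_derive x v (fun x => qHW x i j) (qHW v i j).
Proof. exact: is_derive_linear (scalar_qHW i j). Qed.

Let dP x i j : is_derive x v (fun x => qHF x i j) (qHF v i j).
Proof. exact: is_derive_linear (scalar_qHF i j). Qed.

(** Entrywise first and second derivatives of [C C = H X]. The first triple forces [C' = 0] once the
    variations of [H] and [X] vanish; the second is the equation behind the concavity of [C]. *)
Lemma geomean_lyapunov :
  [/\ geomean q 0 0 * k 0 0 + geomean q 0 1 * k 0 1
      = (qH q * qHW v 0 0 - qH v * qHW q 0 0) / 2,
      geomean q 0 1 * (k 0 0 + k 1 1) + k 0 1 * (geomean q 0 0 + geomean q 1 1)
      = qH q * qHW v 0 1 - qH v * qHW q 0 1
    & geomean q 0 1 * k 0 1 + geomean q 1 1 * k 1 1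
      = (qH q * qHW v 1 1 - qH v * qHW q 1 1) / 2]
  /\ [/\ geomean q 0 0 * e 0 0 + geomean q 0 1 * e 0 1
      = - (k 0 0 ^+ 2 + k 0 1 ^+ 2),
      geomean q 0 1 * (e 0 0 + e 1 1) + e 0 1 * (geomean q 0 0 + geomean q 1 1)
      = 2 * - (k 0 1 * (k 0 0 + k 1 1))
    & geomean q 0 1 * e 0 1 + geomean q 1 1 * e 1 1
      = - (k 0 1 ^+ 2 + k 1 1 ^+ 2)].
Proof.
have h0 := admissible_qH Dq; have [r0 r1 r2] := geomean_rel Dq.
have dhX i j : (forall x, D x -> is_derive x v (fun x => qH x * qHW x i j)
     (qH x * qHW v i j + qHW x i j * qH v))
   /\ is_derive q v (fun x => qH x * qHW v i j + qHW x i j * qH v)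
       (2 * (qH v * qHW v i j)).
  split=> [x Dx|]; have dhx := dh; have dXx x' := dX x' i j.
    by have dhx' := dh x; have dX' := dX x i j; der.
  have dhx' := dh q; have dX' := dX q i j.
  by notypeclasses refine (is_derive_eq _ _); [der|cbv beta; ring].
have [a00 a01] := (da 0 0, da 0 1); have a11 := da 1 1.
have [c00 c01] := (dc 0 0 Dq, dc 0 1 Dq); have c11 := dc 1 1 Dq.
have sq i j : (forall x, D x ->
     is_derive x v (fun x => geomean x i j ^+ 2) (2 * geomean x i j * a i j x))
   /\ is_derive q v (fun x => 2 * geomean x i j * a i j x)
       (2 * (a i j q ^+ 2 + geomean q i j * e i j)).
  split=> [x Dx|].
    have c := dc i j Dx.
    by notypeclasses refine (is_derive_eq _ _); [der|cbv beta; ring].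
  have c := dc i j Dq; have a' := da i j.
  by notypeclasses refine (is_derive_eq _ _); [der|cbv beta; ring].
have add2 (f f' f1 f1' : 'rV[R]_11 -> R) f2 f12 :
    (forall x, D x -> is_derive x v f (f' x)) /\ is_derive q v f' f2 ->
    (forall x, D x -> is_derive x v f1 (f1' x)) /\ is_derive q v f1' f12 ->
    (forall x, D x -> is_derive x v (fun x => f x + f1 x) (f' x + f1' x))
    /\ is_derive q v (fun x => f' x + f1' x) (f2 + f12).
  move=> [d1 d2] [d3 d4]; split=> [x Dx|]; last exact: is_derive_add.
  by apply: is_derive_add; [exact: d1|exact: d3].
have [s1 s2] := add2 _ _ _ _ _ _ (sq 0 0) (sq 0 1).
have [t1 t2] := add2 _ _ _ _ _ _ (sq 0 1) (sq 1 1).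
have m1 x : D x -> is_derive x v
    (fun x => geomean x 0 1 * (geomean x 0 0 + geomean x 1 1))
    (geomean x 0 1 * (a 0 0 x + a 1 1 x)
     + (geomean x 0 0 + geomean x 1 1) * a 0 1 x).
  by move=> Dx; have c0 := dc 0 0 Dx; have c1 := dc 0 1 Dx; have c2 := dc 1 1 Dx; der.
have m2 : is_derive q v (fun x => geomean x 0 1 * (a 0 0 x + a 1 1 x)
     + (geomean x 0 0 + geomean x 1 1) * a 0 1 x)
    (geomean q 0 1 * (e 0 0 + e 1 1) + e 0 1 * (geomean q 0 0 + geomean q 1 1)
     + 2 * (a 0 1 q * (a 0 0 q + a 1 1 q))).
  notypeclasses refine (is_derive_eq _ _); [der|cbv beta].
  move: (a 0 0 q) (a 0 1 q) (a 1 1 q) (e 0 0) (e 0 1) (e 1 1) => *; ring.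
have g0 x Dx := let: And3 r _ _ := @geomean_rel x Dx in r.
have g1 x Dx := let: And3 _ r _ := @geomean_rel x Dx in r.
have g2 x Dx := let: And3 _ _ r := @geomean_rel x Dx in r.
have [u0 w0] := derive2_eq oD Dq g0 s1 s2 (dhX 0 0).1 (dhX 0 0).2.
have [u1 w1] := derive2_eq oD Dq g1 m1 m2 (dhX 0 1).1 (dhX 0 1).2.
have [u2 w2] := derive2_eq oD Dq g2 t1 t2 (dhX 1 1).1 (dhX 1 1).2.
move: h0 r0 r1 r2 u0 u1 u2 w0 w1 w2; rewrite /k.
move: (a 0 0 q) (a 0 1 q) (a 1 1 q) (e 0 0) (e 0 1) (e 1 1).
move: (geomean q 0 0) (geomean q 0 1) (geomean q 1 1) (qH q) (qH v).
move: (qHW q 0 0) (qHW q 0 1) (qHW q 1 1) (qHW v 0 0) (qHW v 0 1) (qHW v 1 1).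
exact: lyapunov_pair.
Qed.

Let N x i := qHF x i 0 ^+ 2 * geomean x 1 1
  - 2 * qHF x i 0 * qHF x i 1 * geomean x 0 1 + qHF x i 1 ^+ 2 * geomean x 0 0.

Let dN x i := 2 * qHF x i 0 * qHF v i 0 * geomean x 1 1
  + qHF x i 0 ^+ 2 * a 1 1 x
  - 2 * (qHF v i 0 * qHF x i 1 + qHF x i 0 * qHF v i 1) * geomean x 0 1
  - 2 * qHF x i 0 * qHF x i 1 * a 0 1 x
  + 2 * qHF x i 1 * qHF v i 1 * geomean x 0 0 + qHF x i 1 ^+ 2 * a 0 0 x.

Let dd x := a 0 0 x * geomean x 1 1 + geomean x 0 0 * a 1 1 x
  - 2 * geomean x 0 1 * a 0 1 x.

(** Only what the positivity argument uses is exposed: [z] solves [C z = p], [r = p' - C' z], and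
    [y] merely occurs inside squares. *)
Lemma has_derive2_fractional i : exists z0 z1 r0 r1 y0 y1,
  [/\ geomean q 0 0 * z0 + geomean q 0 1 * z1 = qHF q i 0,
      geomean q 0 1 * z0 + geomean q 1 1 * z1 = qHF q i 1,
      r0 = qHF v i 0 - (a 0 0 q * z0 + a 0 1 q * z1),
      r1 = qHF v i 1 - (a 0 1 q * z0 + a 1 1 q * z1) &
  has_derive2 q v (fractional i)
   (2 * ((r0 ^+ 2 * geomean q 1 1 - 2 * r0 * r1 * geomean q 0 1
          + r1 ^+ 2 * geomean q 0 0) / geodet q)
    + (geodet q * ((k 0 0 * z0 + k 0 1 * z1) ^+ 2 + (k 0 1 * z0 + k 1 1 * z1) ^+ 2)
       + ((k 0 0 * y0 + k 0 1 * y1) ^+ 2 + (k 0 1 * y0 + k 1 1 * y1) ^+ 2))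
      / ((geomean q 0 0 + geomean q 1 1) * geodet q))].
Proof.
have d0 := geodet_gt0 Dq; have [_ c00 _] := (spd2P _).1 (geomean_spd Dq).
have [_ [E0 E1 E2]] := geomean_lyapunov.
have nd : geodet q != 0 by rewrite gt_eqF.
have e2 := matrix_fractional_derive2 (a 0 0 q) (a 0 1 q) (a 1 1 q)
  (qHF q i 0) (qHF q i 1) (qHF v i 0) (qHF v i 1) c00 d0 E0 E1 E2.
cbv zeta in e2.
pose z0 := (geomean q 1 1 * qHF q i 0 - geomean q 0 1 * qHF q i 1) / geodet q.
pose z1 := (geomean q 0 0 * qHF q i 1 - geomean q 0 1 * qHF q i 0) / geodet q.
pose r0 := qHF v i 0 - (a 0 0 q * z0 + a 0 1 q * z1).
pose r1 := qHF v i 1 - (a 0 1 q * z0 + a 1 1 q * z1).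
pose y0 := geomean q 1 1 * z0 - geomean q 0 1 * z1.
pose y1 := geomean q 0 0 * z1 - geomean q 0 1 * z0.
exists z0, z1, r0, r1, y0, y1; split=> //.
- by rewrite /z0 /z1; move: nd; rewrite /geodet => nd; field.
- by rewrite /z0 /z1; move: nd; rewrite /geodet => nd; field.
(* Trades the sum of squares for the raw quotient-rule expression, which differentiation produces
   directly. *)
apply: (eq_ind _ (has_derive2 q v (fractional i)) _ _ e2).
exists (fun x => dN x i / geodet x - N x i * dd x / geodet x ^+ 2).
  move=> x Dx; have ndx : geodet x != 0 by rewrite gt_eqF ?geodet_gt0.
  have [c0 c1] := (dc 0 0 Dx, dc 0 1 Dx); have c2 := dc 1 1 Dx.
  have [p0 p1] := (dP x i 0, dP x i 1); rewrite /fractional.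
  move: ndx; rewrite /geodet /dN /N /dd => ndx.
  notypeclasses refine (is_derive_eq _ _); [der|cbv beta].
  move: ndx; clear c0 c1 c2 p0 p1.
  move: (a 0 0 x) (a 0 1 x) (a 1 1 x) (geomean x 0 0) (geomean x 0 1) (geomean x 1 1).
  by move: (qHF x i 0) (qHF x i 1) (qHF v i 0) (qHF v i 1) => *; field.
have [c0 c1] := (dc 0 0 Dq, dc 0 1 Dq); have c2 := dc 1 1 Dq.
have [a0 a1] := (da 0 0, da 0 1); have a2 := da 1 1.
have [p0 p1] := (dP q i 0, dP q i 1).
have nd2 : geodet q ^+ 2 != 0 by rewrite expf_neq0.
move: nd nd2; rewrite /geodet /dN /N /dd => nd nd2.
notypeclasses refine (is_derive_eq _ _); [der|cbv beta].
clear e2; move: nd {nd2}; clear c0 c1 c2 p0 p1 a0 a1 a2 E0 E1 E2 d0 c00.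
clear z0 z1 r0 r1 y0 y1.
move: (a 0 0 q) (a 0 1 q) (a 1 1 q) (e 0 0) (e 0 1) (e 1 1).
move: (geomean q 0 0) (geomean q 0 1) (geomean q 1 1).
by move: (qHF q i 0) (qHF q i 1) (qHF v i 0) (qHF v i 1) => *; field.
Qed.

End AlongDirection.

End EnergyHessian.

(** * Strict convexity, symmetrization and the entropy source *)

Section EnergyConvex.
Context {R : realType} (P : physics R).
Hypotheses (g_gt0 : 0 < grav P) (G_gt0 : 0 < elas P).
Implicit Types (q v : 'rV[R]_11).
Let D := @admissible R.
Let oD : open D := open_admissible.

Let sum_eq0 (A0 A1 H B0 B1 B2 W Q0 Q1 G : R) : 0 < G ->
  0 <= A0 -> 0 <= A1 -> 0 <= H -> 0 <= B0 -> 0 <= B1 -> 0 <= B2 ->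
  0 <= W -> 0 <= Q0 -> 0 <= Q1 ->
  A0 + A1 + H + (B0 + 2 * B1 + B2) + G / 2 * (W + (Q0 + Q1)) <= 0 ->
  [/\ A0 = 0, A1 = 0 & H = 0] /\ [/\ B0 = 0, B1 = 0 & B2 = 0]
  /\ [/\ W = 0, Q0 = 0 & Q1 = 0].
Proof.
move=> G0 a0 a1 h b0 b1 b2 w q0 q1 e.
have s : 0 <= W + (Q0 + Q1) by rewrite !addr_ge0.
have gs : 0 <= G / 2 * (W + (Q0 + Q1)) by rewrite mulr_ge0 // divr_ge0 // ltW.
have gs0 : G / 2 * (W + (Q0 + Q1)) = 0 by lra.
have s0 : W + (Q0 + Q1) = 0.
  move/eqP: gs0; rewrite mulf_eq0 => /orP[|/eqP //].
  by rewrite gt_eqF // divr_gt0.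
by split; [split; lra|split; split; lra].
Qed.

Let sqr_div_eq0 (x h : R) : h != 0 -> x ^+ 2 / h = 0 -> x = 0.
Proof.
move=> h0 /eqP; rewrite mulf_eq0 invr_eq0 (negPf h0) orbF sqrf_eq0.
by move/eqP.
Qed.

(** All terms are nonnegative, so a nonpositive sum makes each vanish. The [g] term gives [H' = 0];
    then the squares give [U] and [X], and [w^4 / H] gives [w]. Now the Lyapunov equation for [K] is
    homogeneous, so [C' = 0], hence [r = p'] and the fractional terms give [P' = 0]: the direction
    is zero. *)
Lemma energy_derive2_gt0 q v : D q -> v != 0 -> 0 < 'D_v ('D_v (energy P)) q.
Proof.
move=> Dq v0; have h0 := admissible_qH Dq; have [hp _ _] := Dq.
have [_ _ wp] := (admissibleP q).1 Dq.
have dp := geodet_gt0 Dq; have [_ c00 _] := (spd2P _).1 (geomean_spd Dq).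
have c11 := spd2_11 (geomean_spd Dq).
have [z0 [z1 [r0 [r1 [y0 [y1 [_ _ r0E r1E F0]]]]]]] := has_derive2_fractional v Dq 0.
have [t0 [t1 [s0 [s1 [x0 [x1 [_ _ s0E s1E F1]]]]]]] := has_derive2_fractional v Dq 1.
have sqr l sl := @has_derive2_sqratio R q v Dq l sl.
have U0 := sqr _ (scalar_qHU 0); have U1 := sqr _ (scalar_qHU 1).
have X00 := sqr _ (scalar_qHW 0 0); have X11 := sqr _ (scalar_qHW 1 1).
have X01 := has_derive2_scale 2 (sqr _ (scalar_qHW 0 1)).
have H2 := has_derive2_scale (grav P) (has_derive2_Hterm q v).
have W2 := has_derive2_wterm v Dq.
have E := has_derive2E Dq (@energy_conservative R P)
  (has_derive2_add (has_derive2_add (has_derive2_add (has_derive2_add U0 U1) H2)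
     (has_derive2_add (has_derive2_add X00 X01) X11))
   (has_derive2_scale (elas P / 2) (has_derive2_add W2 (has_derive2_add F0 F1)))).
apply: (eq_ind_r (fun z => 0 < z) _ E).
rewrite ltNge; apply: contraNN v0 => T0.
have sq_ge0 (x : R) : 0 <= x ^+ 2 / qH q by rewrite divr_ge0 ?sqr_ge0 // ltW.
have frac1_ge0 (a b : R) : 0 <= 2 * ((a ^+ 2 * geomean q 1 1
    - 2 * a * b * geomean q 0 1 + b ^+ 2 * geomean q 0 0) / geodet q).
  by rewrite mulr_ge0 // divr_ge0 ?quadform_ge0 // ltW.
have frac2_ge0 (a b c d : R) : 0 <= (geodet q * (a ^+ 2 + b ^+ 2) + (c ^+ 2 + d ^+ 2))
    / ((geomean q 0 0 + geomean q 1 1) * geodet q).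
  apply: divr_ge0; last by apply: mulr_ge0; apply: ltW => //; exact: addr_gt0.
  apply: addr_ge0; last by apply: addr_ge0; exact: sqr_ge0.
  by apply: mulr_ge0; [exact: ltW|apply: addr_ge0; exact: sqr_ge0].
have [[A0 A1 H0] [[B0 B1 B2] [W0 Q0 Q1]]] := sum_eq0 G_gt0 (sq_ge0 _) (sq_ge0 _)
  (mulr_ge0 (ltW g_gt0) (sqr_ge0 _)) (sq_ge0 _) (sq_ge0 _) (sq_ge0 _)
  (mulr_ge0 (divr_ge0 (mulr_ge0 (ler0n _ 2) (sqr_ge0 (qHw q))) (ltW hp))
     (addr_ge0 (sqr_ge0 _) (mulr_ge0 (ler0n _ 2) (sqr_ge0 _))))
  (addr_ge0 (frac1_ge0 _ _) (frac2_ge0 _ _ _ _))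
  (addr_ge0 (frac1_ge0 _ _) (frac2_ge0 _ _ _ _)) T0.
have hv : qH v = 0.
  by move/eqP: H0; rewrite mulf_eq0 gt_eqF //= sqrf_eq0 => /eqP.
have lz (x y : R) : (x - y * qH v / qH q) ^+ 2 / qH q = 0 -> x = 0.
  by move=> /(sqr_div_eq0 h0); rewrite hv mulr0 mul0r subr0.
have Xv : qHW v = 0.
  apply: matrix2P; rewrite [RHS]mxE ?qHW_sym;
    [exact: lz B0|exact: lz B1|exact: lz B1|exact: lz B2].
have wv : qHw v = 0.
  move/eqP: W0; rewrite mulf_eq0 mulf_eq0 invr_eq0 (negPf h0) orbF.
  rewrite mulf_eq0 pnatr_eq0 sqrf_eq0 (gt_eqF wp) /= hv mulr0 mul0r sub0r.
  have n2 : 0 <= 2 * qHw v ^+ 2 := mulr_ge0 (ler0n R 2) (sqr_ge0 _).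
  rewrite paddr_eq0 ?sqr_ge0 // => /andP[_].
  by rewrite mulf_eq0 pnatr_eq0 sqrf_eq0 => /eqP.
have [[K0 K1 K2] _] := geomean_lyapunov v Dq.
have Xv' i j : qHW v i j = 0 by rewrite Xv mxE.
have k1 i j : qH q * qHW v i j - qH v * qHW q i j = 0.
  by rewrite Xv' hv mulr0 mul0r subrr.
have k0 i j : (qH q * qHW v i j - qH v * qHW q i j) / 2 = 0.
  by rewrite k1 mul0r.
have [a0 a1 a2] := lyapunov_inj c00 dp (etrans K0 (k0 0 0)) (etrans K1 (k1 0 1))
  (etrans K2 (k0 1 1)).
have kz (x y : R) : x - qH v / qH q * y = 0 -> x = 0.
  by rewrite hv mul0r mul0r subr0.
have {}a0 := kz _ _ a0; have {}a1 := kz _ _ a1; have {}a2 := kz _ _ a2.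
have fr (a b : R) X Y : 0 <= X -> 2 * ((a ^+ 2 * geomean q 1 1
    - 2 * a * b * geomean q 0 1 + b ^+ 2 * geomean q 0 0) / geodet q) + X = 0 ->
    Y = true -> a = 0 /\ b = 0.
  move=> X0 /eqP; rewrite paddr_eq0 // mulf_eq0 pnatr_eq0 /= => /andP[e _] _.
  apply: (quadform_eq0 c00 dp); apply/eqP; move: e.
  by rewrite mulf_eq0 invr_eq0 (gt_eqF dp) orbF.
have [r00 r10] := fr _ _ _ _ (frac2_ge0 _ _ _ _) Q0 (erefl true).
have [s00 s10] := fr _ _ _ _ (frac2_ge0 _ _ _ _) Q1 (erefl true).
rewrite r00 a0 a1 !mul0r addr0 subr0 in r0E.
rewrite r10 a1 a2 !mul0r addr0 subr0 in r1E.
rewrite s00 a0 a1 !mul0r addr0 subr0 in s0E.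
rewrite s10 a1 a2 !mul0r addr0 subr0 in s1E.
have z (l : 'rV[R]_11 -> R) : scalar l -> l 0 = 0.
  by move=> sl; have := sl (-1) 0 0; rewrite scaler0 addr0 mulN1r addNr.
apply/eqP/state_eq; first by rewrite hv z //; exact: scalar_qH.
- apply/rowP; apply: ord2P; rewrite (z _ (scalar_qHU _)).
    exact: lz A0.
  exact: lz A1.
- by apply: matrix2P; rewrite (z _ (scalar_qHF _ _)).
- by apply/matrixP => i j; rewrite Xv (z _ (scalar_qHW _ _)) mxE.
- by rewrite wv z //; exact: scalar_qHw.
Qed.

Lemma energy_strictly_convex : strictly_convex_on D (energy P).
Proof.
apply: (strictly_convex_derive2 oD (smooth_energy P)) => [x y s Dx Dy s01|x v Dx v0].
  exact: convex_admissible.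
exact: energy_derive2_gt0.
Qed.

Lemma energy_hessian_spd q : D q -> spd (hessian (energy P) q).
Proof.
move=> Dq; split; first exact (hessian_sym oD (smooth_energy P) Dq).
move=> v v0; rewrite (dot_hessian oD v (smooth_energy P) Dq).
exact: energy_derive2_gt0.
Qed.

Section Systems.
Context (rY : 'rV[R]_11 -> 'M[R]_2).
Let S := Y_system P rY.

Lemma smooth_Y_flux j : smooth_on D (flux S j).
Proof. exact: smooth_flux_with smooth_stressA smooth_stressAcc. Qed.

Lemma Y_compat j q v : D q -> 'D_('D_v (flux S j) q) (energy P) q
  = 'D_v (energy_flux P j) q
    + \sum_(al < 2) piola_factor P al q * qHF v j al.
Proof. by move=> Dq; exact: flux_compat. Qed.

Lemma Y_hessian_symmetrizes : hessian_symmetrizes S piola D (energy P).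
Proof.
apply: (compat_hessian_symmetrizes oD (smooth_energy P) (smooth_energy_flux P)
  smooth_Y_flux (smooth_piola_factor P) Y_compat energy_hessian_spd).
by move=> p pp al; exact: pp.
Qed.

(* The factor -1 / H undoes the normalization - H Dt of the energy source. *)
Definition dissipation q : R :=
  - (qH q)^-1 * 'D_(pack 0 0 0 (qH q *: rY q)
      (qH q * ((qH q ^- 2 * scaw q ^- 3 - scaw q) / (4 * rlx P)))) (energy P) q.

(** Only the kinetic energy varies; that [A] does not is the transport lemma with factor 0. *)
Lemma derive_energy_momentum q (m : 'rV[R]_2) : D q ->
  'D_(pack 0 m 0 0 0) (energy P) q = dot (vel q) m.
Proof.
move=> Dq; have h0 := admissible_qH Dq.
have [_ e] := is_derive_energy P Dq (pack 0 m 0 0 0); apply: (etrans e).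
have z : symvec 0 = 0 :> 'rV[R]_3 by apply/rowP => i; rewrite !mxE.
have vz : vecsym 0 = 0 :> 'M[R]_2 by apply/matrixP => i j; rewrite !mxE.
have dY i j : dtenW q (pack 0 m 0 0 0) i j = 0.
  by rewrite /dtenW qHW_pack qH_pack z vz mxE mulr0 subr0 mul0r.
have dY0 : dmx tenW (pack 0 m 0 0 0) q = 0 *: dmx tenW 0 q.
  rewrite scale0r; apply/matrixP => i j; rewrite mxE [RHS]mxE.
  have [_ eY] := is_derive_tenW (pack 0 m 0 0 0) Dq i j.
  exact: (etrans eY (dY i j)).
have dA : dstressA q (pack 0 m 0 0 0) = 0.
  by rewrite /dstressA (stressA_transport Dq dY0) scale0r.
have dF i j : ddefF q (pack 0 m 0 0 0) i j = 0.
  by rewrite /ddefF qHF_pack qH_pack mxE mulr0 subr0 mul0r.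
have dy : dscaw q (pack 0 m 0 0 0) = 0.
  by rewrite /dscaw qHw_pack qH_pack mulr0 subr0 mul0r.
have dU i : dvel q (pack 0 m 0 0 0) i = m 0 i / qH q.
  by rewrite /dvel qHU_pack qH_pack mulr0 subr0.
rewrite /denergy qH_pack !dY !dF dA dy !dU !mxE /dot mulmx2E !mxE.
by field.
Qed.

(** The source splits into a momentum part, giving friction and topography, and a relaxation part,
    which is the dissipation by definition. *)
Lemma derive_energy_source q x : D q -> 'D_(source S x q) (energy P) q
  = energy_source P dissipation x q.
Proof.
move=> Dq; have h0 := admissible_qH Dq.
have de := smooth_differentiable (smooth_energy P) Dq.
pose m := - (grav P * qH q) *: grad (zb P) x - (fric P * qH q) *: vel q.
pose s := pack 0 0 0 (qH q *: rY q)
  (qH q * ((qH q ^- 2 * scaw q ^- 3 - scaw q) / (4 * rlx P))).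
have lin (l : 'rV[R]_11 -> R) : scalar l -> l (pack 0 m 0 0 0 + s)
    = l (pack 0 m 0 0 0) + l s.
  by move=> sl; have := sl 1 (pack 0 m 0 0 0) s; rewrite scale1r mul1r.
have z : symvec 0 = 0 :> 'rV[R]_3 by apply/rowP => i; rewrite !mxE.
have vz : vecsym 0 = 0 :> 'M[R]_2 by apply/matrixP => i j; rewrite !mxE.
have sE : source S x q = pack 0 m 0 0 0 + s.
  apply: state_eq.
  - by rewrite (lin _ scalar_qH) !qH_pack addr0.
  - by apply/rowP => i; rewrite (lin _ (scalar_qHU i)) !qHU_pack [X in _ = _ + X]mxE addr0.
  - apply/matrixP => i j; rewrite (lin _ (scalar_qHF i j)) !qHF_pack.
    by rewrite [X in _ = _ + X]mxE addr0.
  - apply/matrixP => i j; rewrite (lin _ (scalar_qHW i j)) !qHW_pack z vz.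
    by rewrite [X in _ = X + _]mxE add0r.
  - by rewrite (lin _ scalar_qHw) !qHw_pack add0r.
rewrite sE derive_dirD // derive_energy_momentum // /energy_source /dissipation.
rewrite mulrA mulrN mulfV // mulN1r opprK -/s; congr (_ + _).
rewrite /m /dot !mulmx2E !mxE; ring.
Qed.

End Systems.

End EnergyConvex.

(** * Motions and the Piola identity *)

Section PiolaIdentity.
Context {R : realType}.

Lemma with_space_differentiable (phi : 'rV[R]_3 -> 'rV[R]_2) w :
  differentiable phi w -> differentiable (fun w => with_space w (phi w)) w.
Proof.
move=> dphi; apply: differentiable_row => k.
case: (unliftP ord0 k) => [j|] ->.
  have -> : (fun x => with_space x (phi x) 0 (lift ord0 j))
      = (fun x => phi x 0 j).
    by apply/funext => x; rewrite mxE liftK.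
  exact: (differentiable_comp dphi (differentiable_coord (phi w) 0 j)).
have -> : (fun x => with_space x (phi x) 0 ord0) = (fun x => x 0 ord0).
  by apply/funext => x; rewrite mxE unlift_none.
exact: differentiable_coord.
Qed.

Lemma dx_with_space (phi : 'rV[R]_3 -> 'rV[R]_2) w be :
  differentiable phi w -> dx be (fun w => with_space w (phi w)) w
  = \sum_(j < 2) dx be phi w 0 j *: unitv (lift ord0 j).
Proof.
move=> dphi; have dw := with_space_differentiable dphi.
apply/rowP => k; rewrite /dx -(derive_coord _ _ dw) summxE.
have sc : scalar (fun v : 'rV[R]_3 => v 0 ord0) by move=> a u v; rewrite !mxE.
case: (unliftP ord0 k) => [j|] ->.
  have -> : (fun x => with_space x (phi x) 0 (lift ord0 j))
      = (fun x => phi x 0 j).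
    by apply/funext => x; rewrite mxE liftK.
  rewrite (derive_coord _ _ dphi) (bigD1 j) //= [X in _ = X + _]mxE mxE !eqxx mulr1.
  rewrite big1 ?addr0 // => i ij; rewrite mxE [X in _ * X]mxE eqxx /=.
  by rewrite (inj_eq lift_inj) eq_sym (negPf ij) mulr0.
have -> : (fun x => with_space x (phi x) 0 ord0) = (fun x => x 0 ord0).
  by apply/funext => x; rewrite mxE unlift_none.
rewrite (derive_scalar _ _ sc) mxE /= big1 // => i _.
by rewrite mxE [X in _ * X]mxE mulr0.
Qed.

(** Here [d0] and [d1] are the space derivatives of [F]. Multiplied by [det F], the divergence of
    [H F_al] is the derivative of [H det F] along [F_al] plus multiples of the commutation defects
    of the two columns. *)
Let piola_algebra (h f00 f01 f10 f11 dh0 dh1 : R) (d0 d1 : 'I_2 -> 'I_2 -> R) :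
  f00 * f11 - f01 * f10 != 0 ->
  (forall i, f01 * d0 i 0 + f11 * d1 i 0 = f00 * d0 i 1 + f10 * d1 i 1) ->
  h * (f00 * d0 1 1 + f11 * d0 0 0 - (f01 * d0 1 0 + f10 * d0 0 1))
    + (f00 * f11 - f01 * f10) * dh0 = 0 ->
  h * (f00 * d1 1 1 + f11 * d1 0 0 - (f01 * d1 1 0 + f10 * d1 0 1))
    + (f00 * f11 - f01 * f10) * dh1 = 0 ->
  (h * d0 0 0 + f00 * dh0) + (h * d1 1 0 + f10 * dh1) = 0 /\
  (h * d0 0 1 + f01 * dh0) + (h * d1 1 1 + f11 * dh1) = 0.
Proof.
move=> J0 sym e0 e1; have s0 := sym 0; have s1 := sym 1.
split; apply: (mulfI J0); rewrite mulr0.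
  rewrite [LHS](_ : _ =
    f00 * (h * (f00 * d0 1 1 + f11 * d0 0 0 - (f01 * d0 1 0 + f10 * d0 0 1))
       + (f00 * f11 - f01 * f10) * dh0)
    + f10 * (h * (f00 * d1 1 1 + f11 * d1 0 0 - (f01 * d1 1 0 + f10 * d1 0 1))
       + (f00 * f11 - f01 * f10) * dh1)
    + h * f00 * ((f01 * d0 1 0 + f11 * d1 1 0) - (f00 * d0 1 1 + f10 * d1 1 1))
    - h * f10 * ((f01 * d0 0 0 + f11 * d1 0 0) - (f00 * d0 0 1 + f10 * d1 0 1)));
    last by ring.
  by rewrite e0 e1 s0 s1 !subrr !mulr0 !addr0 subr0.
rewrite [LHS](_ : _ =
    f01 * (h * (f00 * d0 1 1 + f11 * d0 0 0 - (f01 * d0 1 0 + f10 * d0 0 1))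
       + (f00 * f11 - f01 * f10) * dh0)
    + f11 * (h * (f00 * d1 1 1 + f11 * d1 0 0 - (f01 * d1 1 0 + f10 * d1 0 1))
       + (f00 * f11 - f01 * f10) * dh1)
    + h * f01 * ((f01 * d0 1 0 + f11 * d1 1 0) - (f00 * d0 1 1 + f10 * d1 1 1))
    - h * f11 * ((f01 * d0 0 0 + f11 * d1 0 0) - (f00 * d0 0 1 + f10 * d1 0 1)));
    last by ring.
by rewrite e0 e1 s0 s1 !subrr !mulr0 !addr0 subr0.
Qed.

Context (P : physics R) (Hhat_gt0 : 0 < Hhat P) (S : @balance_law R 11).
Context (Om : set 'rV[R]_3) (q : 'rV[R]_3 -> 'rV[R]_11) (oOm : open Om).
Hypothesis sol : motion_solution P S Om q.

Let sq : smooth_on Om q. Proof. by case: sol => -[]. Qed.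
Let Dq p : Om p -> admissible (q p). Proof. by case: sol => -[_ + _ _] _; apply. Qed.

Let sF i al : smooth_on Om (fun x => defF (q x) i al).
Proof.
exact: (smooth_comp oOm (f := fun x => defF x i al) Dq sq (smooth_defF i al)).
Qed.

Let sh : smooth_on Om (fun x => qH (q x)).
Proof. exact: (smooth_comp oOm (f := @qH R) Dq sq (@smooth_qH R)). Qed.

(** Both sides are the mixed second material derivative of [phi^i]: by the chain rule a material
    derivative of index [be] is [F^j_be] times the space derivative of index [j], and Schwarz
    applies to [phi]. *)
Let material_sym p i : Om p ->
  defF (q p) 0 1 * dx 0 (fun x => defF (q x) i 0) p
  + defF (q p) 1 1 * dx 1 (fun x => defF (q x) i 0) p
  = defF (q p) 0 0 * dx 0 (fun x => defF (q x) i 1) p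
  + defF (q p) 1 0 * dx 1 (fun x => defF (q x) i 1) p.
Proof.
move=> Omp; have [_ dg] := sol; have [W [phi [oW sphi [w Ww wp] Wphi]]] := dg p Omp.
have dphi x : W x -> differentiable phi x := smooth_differentiable sphi.
pose phii := fun x => phi x 0 i.
have sphii : smooth_on W phii := smooth_coord oW i sphi.
have mat al be : dx be ('D_(unitv (lift ord0 al)) phii) w
    = defF (q p) 0 be * dx 0 (fun x => defF (q x) i al) p
      + defF (q p) 1 be * dx 1 (fun x => defF (q x) i al) p.
  have eqn x : W x -> ((fun y => defF (q y) i al) \o (fun x => with_space x (phi x))) x
      = 'D_(unitv (lift ord0 al)) phii x.
    move=> Wx; have [_ _ dF] := Wphi x Wx; rewrite /= -dF /dx.
    by rewrite -(derive_coord _ _ (dphi x Wx)).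
  have dFp : differentiable (fun y => defF (q y) i al) (with_space w (phi w)).
    by rewrite wp; exact: smooth_differentiable (sF i al) Omp.
  rewrite /dx -(derive_ext oW _ eqn Ww).
  rewrite (derive_chain _ (with_space_differentiable (dphi w Ww)) dFp).
  have := dx_with_space be (dphi w Ww); rewrite /dx => ->.
  rewrite (derive_dir_sum _ _ dFp) sum2E (derive_dirZ _ _ dFp) (derive_dirZ _ _ dFp).
  have [_ _ dF] := Wphi w Ww; rewrite /dx in dF; rewrite !dF.
  by rewrite wp.
rewrite -!mat /dx; exact (smooth_derive_comm oW _ _ sphii Ww).
Qed.

Lemma motion_piola p : Om p -> piola (fun j => dx j q p).
Proof.
move=> Omp; have [[_ _ det _] _] := sol.
have dq := smooth_differentiable sq Omp.
have dF i al := smooth_differentiable (sF i al) Omp.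
have dh := smooth_differentiable sh Omp.
have h0 := admissible_qH (Dq Omp).
pose d j i al := dx j (fun x => defF (q x) i al) p.
pose e j := dx j (fun x => qH (q x)) p.
(* The algebra divides by [det F], which [H det F = Hhat > 0] keeps away from 0. *)
have J0 : defF (q p) 0 0 * defF (q p) 1 1 - defF (q p) 0 1 * defF (q p) 1 0 != 0.
  have := det p Omp; rewrite det2E => E; apply: contraTneq Hhat_gt0 => J.
  by rewrite -E J mulr0 ltxx.
have bF j i al : is_derive p (unitv (lift ord0 j)) (fun x => defF (q x) i al) (d j i al).
  by split=> //; exact: diff_derivable.
have bh j : is_derive p (unitv (lift ord0 j)) (fun x => qH (q x)) (e j).
  by split=> //; exact: diff_derivable.
have HF j i al : qHF (dx j q p) i al = qH (q p) * d j i al + defF (q p) i al * e j.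
  have sl := scalar_qHF (R := R) i al.
  have b : is_derive p (unitv (lift ord0 j)) (fun x => qHF (q x) i al)
      (qHF (dx j q p) i al).
    have dl := differentiable_scalar (q p) sl.
    split; first exact/diff_derivable/(differentiable_comp dq dl).
    by rewrite (derive_chain _ dq dl) derive_scalar.
  have b' : is_derive p (unitv (lift ord0 j))
      (fun x => qH (q x) * defF (q x) i al)
      (qH (q p) * d j i al + defF (q p) i al * e j).
    by have b1 := bF j i al; have b2 := bh j; der.
  have [_ <-] := b; have [_ <-] := b'; apply: (derive_ext oOm) => // x Omx.
  have hx := admissible_qH (Dq Omx).
  by rewrite [defF _ _ _]mxE mulVKf.
have dJ j : qH (q p) * (defF (q p) 0 0 * d j 1 1 + defF (q p) 1 1 * d j 0 0
     - (defF (q p) 0 1 * d j 1 0 + defF (q p) 1 0 * d j 0 1))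
   + (defF (q p) 0 0 * defF (q p) 1 1 - defF (q p) 0 1 * defF (q p) 1 0) * e j = 0.
  have b : is_derive p (unitv (lift ord0 j)) (fun x => qH (q x) *
     (defF (q x) 0 0 * defF (q x) 1 1 - defF (q x) 0 1 * defF (q x) 1 0))
   (qH (q p) * (defF (q p) 0 0 * d j 1 1 + defF (q p) 1 1 * d j 0 0
     - (defF (q p) 0 1 * d j 1 0 + defF (q p) 1 0 * d j 0 1))
   + (defF (q p) 0 0 * defF (q p) 1 1 - defF (q p) 0 1 * defF (q p) 1 0) * e j).
    have [b00 b01] := (bF j 0 0, bF j 0 1); have [b10 b11] := (bF j 1 0, bF j 1 1).
    by have b2 := bh j; der.
  have [_ <-] := b; rewrite -(derive_cst (Hhat P) p (unitv (lift ord0 j))).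
  by apply: (derive_ext oOm) => // x Omx; rewrite -(det x Omx) det2E.
have [p0 p1] := piola_algebra (d0 := d 0) (d1 := d 1) J0
  (fun i => material_sym i Omp) (dJ 0) (dJ 1).
apply: ord2P; apply: (etrans (sum2E _)).
  exact (etrans (congr2 (fun x y => x + y) (HF 0 0 0) (HF 1 1 0)) p0).
exact (etrans (congr2 (fun x y => x + y) (HF 0 0 1) (HF 1 1 1)) p1).
Qed.

End PiolaIdentity.

(** * The energy law and symmetric hyperbolicity *)

Section EnergyLaw.
Context {R : realType} (P : physics R).
Hypotheses (g_gt0 : 0 < grav P) (G_gt0 : 0 < elas P) (Hhat_gt0 : 0 < Hhat P).
Context (rY : 'rV[R]_11 -> 'M[R]_2).
Let S := Y_system P rY.

Lemma energy_extension : strictly_convex_extension (motion_solution P S)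
  (@admissible R) (energy P) (energy_flux P) (energy_source P (dissipation P rY)).
Proof.
split; first exact: energy_strictly_convex.
- exact: smooth_energy.
- exact: smooth_energy_flux.
move=> Om q oOm sol p Omp; have [[sq Dq _ Sq] _] := sol.
rewrite (entropy_law (smooth_energy P) (smooth_energy_flux P) (smooth_Y_flux P rY)
  (Y_compat P rY) oOm sq Dq Sq Omp).
  by rewrite derive_energy_source //; exact: Dq.
by move=> al; exact: (motion_piola Hhat_gt0 oOm sol Omp al).
Qed.

Lemma Y_symmetric_hyperbolic :
  symmetric_hyperbolic (motion_solution P S) S piola (@admissible R).
Proof.
split; first exact: open_admissible.
  exact: smooth_Y_flux.
exists (energy P); split; last exact: Y_hessian_symmetrizes.
by exists (energy_flux P), (energy_source P (dissipation P rY)); exact: energy_extension.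
Qed.

End EnergyLaw.

(** * The change of variables between Y and A *)

Section ChangeOfVariables.
Context {R : realType}.
Implicit Types (q u v x a : 'rV[R]_11).
Let D := @admissible R.
Let oD : open D := open_admissible.

Definition A_to_Y a : 'rV[R]_11 := pack (qH a) (qHU a) (qHF a)
  (qH a *: invmx (tenW a *m tenW a)) (qH a * Num.sqrt (Num.sqrt (scaw a))).

Lemma tenW_pack H m (F W : 'M[R]_2) w : H != 0 -> W 1 0 = W 0 1 ->
  tenW (pack H m F (H *: W) w) = W.
Proof.
move=> H0 sW; rewrite /tenW qH_pack qHW_pack vecsym_symvec ?scalerA ?mulVf //.
  by rewrite scale1r.
by rewrite !mxE sW.
Qed.

Lemma scaw_pack H m (F W : 'M[R]_2) w : H != 0 ->
  scaw (pack H m F W (H * w)) = w.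
Proof. by move=> H0; rewrite /scaw qH_pack qHw_pack mulKf. Qed.

Lemma tenW_Y_to_A q : D q -> tenW (Y_to_A q) = stressA q.
Proof. by move=> Dq; rewrite tenW_pack ?stressA_sym //; exact: admissible_qH. Qed.

Lemma scaw_Y_to_A q : D q -> scaw (Y_to_A q) = stressAcc q.
Proof. by move=> Dq; rewrite scaw_pack //; exact: admissible_qH. Qed.

Lemma spd2_sym (A : 'M[R]_2) : spd A -> A 1 0 = A 0 1.
Proof. by case/spd2P. Qed.

Lemma tenW_A_to_Y a : D a -> tenW (A_to_Y a) = invmx (tenW a *m tenW a).
Proof.
move=> Da; have [_ sW _] := Da; rewrite tenW_pack //; first exact: admissible_qH.
exact/spd2_sym/spd2_inv/spd2_sqr.
Qed.

Lemma scaw_A_to_Y a : D a -> scaw (A_to_Y a) = Num.sqrt (Num.sqrt (scaw a)).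
Proof. by move=> Da; rewrite scaw_pack //; exact: admissible_qH. Qed.

Lemma Y_to_A_admissible q : D q -> D (Y_to_A q).
Proof.
move=> Dq; split; rewrite ?tenW_Y_to_A ?scaw_Y_to_A //.
  by rewrite qH_pack; case: Dq.
  exact: stressA_spd.
by rewrite exprn_gt0 //; case: Dq.
Qed.

Lemma A_to_Y_admissible a : D a -> D (A_to_Y a).
Proof.
move=> Da; have [h sW w] := Da; split; first by rewrite qH_pack.
  by rewrite tenW_A_to_Y //; exact/spd2_inv/spd2_sqr.
by rewrite scaw_A_to_Y // !sqrtr_gt0.
Qed.

Lemma state_eq_prim u v : qH u != 0 -> qH u = qH v -> qHU u = qHU v ->
  qHF u = qHF v -> tenW u = tenW v -> scaw u = scaw v -> u = v.
Proof.
move=> h0 eH eU eF eW ew; apply: state_eq => //.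
  by have := congr1 ( *:%R (qH u)) eW; rewrite /tenW -eH !scalerA mulfV // !scale1r.
by have := congr1 ( *%R (qH u)) ew; rewrite /scaw -eH !mulVKf.
Qed.

Lemma qH_Y_to_A q : qH (Y_to_A q) = qH q. Proof. exact: qH_pack. Qed.

Lemma qHU_Y_to_A q : qHU (Y_to_A q) = qHU q. Proof. exact: qHU_pack. Qed.

Lemma qHF_Y_to_A q : qHF (Y_to_A q) = qHF q. Proof. exact: qHF_pack. Qed.

Lemma qH_A_to_Y a : qH (A_to_Y a) = qH a. Proof. exact: qH_pack. Qed.

Lemma qHU_A_to_Y a : qHU (A_to_Y a) = qHU a. Proof. exact: qHU_pack. Qed.

Lemma qHF_A_to_Y a : qHF (A_to_Y a) = qHF a. Proof. exact: qHF_pack. Qed.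

Lemma vel_Y_to_A q : vel (Y_to_A q) = vel q.
Proof. by rewrite /vel qH_Y_to_A qHU_Y_to_A. Qed.

Lemma defF_Y_to_A q : defF (Y_to_A q) = defF q.
Proof. by rewrite /defF qH_Y_to_A qHF_Y_to_A. Qed.

Lemma Y_to_AK q : D q -> A_to_Y (Y_to_A q) = q.
Proof.
move=> Dq; have h0 := admissible_qH Dq; have DA := Y_to_A_admissible Dq.
have [_ sW w0] := Dq.
apply: state_eq_prim.
- by rewrite qH_A_to_Y qH_Y_to_A.
- by rewrite qH_A_to_Y qH_Y_to_A.
- by rewrite qHU_A_to_Y qHU_Y_to_A.
- by rewrite qHF_A_to_Y qHF_Y_to_A.
- by rewrite tenW_A_to_Y // tenW_Y_to_A // stressA_sqr // invmxK.
- rewrite scaw_A_to_Y // scaw_Y_to_A // /stressAcc (exprM _ 2 2) sqrtr_sqr.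
  by rewrite ger0_norm ?sqr_ge0 // sqrtr_sqr ger0_norm // ltW.
Qed.

Lemma A_to_YK a : D a -> Y_to_A (A_to_Y a) = a.
Proof.
move=> Da; have h0 := admissible_qH Da; have DY := A_to_Y_admissible Da.
have [_ sW w0] := Da.
apply: state_eq_prim.
- by rewrite qH_Y_to_A qH_A_to_Y.
- by rewrite qH_Y_to_A qH_A_to_Y.
- by rewrite qHU_Y_to_A qHU_A_to_Y.
- by rewrite qHF_Y_to_A qHF_A_to_Y.
- rewrite tenW_Y_to_A // /stressA tenW_A_to_Y //; apply: invsqrtmx_uniq => //.
    exact/spd2_inv/spd2_sqr.
  by rewrite invmxK.
- rewrite scaw_Y_to_A // /stressAcc scaw_A_to_Y // (exprM _ 2 2).
  by rewrite sqr_sqrtr ?sqrtr_ge0 // sqr_sqrtr // ltW.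
Qed.

Lemma smooth_Y_to_A : smooth_on D (@Y_to_A R).
Proof.
apply: (smooth_pack oD smooth_qH).
- by move=> i; exact: smooth_linear oD (scalar_qHU i).
- by move=> i j; exact: smooth_linear oD (scalar_qHF i j).
- move=> i j; refine (smooth_ext oD _ (smoothM oD smooth_qH (smooth_stressA i j))).
  by move=> x _; rewrite [RHS]mxE.
- exact (smoothM oD (@smooth_qH R) (@smooth_stressAcc R)).
Qed.

Lemma smooth_A_to_Y : smooth_on D A_to_Y.
Proof.
have sAA i j : smooth_on D (fun x => (tenW x *m tenW x) i j).
  refine (smooth_ext oD (f := fun x => tenW x i 0 * tenW x 0 j
    + tenW x i 1 * tenW x 1 j) _ _); first by move=> x _; rewrite mulmx2E.
  exact (smoothD oD (smoothM oD (smooth_tenW i 0) (smooth_tenW 0 j))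
                    (smoothM oD (smooth_tenW i 1) (smooth_tenW 1 j))).
have pAA x : D x -> spd (tenW x *m tenW x) by move=> [_ sW _]; exact: spd2_sqr.
have w0 x : D x -> 0 < scaw x by case.
have w1 x : D x -> 0 < Num.sqrt (scaw x) by move=> /w0; rewrite sqrtr_gt0.
have sw := smooth_sqrt oD w1 (smooth_sqrt oD w0 (@smooth_scaw R)).
apply: (smooth_pack oD smooth_qH).
- by move=> i; exact: smooth_linear oD (scalar_qHU i).
- by move=> i j; exact: smooth_linear oD (scalar_qHF i j).
- move=> i j; refine (smooth_ext oD _ (smoothM oD smooth_qH (smooth_mxinv pAA sAA i j))).
  by move=> x _; rewrite [RHS]mxE.
- exact (smoothM oD (@smooth_qH R) sw).
Qed.

(** Differentiating [A_to_Y \o Y_to_A = id] on the open admissible set gives a left inverse of the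
    differential. It carries the balance law back from [A] to [Y]. *)
Lemma derive_Y_to_A_inj q u v : D q ->
  'D_u (@Y_to_A R) q = 'D_v (@Y_to_A R) q -> u = v.
Proof.
move=> Dq e; have DA := Y_to_A_admissible Dq.
have d1 := smooth_differentiable smooth_Y_to_A Dq.
have d2 := smooth_differentiable smooth_A_to_Y DA.
have K w : 'D_('D_w (@Y_to_A R) q) A_to_Y (Y_to_A q) = w.
  have YAK x : D x -> (A_to_Y \o @Y_to_A R) x = id x.
    by move=> Dx; exact: Y_to_AK.
  apply: (etrans (esym (derive_chain w d1 d2))).
  exact (etrans (derive_ext oD w YAK Dq) (derive_id q w)).
exact: (etrans (esym (K u))
  (etrans (congr1 (fun w => 'D_w A_to_Y (Y_to_A q)) e) (K v))).
Qed.

(** * Conjugacy of the fluxes and of the sources *)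

Section Conjugacy.
Context (P : physics R).
Let fA j := flux (A_system P) j.
Let fY j := flux (Y_system P (Y_rate P)) j.

Let scalarD (l : 'rV[R]_11 -> R) (f : 'rV[R]_11 -> 'rV[R]_11) q v (r : R) :
  scalar l -> differentiable f q -> is_derive q v (fun x => l (f x)) r ->
  l ('D_v f q) = r.
Proof.
by move=> sl df dr; exact: is_derive_unique (derive_comp_scalar v sl df) dr.
Qed.

Let is_derive_ext (f f1 : 'rV[R]_11 -> R) q v r : D q ->
  (forall x, D x -> f1 x = f x) -> is_derive q v f1 r -> is_derive q v f r.
Proof. by move=> Dq e; apply: near_eq_is_derive; exact: open_near_eq e Dq. Qed.

Let qHW_Y_to_A q i k : D q -> qHW (Y_to_A q) i k = qH q * stressA q i k.
Proof.
move=> Dq; rewrite qHW_pack vecsym_symvec [X in X = _]mxE //.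
by rewrite [RHS]mxE stressA_sym.
Qed.

Lemma smooth_A_flux j : smooth_on D (fA j).
Proof. exact: smooth_flux_with (@smooth_tenW R) (@smooth_scaw R). Qed.

Lemma flux_conjugacy j q v : D q ->
  'D_v (fA j \o @Y_to_A R) q = 'D_('D_v (fY j) q) (@Y_to_A R) q.
Proof.
move=> Dq; have h0 := admissible_qH Dq.
have dPsi := smooth_differentiable smooth_Y_to_A Dq.
have dfA := smooth_differentiable (smooth_A_flux j) (Y_to_A_admissible Dq).
have dcomp := differentiable_comp dPsi dfA.
have dfY := smooth_differentiable (smooth_Y_flux P (Y_rate P) j) Dq.
set w := 'D_v (fY j) q.
have velE := vel_Y_to_A; have FE := defF_Y_to_A; have HE := qH_Y_to_A.
(* On [H], [HU] and [HF] the change of variables is the identity, so equality of the flux components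
   suffices; [HW] and [Hw] need the transport of [stressA] and [scaw]. *)
have common l : scalar l ->
    (forall x, D x -> l (fY j x) = l (fA j (Y_to_A x))) ->
    (forall x, l x = l (Y_to_A x)) ->
    l ('D_v (fA j \o @Y_to_A R) q) = l ('D_w (@Y_to_A R) q).
  move=> sl e1 e2.
  have c1 := scalarD sl dcomp (is_derive_ext Dq e1 (derive_comp_scalar v sl dfY)).
  have c2 := scalarD sl dPsi
    (is_derive_ext Dq (fun x _ => e2 x) (is_derive_linear q w sl)).
  exact: (etrans c1 (esym c2)).
have dA i k := is_derive_stressA v Dq i k.
have dAw i k := is_derive_stressA w Dq i k.
have dy := is_derive_scaw v Dq; have dyw := is_derive_scaw w Dq.
have dU := is_derive_vel v Dq j.
have dh u : is_derive q u (@qH R) (qH u) by exact: is_derive_linear scalar_qH.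
have dhv := dh v; have dhw := dh w.
have wE := qH_dflux P j v Dq.
apply: state_eq.
- apply: common scalar_qH _ _ => [x Dx|x]; last by rewrite HE.
  apply: (etrans (qH_flux P stressA (@stressAcc R) j x)).
  apply: (etrans _ (esym (qH_flux P (@tenW R) (@scaw R) j (Y_to_A x)))).
  by rewrite HE velE.
- apply/rowP => i; apply: common (scalar_qHU i) _ _ => [x Dx|x]; last first.
    by rewrite qHU_pack.
  apply: (etrans (qHU_flux P stressA (@stressAcc R) j x i)).
  apply: (etrans _ (esym (qHU_flux P (@tenW R) (@scaw R) j (Y_to_A x) i))).
  by rewrite HE velE FE tenW_Y_to_A // scaw_Y_to_A.
- apply/matrixP => i k; apply: common (scalar_qHF i k) _ _ => [x Dx|x]; last first.
    by rewrite qHF_pack.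
  apply: (etrans (qHF_flux P stressA (@stressAcc R) j x i k)).
  apply: (etrans _ (esym (qHF_flux P (@tenW R) (@scaw R) j (Y_to_A x) i k))).
  by rewrite HE velE FE.
- apply/matrixP => i k; have dAik := dA i k; have dAwik := dAw i k.
  pose r := qH q * vel q 0 j * dmx stressA v q i k + stressA q i k * qH w.
  transitivity r.
    apply: (scalarD (scalar_qHW i k) dcomp).
    apply: (is_derive_ext (f1 := fun x => qH x * vel x 0 j * stressA x i k) Dq).
      by move=> x Dx; rewrite /fA /= qHW_flux HE velE tenW_Y_to_A.
    rewrite /r wE.
    by notypeclasses refine (is_derive_eq _ _); [der|].
  apply/esym; apply: (scalarD (scalar_qHW i k) dPsi).
  apply: (is_derive_ext (f1 := fun x => qH x * stressA x i k) Dq).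
    by move=> x Dx; rewrite qHW_Y_to_A.
  notypeclasses refine (is_derive_eq _ _); [der|cbv beta].
  rewrite -[dmx stressA w q]/(dstressA q w) (dstressA_dflux P j v Dq) [X in _ * X]mxE.
  by rewrite /r mulrA.
- have [dy4 dy4w] := (is_derive_exp 3 dy, is_derive_exp 3 dyw).
  pose r := qH q * vel q 0 j * (4 * scaw q ^+ 3 * dscaw q v) + scaw q ^+ 4 * qH w.
  transitivity r.
    apply: (scalarD scalar_qHw dcomp).
    apply: (is_derive_ext (f1 := fun x => qH x * vel x 0 j * scaw x ^+ 4) Dq).
      by move=> x Dx; rewrite /fA /= qHw_flux HE velE scaw_Y_to_A.
    rewrite /r wE.
    by notypeclasses refine (is_derive_eq _ _); [der|].
  apply/esym; apply: (scalarD scalar_qHw dPsi).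
  apply: (is_derive_ext (f1 := fun x => qH x * scaw x ^+ 4) Dq).
    by move=> x Dx; rewrite qHw_pack.
  notypeclasses refine (is_derive_eq _ _); [der|cbv beta].
  rewrite -[(qHw w - _) / _]/(dscaw q w) (dscaw_dflux P j v Dq) /r; ring.
Qed.

Lemma sym_offdiag (M : 'M[R]_2) : M^T = M -> M 1 0 = M 0 1.
Proof. by move=> e; rewrite -{1}e mxE. Qed.

Let trB (M N : 'M[R]_2) : (M - N)^T = M^T - N^T. Proof. by rewrite linearB. Qed.
Let trD (M N : 'M[R]_2) : (M + N)^T = M^T + N^T. Proof. by rewrite linearD. Qed.
Let trZ (c : R) (M : 'M[R]_2) : (c *: M)^T = c *: M^T. Proof. by rewrite linearZ. Qed.

Section Rate.
Context (q : 'rV[R]_11) (Dq : D q) (detF : \det (defF q) != 0).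
Let A := stressA q.
Let Y := tenW q.
Let C := (defF q)^T *m defF q.

Let uA : A \in unitmx. Proof. exact/spd2_unit/stressA_spd. Qed.
Let uC : C \in unitmx.
Proof. by rewrite unitmx_mul unitmx_tr !unitmxE !unitfE detF. Qed.
Let sA : A^T = A. Proof. by case: (stressA_spd Dq). Qed.
Let sCi : (invmx C)^T = invmx C.
Proof. by rewrite trmx_inv /C trmx_mul trmxK. Qed.

(** With [C = F^T F], [Z = C^-1 A + A C^-1] and [Y^-1 = A A]; the inverses of products disappear. *)
Lemma Y_rateE : Y_rate P q = - (rlx P)^-1 *:
  (Y *m (invmx C *m A + A *m invmx C - 2 *: (A *m A)) *m Y).
Proof.
have e1 : invmx (invmx A *m (defF q)^T *m defF q) = invmx C *m A.
  rewrite -(mulmxA (invmx A)); apply: invmx_right.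
  by rewrite -(mulmxA (invmx A)) (mulmxA _ (invmx C)) (mulmxV uC) mul1mx mulVmx.
have e2 : invmx ((defF q)^T *m defF q *m invmx A) = A *m invmx C.
  apply: invmx_right.
  by rewrite -(mulmxA _ (invmx A)) (mulmxA (invmx A)) mulVmx // mul1mx (mulmxV uC).
have e3 : invmx Y = A *m A by apply: esym; exact: stressA_sqr.
exact: (congr1 (fun M => - (rlx P)^-1 *: (Y *m M *m Y))
  (congr2 (fun M N => M - 2 *: N) (congr2 (fun M N => M + N) e1 e2) e3)).
Qed.

(** A packed state stores three entries of the matrix, so the rate is recovered from the source only
    if it is symmetric. *)
Lemma Y_rate_sym : Y_rate P q 1 0 = Y_rate P q 0 1.
Proof.
have sY : Y^T = Y by case: (Dq) => _ [].
apply: sym_offdiag; rewrite Y_rateE trZ; congr (_ *: _).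
rewrite !trmx_mul sY trB trD trZ !trmx_mul sA sCi mulmxA.
by rewrite [A *m invmx C + _]addrC.
Qed.

(** [A A] cancels the outer factors [Y], leaving [C^-1 A + A C^-1 - 2 A A] over [lambda], which is
    [A E + E A]. The factor 2 in [Y_rate] is this doubled [A A]. *)
Lemma relaxation_lyapunov (E := (rlx P)^-1 *: (invmx C - A)) :
  A *m E + E *m A = - (A *m A *m Y_rate P q *m (A *m A)).
Proof.
have uY : Y \in unitmx by case: (Dq) => _ /spd2_unit.
have AAY : A *m A *m Y = 1%:M by rewrite stressA_sqr // mulVmx.
have YAA : Y *m (A *m A) = 1%:M by rewrite stressA_sqr // mulmxV.
have -> : A *m A *m Y_rate P q *m (A *m A)
    = - ((rlx P)^-1 *: (invmx C *m A + A *m invmx C - 2 *: (A *m A))).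
  rewrite Y_rateE -scalemxAr -scalemxAl scaleNr; congr (- (_ *: _)).
  rewrite -(mulmxA Y) (mulmxA (A *m A)) AAY mul1mx -mulmxA YAA.
  exact: mulmx1.
rewrite opprK /E -scalemxAr -scalemxAl -scalerDr.
congr (_ *: _); rewrite mulmxBr mulmxBl scaler_nat mulr2n opprD addrACA.
by rewrite [A *m invmx C + _]addrC.
Qed.

Lemma source_conjugacy (x : 'rV[R]_2) : source (A_system P) x (Y_to_A q)
  = 'D_(source (Y_system P (Y_rate P)) x q) (@Y_to_A R) q.
Proof.
have h0 := admissible_qH Dq; have [_ _ yp] := Dq.
have dPsi := smooth_differentiable smooth_Y_to_A Dq.
set s := source (Y_system P (Y_rate P)) x q.
have sH : qH s = 0 by exact: qH_pack.
have dY : dmx tenW s q = Y_rate P q.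
  apply/matrixP => i j; rewrite mxE; have [_ e] := is_derive_tenW s Dq i j.
  apply: (etrans e); rewrite sH mulr0 subr0 /s /source /= /source_with qHW_pack.
  have sR : (qH q *: Y_rate P q) 1 0 = (qH q *: Y_rate P q) 0 1.
    by rewrite [LHS]mxE [RHS]mxE Y_rate_sym.
  by rewrite (vecsym_symvec sR) [X in X / _]mxE mulrAC divff // mul1r.
have sE : ((rlx P)^-1 *: (invmx C - A)) 1 0 = ((rlx P)^-1 *: (invmx C - A)) 0 1.
  by apply: sym_offdiag; rewrite trZ trB sCi sA.
have dA : dmx stressA s q = (rlx P)^-1 *: (invmx C - A).
  by apply: dmx_stressA_uniq; rewrite ?dY ?relaxation_lyapunov.
apply: state_eq.
- apply/esym; apply: (etrans (scalarD scalar_qH dPsi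
    (is_derive_ext Dq (fun y _ => esym (qH_Y_to_A y))
      (is_derive_linear q s scalar_qH)))).
  by rewrite sH; exact/esym/qH_pack.
- apply/rowP => i; apply/esym; apply: (etrans (scalarD (scalar_qHU i) dPsi
    (is_derive_ext Dq (fun y _ => esym (congr1 (fun m : 'rV[R]_2 => m 0 i) (qHU_Y_to_A y)))
      (is_derive_linear q s (scalar_qHU i))))).
  by rewrite /s /= /source_with !qHU_pack qH_Y_to_A vel_Y_to_A.
- apply/matrixP => i k; apply/esym; apply: (etrans (scalarD (scalar_qHF i k) dPsi
    (is_derive_ext Dq (fun y _ => esym (congr1 (fun m : 'M[R]_2 => m i k) (qHF_Y_to_A y)))
      (is_derive_linear q s (scalar_qHF i k))))).
  by rewrite /s /= /source_with !qHF_pack.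
- apply/matrixP => i k; apply/esym; apply: (scalarD (scalar_qHW i k) dPsi).
  apply: (is_derive_ext (f1 := fun y => qH y * stressA y i k) Dq).
    by move=> y Dy; rewrite qHW_Y_to_A.
  have dh : is_derive q s (@qH R) (qH s) by exact: is_derive_linear scalar_qH.
  have dAik := is_derive_stressA s Dq i k.
  notypeclasses refine (is_derive_eq _ _); [der|cbv beta].
  rewrite sH mulr0 addr0 dA /= /source_with qHW_pack vecsym_symvec.
    by rewrite qH_Y_to_A defF_Y_to_A tenW_Y_to_A // [RHS]mxE.
  by rewrite defF_Y_to_A tenW_Y_to_A // [LHS]mxE [RHS]mxE sE.
- apply/esym; apply: (scalarD scalar_qHw dPsi).
  apply: (is_derive_ext (f1 := fun y => qH y * scaw y ^+ 4) Dq).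
    by move=> y Dy; rewrite qHw_pack.
  have dh : is_derive q s (@qH R) (qH s) by exact: is_derive_linear scalar_qH.
  have dy := is_derive_scaw s Dq.
  notypeclasses refine (is_derive_eq _ _); [der|cbv beta].
  (* The factor [4 y^3] from the derivative of [y^4] cancels the 4 and the [y^-3] in the rate of
     [Y^cc]. *)
  rewrite sH /s /= /source_with !qHw_pack qH_Y_to_A scaw_Y_to_A // /stressAcc.
  have y0 : scaw q != 0 by rewrite gt_eqF.
  (* At [lambda = 0] both sides vanish by the convention [0^-1 = 0]. *)
  have [l0|l0] := eqVneq (rlx P) 0; last by field; rewrite h0 y0 l0.
  by rewrite l0 mulr0 invr0 !(mulr0, mul0r, subrr, addr0).
Qed.

End Rate.

Section Solutions.
Context (Om : set 'rV[R]_3) (oOm : open Om).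

Lemma smooth_state_comp (f : 'rV[R]_11 -> 'rV[R]_11) (q : 'rV[R]_3 -> 'rV[R]_11) :
  (forall p, Om p -> D (q p)) -> smooth_on Om q -> smooth_on D f ->
  smooth_on Om (f \o q).
Proof.
move=> Dq sq sf; apply: (smooth_row oOm) => k.
exact: (smooth_comp oOm (f := fun x => f x 0 k) Dq sq (smooth_coord oD k sf)).
Qed.

Lemma balance_conjugacy (q : 'rV[R]_3 -> 'rV[R]_11) p :
  (forall p, Om p -> D (q p)) -> smooth_on Om q -> Om p ->
  dt (@Y_to_A R \o q) p + \sum_(j < 2) dx j (fA j \o (@Y_to_A R \o q)) p
  = 'D_(dt q p + \sum_(j < 2) dx j (fY j \o q) p) (@Y_to_A R) (q p).
Proof.
move=> Dq sq Omp; have Dp := Dq p Omp.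
have dq := smooth_differentiable sq Omp.
have dPsi := smooth_differentiable smooth_Y_to_A Dp.
rewrite (derive_dirD _ _ dPsi) (derive_dir_sum _ _ dPsi).
apply: (congr2 (fun a b => a + b)).
  exact: (derive_chain (unitv ord0) dq dPsi).
apply: eq_bigr => j _.
have dfA := smooth_differentiable (smooth_A_flux j) (Y_to_A_admissible Dp).
have dfY := smooth_differentiable (smooth_Y_flux P (Y_rate P) j) Dp.
have e1 := derive_chain (unitv (lift ord0 j)) dq (differentiable_comp dPsi dfA).
apply: (etrans e1); apply: (etrans (flux_conjugacy j _ Dp)).
apply: (congr1 (fun w => 'D_w (@Y_to_A R) (q p))).
exact/esym/(derive_chain (unitv (lift ord0 j)) dq dfY).
Qed.

End Solutions.

End Conjugacy.

End ChangeOfVariables.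

(** * Bijection between the solutions of the two systems *)

Section SolutionBijection.
Context {R : realType} (P : physics R) (Hhat_gt0 : 0 < Hhat P).
Context (Om : set 'rV[R]_3) (oOm : open Om).
Let Ysys := Y_system P (Y_rate P).
Let Asys := A_system P.

Lemma smooth_solution_ext (S : @balance_law R 11) (q q' : 'rV[R]_3 -> 'rV[R]_11) :
  (forall p, Om p -> q p = q' p) ->
  smooth_solution P S Om q -> smooth_solution P S Om q'.
Proof.
move=> e [sq Dq det Sq]; split=> [|p Omp|p Omp|p Omp].
- exact (smooth_ext oOm e sq).
- by rewrite -e //; exact: Dq.
- by rewrite -e //; exact: det.
have eS j x : Om x -> (flux S j \o q) x = (flux S j \o q') x.
  by move=> Omx; rewrite /= e.
have e1 : dt q p = dt q' p := derive_ext oOm _ e Omp.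
have e2 : \sum_(j < 2) dx j (flux S j \o q) p = \sum_(j < 2) dx j (flux S j \o q') p.
  by apply: eq_bigr => j _; exact: (derive_ext oOm _ (eS j) Omp).
by rewrite -e1 -e2 -(e p Omp); exact: Sq.
Qed.

Let det_neq0 (q : 'rV[R]_11) : qH q * \det (defF q) = Hhat P ->
  \det (defF q) != 0.
Proof.
by move=> E; apply: contraTneq Hhat_gt0 => z; rewrite -E z mulr0 ltxx.
Qed.

Lemma Y_to_A_solution (q : 'rV[R]_3 -> 'rV[R]_11) :
  smooth_solution P Ysys Om q -> smooth_solution P Asys Om (@Y_to_A R \o q).
Proof.
move=> [sq Dq det Sq]; split=> [|p Omp|p Omp|p Omp].
- exact (smooth_state_comp oOm Dq sq (@smooth_Y_to_A R)).
- exact/Y_to_A_admissible/Dq.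
- by rewrite /= qH_Y_to_A defF_Y_to_A; exact: det.
have e1 := balance_conjugacy P Dq sq Omp.
have e2 := congr1 (fun w => 'D_w (@Y_to_A R) (q p)) (Sq p Omp).
have e3 := source_conjugacy P (Dq p Omp) (det_neq0 (det p Omp)) (space_of p).
exact (etrans e1 (etrans e2 (esym e3))).
Qed.

Lemma A_to_Y_solution (a : 'rV[R]_3 -> 'rV[R]_11) :
  smooth_solution P Asys Om a -> smooth_solution P Ysys Om (@A_to_Y R \o a).
Proof.
move=> sol; have [sa Da det Sa] := sol.
have Dq p (Omp : Om p) : admissible ((@A_to_Y R \o a) p) := A_to_Y_admissible (Da p Omp).
have sq : smooth_on Om (@A_to_Y R \o a).
  exact (smooth_state_comp oOm Da sa (@smooth_A_to_Y R)).
have detq p : Om p -> qH ((@A_to_Y R \o a) p) * \det (defF ((@A_to_Y R \o a) p)) = Hhat P.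
  move=> Omp; rewrite -(det p Omp) /= /defF.
  by rewrite qH_A_to_Y qHF_A_to_Y.
(* It suffices to compare both sides of the balance law after the injective differential, where the
   law becomes that of [Y_to_A \o (A_to_Y \o a)]. This function agrees with [a] only on [Om], but
   [Om] is open, so its derivatives there agree as well. *)
split=> // p Omp; apply: (derive_Y_to_A_inj (Dq p Omp)).
apply: (etrans (esym (balance_conjugacy P Dq sq Omp))).
apply: (etrans _ (source_conjugacy P (Dq p Omp) (det_neq0 (detq p Omp)) _)).
have K x : Om x -> a x = (@Y_to_A R \o (@A_to_Y R \o a)) x.
  by move=> Omx; rewrite /= A_to_YK //; exact: Da.
have [_ _ _ SK] := smooth_solution_ext K sol.
exact: SK.
Qed.

(** Restriction to [Om] with a default value outside makes a solution on [Om] a single function, so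
    that injectivity is an equality of functions. *)
Lemma solution_bijection : set_bij
  [set q | smooth_solution P Ysys Om q /\ q \_ Om = q]
  [set a | smooth_solution P Asys Om a /\ a \_ Om = a]
  (fun q => (@Y_to_A R \o q) \_ Om).
Proof.
have restr (f : 'rV[R]_3 -> 'rV[R]_11) p : Om p -> (f \_ Om) p = f p.
  by move=> Omp; rewrite patchE mem_set.
have restrC (f : 'rV[R]_3 -> 'rV[R]_11) : (f \_ Om) \_ Om = f \_ Om.
  by apply/funext => p; rewrite !patchE; case: (p \in Om).
split.
- move=> q [sol _] /=; split; last exact: restrC.
  apply: smooth_solution_ext (Y_to_A_solution sol) => p Omp.
  by rewrite restr.
- move=> q q'; rewrite !inE => -[[_ Dq _ _] eq] [[_ Dq' _ _] eq'] e.
  rewrite -eq -eq'; apply/funext => p; rewrite !patchE; case: ifP => // Omp.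
  have {}Omp : Om p by apply: set_mem.
  have := congr1 (fun f => f p) e; rewrite !restr //= => ep.
  by rewrite -(Y_to_AK (Dq p Omp)) -(Y_to_AK (Dq' p Omp)) ep.
- move=> a [sol ea]; exists ((@A_to_Y R \o a) \_ Om).
    split; last exact: restrC.
    apply: smooth_solution_ext (A_to_Y_solution sol) => p Omp.
    by rewrite restr.
  have [_ Da _ _] := sol.
  rewrite -ea; apply/funext => p; rewrite !patchE; case: ifP => // Omp.
  have {}Omp : Om p by apply: set_mem.
  by rewrite /= ea restr //= A_to_YK //; exact: Da.
Qed.

End SolutionBijection.

Lemma admissible_bijection (R : realType) :
  set_bij (@admissible R) (@admissible R) (@Y_to_A R).
Proof.
split=> [q|q q'|a Da].
- exact: Y_to_A_admissible.
- by rewrite !inE => Dq Dq' e; rewrite -(Y_to_AK Dq) -(Y_to_AK Dq') e.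
- by exists (A_to_Y a); [exact: A_to_Y_admissible|exact: A_to_YK].
Qed.

Theorem proposition4p4 (R : realType) (P : physics R)
  (g_gt0 : 0 < grav P) (G_gt0 : 0 < elas P) (lambda_gt0 : 0 < rlx P)
  (Hhat_gt0 : 0 < Hhat P) (zb_smooth : smooth_on setT (zb P)) :
  (* bijection between the smooth solutions on Om, encoded as functions
     extended by a default value outside Om *)
  (forall Om : set 'rV[R]_3, open Om ->
     set_bij
       [set q | smooth_solution P (Y_system P (Y_rate P)) Om q /\ q \_ Om = q]
       [set a | smooth_solution P (A_system P) Om a /\ a \_ Om = a]
       (fun q => (Y_to_A \o q) \_ Om))
  /\ set_bij (@admissible R) (@admissible R) Y_to_A
  /\ (forall rY : 'rV[R]_11 -> 'M[R]_2, rY = Y_rate P \/ rY = Y_rate_printed P ->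
      let S := Y_system P rY in
      (exists Dt : 'rV[R]_11 -> R,
         strictly_convex_extension (motion_solution P S) (@admissible R)
           (energy P) (energy_flux P) (energy_source P Dt))
      /\ mathematical_entropy (motion_solution P S) (@admissible R) (energy P)
      /\ symmetric_hyperbolic (motion_solution P S) S piola (@admissible R)).
Proof.
split; first by move=> Om oOm; exact: solution_bijection.
split=> [|rY _ S]; first exact: admissible_bijection.
have ext := energy_extension g_gt0 G_gt0 Hhat_gt0 rY.
split; first by exists (dissipation P rY).
split; last exact: Y_symmetric_hyperbolic.
by exists (energy_flux P), (energy_source P (dissipation P rY)).
Qed.
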